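(* For every $\varepsilon>0$ there is a constant $c_\varepsilon>0$ such that the following holds for every $0<\delta\leq 1$. Let $p_1,\ldots,p_n$ be a set of points in $[0,1]^2$ and, for each $j$, let $T_j$ be a $\delta$-tube through $p_j$. Let $P=\{p_1,\ldots,p_n\}$ and $\mathbb{T}=\{T_1,\ldots,T_n\}$, regarded as indexed families. Then $$I(P,\mathbb{T})\geq c_\varepsilon\,\delta^{3/2+\varepsilon}\,|P|\,|\mathbb{T}|.$$
   Context: A $\delta$-tube is the $\delta$-neighborhood in $\mathbb{R}^2$ of a line (its central line). A tube $T$ is ''through'' a point $p$ if the central line of $T$ passes through $p$. $I(P,\mathbb{T})$ is the number of incidences, i.e. the number of index pairs $(j,k)\in\{1,\ldots,n\}^2$ with $p_j\in T_k$ (the pairs $j=k$ are included); families are counted with multiplicity, so $|P|=|\mathbb{T}|=n$. *)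

(* Defs.v *)
From HB Require Import structures.
From mathcomp Require Import all_boot all_order all_algebra.
From mathcomp Require Import all_classical all_reals all_analysis.

Set Implicit Arguments.
Unset Strict Implicit.
Unset Printing Implicit Defensive.

Import Order.TTheory GRing.Theory Num.Theory.
Import numFieldNormedType.Exports.

Local Open Scope classical_set_scope.
Local Open Scope ring_scope.

(* The library norm on 'rV[R]_2 is the sup norm, hence a separate Euclidean
   distance. *)
Definition edist (R : realType) (x y : 'rV[R]_2) : R :=
  Num.sqrt (\sum_(i < 2) (x 0 i - y 0 i) ^+ 2).

Definition unit_square (R : realType) : set 'rV[R]_2 :=
  [set x | forall i, 0 <= x 0 i <= 1].

Definition is_line (R : realType) (L : set 'rV[R]_2) : Prop :=
  exists a v : 'rV[R]_2, v != 0 /\ L = [set a + t *: v | t in [set: R]].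

(* Neighborhoods are open: x is in it iff its distance to A is < delta. *)
Definition neighborhood (R : realType) (delta : R) (A : set 'rV[R]_2) :
    set 'rV[R]_2 :=
  [set x | exists2 y, A y & edist x y < delta].

Definition tube_with_central_line (R : realType) (delta : R)
    (T L : set 'rV[R]_2) : Prop :=
  is_line L /\ T = neighborhood delta L.

(* For delta > 0 the central line of T is determined by T. *)
Definition tube_through (R : realType) (delta : R) (T : set 'rV[R]_2)
    (p : 'rV[R]_2) : Prop :=
  exists2 L, tube_with_central_line delta T L & L p.

Definition incidences (R : realType) (m n : nat) (p : 'I_m -> 'rV[R]_2)
    (T : 'I_n -> set 'rV[R]_2) : nat :=
  #|[pred jk : 'I_m * 'I_n | p jk.1 \in T jk.2]|.

(* Main.v *)
(* A point p = (x, y) with a line of slope m through it is a flag (x, m, y), and p_j lies in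
   T_k as soon as |y_j - y_k - m_k (x_j - x_k)| < delta.  Take Q = 2^l with M fixed and
   delta ~ Q^-M, cover the flags at each level (i, j) by sheared boxes of size Q^-i in x,
   Q^-j in m and Q^-(i+j) in y, let N(i, j) be the number of nonempty boxes, and pass to a
   subfamily whose boxes have at most about the average number of elements.  Inside a box the
   rescaled flags are again flags in the unit cube.  There a direct count bounds the number of
   incidences at scale Q^-h from below, and a high-low inequality carries this bound down to
   the final scale, unless N(i+h', j) N(i, j+h') is small for some h' >= h.  So, with
   g = log_Q N and J the logarithm of the reciprocal density of incidences, each box level
   and each h give either an upper bound on J or an upper bound on
   g(i+h', j) + g(i, j+h') - 2 g(i, j) - 3 h'.  If J > (3/2 + eps) M, follow
   g - (3/2 + eps)(i + j) from its minimum: the second alternative, holding everywhere,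
   makes a bounded-slope function strictly convex at large scale, which is absurd. *)

Require Import Defs.
From mathcomp Require Import all_boot all_order all_algebra.
From mathcomp Require Import all_classical all_reals all_analysis.
From mathcomp Require Import ring lra zify.

Set Implicit Arguments.
Unset Strict Implicit.
Unset Printing Implicit Defensive.

Import Order.TTheory GRing.Theory Num.Theory.
Import numFieldNormedType.Exports.

Local Open Scope ring_scope.

(** * A discrete convexity argument *)

(* [lia] becomes very slow when inequalities between reals are in the context. *)
Ltac nlia :=
  repeat match goal with
  | H : is_true (Order.le _ _) |- _ => clear H
  | H : is_true (Order.lt _ _) |- _ => clear H
  end; lia.

(** The threshold 3/2 is half of the coefficient 3 in the second alternative. Inside a box the
    proportion of incident pairs at relative scale $Q^{-s}$ should be about $Q^{-s}$, divided by the
    ratio whose logarithm is the mixed difference of g. The error of a high-low step is governed by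
    the square root of $Q^s$ times the largest point cell times the largest line cell, and in a
    uniform family these sizes are reciprocal to N(i+s, j) and N(i, j+s). The main term wins,
    roughly, once the product of these two counts exceeds $N(i,j)^2 Q^{3s}$ times the square of that
    ratio.

    The obstacle is that the step h' where this fails has no upper bound, so second differences of
    one fixed length are not directly available. They are recovered on columns running in direction
    (1, 1), by comparing minima over all later positions.

    The order of the choices matters: M depends on eps only, and Q is large afterwards. Losses that
    are bounded powers of Q, with exponents independent of M, become additive constants for g and J,
    and eps M dominates them. *)

Lemma sum_second_differences (R : realType) (F : nat -> R) (e : R) (n : nat) :
  (forall r, (r < n)%N -> e <= F r.+2 - 2 * F r.+1 + F r) ->
  n%:R * e <= F n.+1 - F n - (F 1 - F 0).
Proof.
elim: n => [|n IH] H; first by rewrite mul0r subrr.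
have := IH (fun r hr => H r (ltnW hr)); have := H n (ltnSn n).
by rewrite -natr1; lra.
Qed.

Lemma nat_above (R : realType) (a : R) : exists n : nat, a <= n%:R.
Proof.
by exists (Num.bound `|a|); rewrite (le_trans (ler_norm a)) // ltW // archi_boundP.
Qed.

Lemma geometric_decay (R : realType) (K : nat) (theta : R) :
  (0 < K)%N -> 0 < theta ->
  exists J : nat, (K%:R : R) ^+ J < theta * K.+1%:R ^+ J.
Proof.
move=> K0 th0; have K0' : 0 < K%:R :> R by rewrite ltr0n.
have Ki : 0 < (K%:R : R)^-1 by rewrite invr_gt0.
have bern J : 1 + J%:R / K%:R <= (K.+1%:R / K%:R : R) ^+ J.
  have -> : (K.+1%:R / K%:R : R) = 1 + K%:R^-1.
    by rewrite -natr1 mulrDl divff ?gt_eqF // div1r.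
  elim: J => [|J IH]; first by rewrite mul0r addr0 expr0.
  rewrite exprS -natr1; have J0 : 0 <= J%:R :> R by rewrite ler0n.
  by nra.
have [J HJ] := nat_above (K%:R * theta^-1).
exists J; have := bern J; rewrite expr_div_n => h.
have h2 : theta^-1 < K.+1%:R ^+ J / K%:R ^+ J.
  apply: lt_le_trans h; rewrite ltr_pwDl // ler_pdivlMr // mulrC //.
rewrite ltr_pdivlMr ?exprn_gt0 // in h2.
by rewrite -ltr_pdivrMl // mulrC mulrC.
Qed.

Definition hits (S : pred nat) (a L : nat) : nat := \sum_(a <= X < a + L) S X.

Lemma hits_le (S : pred nat) a L : (hits S a L <= L)%N.
Proof.
rewrite /hits; apply: (@leq_trans (\sum_(a <= X < a + L) 1)%N).
  by apply: leq_sum => i _; case: (S i).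
by rewrite sum_nat_const_nat addKn muln1.
Qed.

Lemma hits_split (S : pred nat) a K d :
  hits S a (K * d) = (\sum_(r < K) hits S (a + r * d) d)%N.
Proof.
elim: K => [|K IH]; first by rewrite big_ord0 /hits mul0n addn0 big_geq.
rewrite big_ord_recr /= -IH /hits.
rewrite (@big_cat_nat _ _ _ (a + K * d)) ?leq_addr //=; last by lia.
by congr (_ + _)%N; congr bigop; rewrite /index_iota; f_equal; lia.
Qed.

Lemma hits_gt0 (S : pred nat) a d :
  (0 < hits S a d)%N -> exists X, S X /\ (a <= X < a + d)%N.
Proof.
rewrite /hits => h.
have : has S (index_iota a (a + d)).
  apply: contraLR h; rewrite -leqNgt leqn0 => /hasPn h.
  by rewrite big_seq big1 // => i /h /negbTE ->.
by move=> /hasP [X]; rewrite mem_index_iota => ? ?; exists X.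
Qed.

(* If every block missed one of its [K.+1] children, the density would decay
   geometrically. *)
Lemma dense_block (S : pred nat) K d0 J a :
  (K ^ J * d0 < hits S a (K.+1 ^ J * d0))%N ->
  exists b d, [/\ (d0 <= d)%N, (a <= b)%N, (b + K.+1 * d <= a + K.+1 ^ J * d0)%N
    & forall r, (r < K.+1)%N ->
        exists X, S X /\ (b + r * d <= X < b + r * d + d)%N].
Proof.
elim: J a => [|J IH] a.
  by rewrite !expn0 !mul1n ltnNge hits_le.
rewrite !expnS -!mulnA; set d := (K.+1 ^ J * d0)%N => h.
have d0d : (d0 <= d)%N by rewrite /d leq_pmull // expn_gt0.
case: (altP (@forallP 'I_K.+1 (fun r => 0 < hits S (a + r * d) d)%N)) => [all|].
  exists a, d; split=> // r rK.
  by have /hits_gt0 := all (Ordinal rK).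
rewrite negb_forall => /existsP [r0]; rewrite lt0n negbK => /eqP hr0.
(* With the child [r0] empty, only [K] children share more than [K * (K ^ J * d0)] hits, so one of
   them exceeds [K ^ J * d0]. *)
have [r hr] : exists r : 'I_K.+1, (K ^ J * d0 < hits S (a + r * d) d)%N.
  apply/existsP; apply: contraLR h; rewrite negb_exists -leqNgt => /forallP hall.
  rewrite hits_split (bigD1 r0) //= hr0 add0n.
  apply: leq_trans (_ : \sum_(i < K.+1 | i != r0) (K ^ J * d0) <= _)%N.
    by apply: leq_sum => i _; rewrite leqNgt.
  rewrite sum_nat_const cardC1 card_ord mulnC //.
have [b [e [h1 h2 h3 h4]]] := IH _ hr.
exists b, e; split => //; first by rewrite (leq_trans _ h2) ?leq_addr.
apply: (leq_trans h3); have := ltn_ord r.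
by rewrite -/d => hrK; rewrite -addnA leq_add2l -mulSnr leq_mul2r hrK orbT.
Qed.

(** * Future minima along columns *)

Definition fmin (R : realType) (phi : nat -> R) (T t : nat) : R :=
  phi [arg min_(i < @ord_max T | (t <= i)%N) phi i]%O.

Lemma fmin_le (R : realType) (phi : nat -> R) T t t' :
  (t <= t' <= T)%N -> fmin phi T t <= phi t'.
Proof.
case/andP=> tt' t'T; rewrite /fmin; case: arg_minP => [|i ti Hi] /=.
  exact: leq_trans t'T.
by have := Hi (inord t'); rewrite inordK ?ltnS //; apply.
Qed.

Lemma fmin_attained (R : realType) (phi : nat -> R) T t : (t <= T)%N ->
  exists2 t', (t <= t' <= T)%N & fmin phi T t = phi t'.
Proof.
move=> tT; rewrite /fmin; case: arg_minP => [|i ti Hi] //=.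
by exists i => //; rewrite ti -ltnS ltn_ord.
Qed.

(** Between [t] and [t.+1] the future minimum can increase only if it is attained at [t] itself, and
    then by at most one step [C] of [phi]. Large total growth therefore forces many times at which
    [phi] equals its future minimum. *)
Lemma fmin_growth (R : realType) (phi : nat -> R) T C t : 0 <= C ->
  (forall s, (s < T)%N -> phi s.+1 <= phi s + C) -> (t <= T)%N ->
  fmin phi T t - fmin phi T 0 <= C * (\sum_(s < t) (phi s == fmin phi T s))%:R.
Proof.
move=> C0 HC; elim: t => [|t IH] tT; first by rewrite big_ord0 subrr mulr0.
rewrite big_ord_recr natrD mulrDr /=; have := IH (ltnW tT).
set a := C * _ => h; suff : fmin phi T t.+1 <= fmin phi T t + C * (phi t == fmin phi T t)%:R.
  by lra.
case: eqP => [e|ne] /=.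
  rewrite mulr1 -e (le_trans (@fmin_le _ phi T t.+1 t.+1 _)) ?leqnn //.
  exact: HC.
rewrite mulr0 addr0; have [t' /andP[tt' t'T] e] := @fmin_attained _ phi T t (ltnW tT).
rewrite e fmin_le // t'T andbT ltn_neqAle tt' andbT.
by apply/eqP => e'; apply: ne; rewrite e e'.
Qed.

Section Columns.
Variables (R : realType) (U0 Lt : nat) (G : nat -> nat -> R).
Hypothesis G00 : G 0 0 = 0.
Hypothesis Gu : forall u v, (u + v < Lt)%N -> `|G u.+1 v - G u v| <= 5.
Hypothesis Gv : forall u v, (u + v < Lt)%N -> `|G u v.+1 - G u v| <= 5.

(* The point of column [X] that is [t] steps above the antidiagonal [u + v = U0]. *)
Definition gam (X t : nat) : R := G (U0 - X + t) (X + t).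
(** Since [G] is nonnegative, the tilt forces every column to grow at rate at least [k / 2], hence
    also its future minimum. It costs only part of the gain [k * h'] in [bad]. *)
Definition tgam (k : R) (X t : nat) : R := gam X t + k / 2 * t%:R.

Lemma G_le u v : (u + v <= Lt)%N -> G u v <= 5 * (u + v)%:R.
Proof.
elim: u => [|u IH].
  elim: v => [|v IH] h; first by rewrite G00 mulr0.
  have := IH (ltnW h); have := @Gv 0 v h; rewrite ler_norml !add0n -natr1; lra.
move=> h; have := IH (ltnW h); have := Gu h.
by rewrite ler_norml addSn -natr1; lra.
Qed.

Lemma gam_step X t : (X < U0)%N -> (U0 + 2 * t <= Lt)%N ->
  `|gam X.+1 t - gam X t| <= 10.
Proof.
move=> XU tL; rewrite /gam.
have -> : (U0 - X + t = (U0 - X.+1 + t).+1)%N by lia.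
have := @Gu (U0 - X.+1 + t) (X + t) ltac:(lia).
have := @Gv (U0 - X.+1 + t) (X + t) ltac:(lia).
by rewrite addSn !ler_norml; lra.
Qed.

Lemma gam_lip X d t : (X + d <= U0)%N -> (U0 + 2 * t <= Lt)%N ->
  `|gam (X + d) t - gam X t| <= 10 * d%:R.
Proof.
elim: d => [|d IH] h tL; first by rewrite addn0 subrr normr0 mulr0.
rewrite addnS; have := IH ltac:(lia) tL.
have := @gam_step (X + d) t ltac:(lia) tL.
by rewrite -natr1 !ler_norml; lra.
Qed.

End Columns.

Section Merge.
Variables (R : realType) (k : R) (U0 T1 P L Lt h0 : nat) (G : nat -> nat -> R).
Hypotheses (k0 : 0 < k) (k1 : k <= 1).
Hypothesis HL : L = (U0 + 2 * T1 + 2 * P)%N.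
Hypothesis LLt : (L <= Lt)%N.
Hypothesis HP : 5 * (U0 + 2 * T1)%:R + k / 2 * U0%:R <= k / 2 * P%:R.
Hypothesis UP : (U0 <= P)%N.
Hypothesis Gge0 : forall u v, (u + v <= Lt)%N -> 0 <= G u v.
Hypothesis G00 : G 0 0 = 0.
Hypothesis Gu : forall u v, (u + v < Lt)%N -> `|G u.+1 v - G u v| <= 5.
Hypothesis Gv : forall u v, (u + v < Lt)%N -> `|G u v.+1 - G u v| <= 5.
Hypothesis bad : forall u v h, (h0 <= h)%N -> (u + v + 2 * h <= L)%N ->
  exists h', [/\ (h <= h')%N, (u + v + h' <= Lt)%N &
    k * h'%:R + (G (u + h') v + G u (v + h')) / 2
      <= G (u + h) v + G u (v + h) - G (u + h) (v + h)].

(** Both neighbouring columns at time [t] are reached from [(u, v)] by moves of length [2 * h], but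
    [bad] at [2 * h] would compare them with an uncontrolled step [h']. It is applied instead at the
    minimizer [h1] of [psi]: then [psi h1 <= psi h'] whatever [h'] is, and the opposite corner
    [(u + h1, v + h1)] still lies on column [X]. *)
Lemma merge X h t : (h0 <= h)%N -> (h <= X)%N -> (X + h <= U0)%N -> (t <= T1)%N ->
  exists2 t', (t <= t' <= T1 + P)%N &
    tgam U0 G k X t' <= (tgam U0 G k (X - h) t + tgam U0 G k (X + h) t) / 2 - k * h%:R.
Proof.
move=> hh hX XhU tT.
set u := (U0 - X - h + t)%N; set v := (X - h + t)%N.
set psi := fun j : nat => (G (u + j) v + G u (v + j)) / 2 + k / 2 * j%:R.
have [h1 /andP[h2 h3] h4] := @fmin_attained _ psi P (2 * h) ltac:(nlia).
have minpsi j : (2 * h <= j <= P)%N -> psi h1 <= psi j.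
  by move=> jP; rewrite -h4 fmin_le.
have eA : G (u + 2 * h) v = gam U0 G (X - h) t by rewrite /gam /u /v; congr G; nlia.
have eB : G u (v + 2 * h) = gam U0 G (X + h) t by rewrite /gam /u /v; congr G; nlia.
have psi2h : psi (2 * h)%N = (gam U0 G (X - h) t + gam U0 G (X + h) t) / 2 + k * h%:R.
  by rewrite /psi eA eB natrM; lra.
have psi2h_le : psi (2 * h)%N <= k / 2 * P%:R.
  apply: le_trans HP; rewrite /psi natrM.
  have := @G_le _ Lt G G00 Gu Gv (u + 2 * h) v ltac:(nlia).
  have := @G_le _ Lt G G00 Gu Gv u (v + 2 * h) ltac:(nlia).
  have -> : (u + 2 * h + v = U0 + 2 * t)%N by nlia.
  have -> : (u + (v + 2 * h) = U0 + 2 * t)%N by nlia.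
  have : ((U0 + 2 * t)%N%:R : R) <= (U0 + 2 * T1)%:R by rewrite ler_nat; nlia.
  have : k * (2 * h)%:R <= k * U0%:R.
    by rewrite ler_pM2l // ler_nat; nlia.
  by rewrite natrM; lra.
have [h' [hh' h'L Hbad]] := @bad u v h1 ltac:(nlia) ltac:(nlia).
have psih' : psi h1 <= psi h'.
  (* Beyond [P] the minimality of [h1] says nothing; there the tilt alone exceeds [psi] at [2 * h],
     which is what [HP] provides. *)
  have [h'P|Ph'] := leqP h' P; first by apply: minpsi; nlia.
  apply: le_trans (minpsi (2 * h)%N _) _; first by nlia.
  apply: le_trans psi2h_le _; rewrite /psi.
  have := Gge0 (u:=u + h') (v:=v) ltac:(nlia); have := Gge0 (u:=u) (v:=v + h') ltac:(nlia).
  have : k * P%:R <= k * h'%:R by rewrite ler_pM2l // ler_nat ltnW.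
  by lra.
have psi12 := minpsi (2 * h)%N ltac:(nlia).
exists (t + h1 - h)%N; first by nlia.
rewrite /tgam natrB; last by nlia.
have hh1 : k * h1%:R <= k * h'%:R by rewrite ler_pM2l // ler_nat.
have hh2 : k * (2 * h)%:R <= k * h1%:R by rewrite ler_pM2l // ler_nat.
rewrite psi2h in psi12; rewrite natrM in hh2; rewrite natrD.
rewrite /psi in psih' psi12.
have -> : gam U0 G X (t + h1 - h) = G (u + h1) (v + h1) by rewrite /gam /u /v; congr G; nlia.
have kh : 0 <= k * h%:R by rewrite mulr_ge0 ?ler0n // ltW.
by lra.
Qed.

End Merge.

Lemma hitsE (S : pred nat) L : hits S 0 L = (\sum_(X < L) S X)%N.
Proof. by rewrite /hits add0n big_mkord. Qed.

(* The alternative [bad] lets the value at a column drop strictly below the mean of two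
   neighbouring columns; on a block of columns that all attain their forward minimum
   near time [t] this makes the forward minimum strictly convex, which a Lipschitz
   function cannot be. *)
Lemma no_bad (R : realType) (k : R) (h0 : nat) : 0 < k -> k <= 1 ->
  exists L : nat, forall Lt (G : nat -> nat -> R), (L <= Lt)%N ->
    (forall u v, (u + v <= Lt)%N -> 0 <= G u v) -> G 0 0 = 0 ->
    (forall u v, (u + v < Lt)%N -> `|G u.+1 v - G u v| <= 5) ->
    (forall u v, (u + v < Lt)%N -> `|G u v.+1 - G u v| <= 5) ->
    ~ (forall u v h, (h0 <= h)%N -> (u + v + 2 * h <= L)%N ->
        exists h', [/\ (h <= h')%N, (u + v + h' <= Lt)%N &
          k * h'%:R + (G (u + h') v + G u (v + h')) / 2
            <= G (u + h) v + G u (v + h) - G (u + h) (v + h)]).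
Proof.
move=> k0 k1.
(* Ensures [40 * d <= k * h] for [h = H * d]. In the convexity step each of the two neighbours
   contributes an error [20 * d]. *)
have [H0 HH0] := nat_above (40 / k).
(* Then [n] second differences of size [k * h] add up to at least [21 * h], while two first
   differences bounded by [10 * h] allow only [20 * h]. *)
have [n Hn] := nat_above (21 / k).
have [H HE] : {H | H = H0.+1} by exists H0.+1.
(* A block of [Km.+1] children of length [d] has room for [n + 2] steps of length [h = H * d]. *)
have [Km KmE] : {Km | Km.+1 = ((n + 2) * H)%N}.
  by exists ((n + 2) * H).-1; rewrite HE; lia.
(* The guaranteed proportion of active times: by [20 * U0 <= k * T1] the future minimum of a column
   grows by at least [k / 4 * T1], and one step of a column is at most 11. *)
have th0 : 0 < k / 44 by rewrite divr_gt0.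
have Km0 : (0 < Km)%N.
  have : (40 <= H0)%N.
    by rewrite -(ler_nat R); apply: le_trans HH0; rewrite ler_pdivlMr //; lra.
  by lia.
have [J HJ] := geometric_decay Km0 th0.
have [d0 d0E] : {d0 | d0 = h0.+1} by exists h0.+1.
have [U0 U0E] : {U0 | U0 = (Km.+1 ^ J * d0)%N} by exists (Km.+1 ^ J * d0)%N.
have U0gt0 : (0 < U0)%N by rewrite U0E muln_gt0 expn_gt0 d0E.
have [T1 HT1] := nat_above (20 * U0%:R / k).
have [P0 HP0] := nat_above ((5 * (U0 + 2 * T1)%:R + k / 2 * U0%:R) / (k / 2)).
have [P PE] : {P | P = (P0 + U0)%N} by exists (P0 + U0)%N.
have [L LE] : {L | L = (U0 + 2 * T1 + 2 * P)%N} by exists (U0 + 2 * T1 + 2 * P)%N.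
have UP : (U0 <= P)%N by rewrite PE leq_addl.
have HP : 5 * (U0 + 2 * T1)%:R + k / 2 * U0%:R <= k / 2 * P%:R.
  rewrite ler_pdivrMr ?divr_gt0 // in HP0.
  apply: le_trans HP0 _; rewrite mulrC ler_pM2l ?divr_gt0 // ler_nat PE leq_addr //.
exists L => Lt G LLt Gge0 G00 Gu Gv bad.
set phi := tgam U0 G k.
set f := fun X => fmin (phi X) (T1 + P).
have HTk : 20 * U0%:R <= k * T1%:R by rewrite ler_pdivrMr // in HT1; rewrite (mulrC k).
have T1gt0 : (0 < T1)%N.
  rewrite lt0n; apply/eqP => e; move: HTk; rewrite e mulr0.
  by apply/negP; rewrite -ltNge mulr_gt0 // ltr0n.
have gamge0 X t : (X <= U0)%N -> (t <= T1 + P)%N -> 0 <= gam U0 G X t.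
  by move=> XU tT; apply: Gge0; nlia.
have phi_step X t : (X <= U0)%N -> (t < T1 + P)%N -> phi X t.+1 <= phi X t + 11.
  move=> XU tT; rewrite /phi /tgam /gam !addnS.
  have := Gu (U0 - X + t)%N (X + t)%N ltac:(nlia).
  have := Gv (U0 - X + t).+1 (X + t)%N ltac:(nlia).
  by rewrite !ler_norml -natr1; lra.
set act := fun t X => phi X t == f X t.
have act_many X : (X < U0)%N -> k / 44 * T1%:R <= (\sum_(t < T1) act t X)%:R.
  move=> XU.
  have := @fmin_growth _ (phi X) (T1 + P) 11 T1 ltac:(lra)
    (fun s hs => phi_step X s (ltnW XU) hs) (leq_addr _ _).
  have [t' /andP[h1 h2] e] := @fmin_attained _ (phi X) (T1 + P) T1 (leq_addr _ _).
  have f0 : fmin (phi X) (T1 + P) 0 <= 5 * U0%:R.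
    apply: le_trans (@fmin_le _ _ _ 0%N 0%N _) _; first by [].
    rewrite /phi /tgam /gam mulr0 addr0 !addn0.
    apply: le_trans (G_le G00 Gu Gv _) _; first by nlia.
    by rewrite subnK // ltnW.
  have fT : k / 2 * T1%:R <= fmin (phi X) (T1 + P) T1.
    rewrite e /phi /tgam; have := gamge0 X t' (ltnW XU) h2.
    have : k / 2 * T1%:R <= k / 2 * t'%:R by rewrite ler_pM2l ?divr_gt0 // ler_nat.
    lra.
  rewrite /act /f; lra.
(* Double counting of pairs (column, active time): averaged over the times, at least [k / 44 * U0]
   columns are active, which is more than [Km ^ J * d0] by the choice of [J]. *)
have [t tT Ht] : exists2 t, (t < T1)%N & (Km ^ J * d0 < hits (act t) 0 U0)%N.
  have : [exists t : 'I_T1, (Km ^ J * d0 < hits (act t) 0 U0)%N].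
    apply: contraT; rewrite negb_exists => /forallP hall.
    have : (\sum_(X < U0) \sum_(t < T1) act t X <= T1 * (Km ^ J * d0))%N.
      rewrite exchange_big /=.
      apply: (@leq_trans (\sum_(t < T1) (Km ^ J * d0))%N).
        by apply: leq_sum => t _; rewrite -hitsE leqNgt.
      by rewrite sum_nat_const card_ord.
    rewrite -(ler_nat R) natr_sum leNgt => /negP[].
    apply: (@lt_le_trans _ _ (\sum_(X < U0) (k / 44 * T1%:R))); last first.
      by apply: ler_sum => X _; apply: act_many.
    rewrite sumr_const card_ord -[X in _ < X]mulr_natr U0E !natrM !natrX.
    have pos : 0 < T1%:R * d0%:R :> R by rewrite mulr_gt0 ?ltr0n ?d0E.
    move: HJ; rewrite -(ltr_pM2r pos).
    move: (Km%:R ^+ J) (Km.+1%:R ^+ J) => a' b'; lra.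
  by case/existsP => t Ht; exists t.
rewrite U0E in Ht; have [b [d [d0d _ bd Hb]]] := dense_block Ht.
rewrite add0n -U0E in bd.
have tL : (U0 + 2 * t <= Lt)%N by nlia.
(* An active column [X'] lies within [d] of [X]. Its value at [t] and its future minimum coincide,
   and each transfers to [X] with error [10 * d]. *)
have flip X : (b <= X < b + Km.+1 * d)%N -> phi X t <= f X t + 20 * d%:R.
  move=> /andP[bX Xb].
  have d_gt0 : (0 < d)%N by rewrite (leq_trans _ d0d) // d0E.
  have rK : ((X - b) %/ d < Km.+1)%N by rewrite ltn_divLR //; nlia.
  have [X' [/eqP e /andP[X1 X2]]] := Hb _ rK.
  have rd : (((X - b) %/ d).+1 * d <= Km.+1 * d)%N by rewrite leq_mul2r rK orbT.
  have X'U : (X' <= U0)%N by rewrite mulSn in rd; nlia.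
  have X3 : (b + (X - b) %/ d * d <= X < b + (X - b) %/ d * d + d)%N.
    have := divn_eq (X - b) d; have := ltn_pmod (X - b) d_gt0; nlia.
  have lip s : (U0 + 2 * s <= Lt)%N -> `|gam U0 G X s - gam U0 G X' s| <= 10 * d%:R.
    move=> sL.
    have [XX'|/ltnW X'X] := leqP X X'.
      have := @gam_lip R U0 Lt G Gu Gv X (X' - X) s ltac:(nlia) sL.
      rewrite subnKC // distrC => /le_trans; apply.
      by rewrite ler_pM2l // ler_nat; nlia.
    have := @gam_lip R U0 Lt G Gu Gv X' (X - X') s ltac:(nlia) sL.
    rewrite subnKC // => /le_trans; apply.
    by rewrite ler_pM2l // ler_nat; nlia.
  have [s /andP[ts sT] es] := @fmin_attained _ (phi X) (T1 + P) t ltac:(nlia).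
  have := @fmin_le _ (phi X') (T1 + P) t s ltac:(by rewrite ts).
  move: e; rewrite /f es /f => <-.
  have := lip t tL; have := lip s ltac:(nlia).
  rewrite /phi /tgam !ler_norml; lra.
have [h hE] : {h | h = (H * d)%N} by exists (H * d)%N.
have hh0 : (h0 <= h)%N.
  by rewrite hE HE mulSn; nlia.
have KdE : (Km.+1 * d = (n + 2) * h)%N by rewrite KmE hE mulnA.
have h_gt0 : (0 < h)%N by rewrite hE muln_gt0 HE (leq_trans _ d0d) // d0E.
have kh20 : 40 * d%:R <= k * h%:R.
  rewrite hE natrM mulrA ler_wpM2r ?ler0n // mulrC.
  rewrite ler_pdivrMr // in HH0; apply: le_trans HH0 _.
  by rewrite ler_pM2r // ler_nat HE.
have flipschitz X : (X + h <= U0)%N -> `|f (X + h)%N t - f X t| <= 10 * h%:R.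
  move=> XhU; rewrite ler_norml; apply/andP; split.
    have [s /andP[ts sT] es] := @fmin_attained _ (phi (X + h)) (T1 + P) t ltac:(nlia).
    have := @fmin_le _ (phi X) (T1 + P) t s ltac:(by rewrite ts).
    have := gam_lip Gu Gv XhU (t:=s) ltac:(nlia).
    rewrite /f es /phi /tgam ler_norml; lra.
  have [s /andP[ts sT] es] := @fmin_attained _ (phi X) (T1 + P) t ltac:(nlia).
  have := @fmin_le _ (phi (X + h)) (T1 + P) t s ltac:(by rewrite ts).
  have := gam_lip Gu Gv XhU (t:=s) ltac:(nlia).
  rewrite /f es /phi /tgam ler_norml; lra.
have conv r : (r < n)%N ->
  k * h%:R <= f (b + r.+2 * h)%N t - 2 * f (b + r.+1 * h)%N t + f (b + r * h)%N t.
  move=> rn.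
  have r2 : (r.+2 * h < (n + 2) * h)%N by rewrite ltn_mul2r h_gt0; nlia.
  have [t' /andP[t1 t2] Hm] := merge k0 LE LLt HP UP Gge0 G00 Gu Gv bad
     (X := (b + r.+1 * h)%N) hh0 ltac:(nlia) ltac:(nlia) (ltnW tT).
  have := @fmin_le _ (phi (b + r.+1 * h)%N) (T1 + P) t t' ltac:(by rewrite t1).
  have := flip (b + r * h)%N ltac:(nlia).
  have := flip (b + r.+2 * h)%N ltac:(nlia).
  have e1 : (b + r.+1 * h - h = b + r * h)%N by nlia.
  have e2 : (b + r.+1 * h + h = b + r.+2 * h)%N by nlia.
  rewrite e1 e2 -/phi in Hm; rewrite -/(f _ t).
  by lra.
have := sum_second_differences conv.
have e3 : (b + n.+1 * h = b + n * h + h)%N by nlia.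
have e4 : (b + 1 * h = b + 0 * h + h)%N by nlia.
have n2 : (n.+1 * h <= (n + 2) * h)%N by rewrite leq_mul2r; nlia.
have := flipschitz (b + n * h)%N ltac:(nlia).
have := flipschitz (b + 0 * h)%N ltac:(nlia).
rewrite e3 e4 !ler_norml.
have hR : 0 < h%:R :> R by rewrite ltr0n.
rewrite ler_pdivrMr // in Hn.
have : 21 * h%:R <= n%:R * (k * h%:R) by rewrite mulrA ler_pM2r.
by lra.
Qed.

(** * The exponent from the two alternatives *)

Definition mixed (R : realType) (g : nat -> nat -> R) (i j h : nat) : R :=
  g (i + h)%N j + g i (j + h)%N - g (i + h)%N (j + h)%N - g i j.

(** Subtracting [s * (i + j)] from [g] leaves [mixed] unchanged and turns [- 3 * h'] into
    [(2 * s - 3) * h'], which is [2 * e * h'] for [s = 3 / 2 + e]. A positive gain linear in [h'] is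
    exactly what [no_bad] refutes. *)
Lemma exponent_bound (R : realType) (eps c : R) : 0 < eps -> 0 <= c ->
  exists2 M : nat, (0 < M)%N & forall (g : nat -> nat -> R) (J : R),
    g 0 0 <= c ->
    (forall i j, (i + j < M)%N -> `|g i.+1 j - g i j| <= 3) ->
    (forall i j, (i + j < M)%N -> `|g i j.+1 - g i j| <= 3) ->
    (forall i j, (i + j = M)%N -> J <= g i j + c) ->
    (forall i j h, (0 < h)%N -> (i + j + 2 * h <= M)%N ->
       J <= (M - (i + j))%:R + g i j + mixed g i j h + c \/
       exists h', [/\ (h <= h')%N, (i + j + h' <= M)%N &
         g (i + h')%N j + g i (j + h')%N - 2 * g i j - 3 * h'%:R
           <= 2 * mixed g i j h + c]) ->
    J <= (3 / 2 + eps) * M%:R.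
Proof.
move=> eps0 c0.
(* The bound [e <= 1 / 2] gives [s <= 2], so the shifted function has slopes at most [3 + 2 = 5].
   The bound [2 * e <= eps] reserves a second [e * M] for the constants. *)
have [e [e0 e1 e2]] : exists e : R, [/\ 0 < e, e <= 1 / 2 & 2 * e <= eps].
  exists (Num.min (1 / 2) (eps / 2)); split.
  - by rewrite lt_min !divr_gt0.
  - by rewrite ge_min lexx.
  - by rewrite mulrC -ler_pdivlMr // ge_min lexx orbT.
have [h0 Hh0] := nat_above (c / e).
have [L HL] := @no_bad R (e / 2) h0.+1 ltac:(lra) ltac:(lra).
have [M0 HM0] := nat_above ((11 * L%:R + 2 * c + 1) / e).
exists M0.+1 => // g J; set M := M0.+1.
have HM : 11 * L%:R + 2 * c < e * M%:R.
  rewrite ler_pdivrMr // in HM0; rewrite /M -natr1; lra.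
move: M HM => {M0 HM0} M HM g00 gu gv triv alt.
rewrite leNgt; apply/negP => HJ.
have {}HJ : (3 / 2 + e) * M%:R + e * M%:R < J.
  by apply: le_lt_trans HJ; rewrite -mulrDl ler_wpM2r //; lra.
set s := 3 / 2 + e.
pose Gs (z : 'I_M.+1 * 'I_M.+1) : R := g z.1 z.2 - s * (z.1 + z.2)%:R.
pose dom (z : 'I_M.+1 * 'I_M.+1) := (z.1 + z.2 <= M)%N.
(* Taking the minimum over the whole triangle as origin makes the shifted function nonnegative with
   value 0 at the origin; comparison with [(0, 0)] bounds the minimum by [c]. *)
have [[i0 j0] /= dom0 min0] : {z | dom z & forall z', dom z' -> Gs z <= Gs z'}.
  exists [arg min_(z < (ord0, ord0) | dom z) Gs z]%O.
    by case: arg_minP.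
  by case: arg_minP => // z _ H z' /H.
rewrite /dom /= in dom0.
have Gmin i j : (i + j <= M)%N ->
    g i0 j0 - s * (i0 + j0)%:R <= g i j - s * (i + j)%:R.
  move=> ijM; have := min0 (inord i, inord j).
  by rewrite /dom /Gs /= !inordK; [apply| nlia | nlia].
have gmove i j d : (i + j + d <= M)%N -> `|g (i + d)%N j - g i j| <= 3 * d%:R.
  elim: d => [|d IH] h; first by rewrite addn0 subrr normr0 mulr0.
  have := IH ltac:(nlia); have := gu (i + d)%N j ltac:(nlia).
  by rewrite addnS -natr1 !ler_norml; lra.
have gmove' i j d : (i + j + d <= M)%N -> `|g i (j + d)%N - g i j| <= 3 * d%:R.
  elim: d => [|d IH] h; first by rewrite addn0 subrr normr0 mulr0.
  have := IH ltac:(nlia); have := gv i (j + d)%N ltac:(nlia).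
  by rewrite addnS -natr1 !ler_norml; lra.
have G0 : g i0 j0 - s * (i0 + j0)%:R <= c.
  by apply: le_trans (Gmin 0%N 0%N _) _ => //; rewrite mulr0 subr0.
have s0 : 0 <= s by rewrite /s; lra.
(* If the minimum lies within [L] of the last diagonal, there is no room for [no_bad], but [triv] at
   a nearby point of that diagonal already bounds [J]. *)
have [yL|yL] := ltnP M (i0 + j0 + L).
  have := triv (i0 + (M - (i0 + j0)))%N j0 ltac:(nlia).
  have := gmove i0 j0 (M - (i0 + j0))%N ltac:(nlia).
  have : (M - (i0 + j0))%:R <= L%:R :> R by rewrite ler_nat; nlia.
  have : s * (i0 + j0)%:R <= s * M%:R by rewrite ler_wpM2l // ler_nat.
  have : 0 <= L%:R :> R by [].
  rewrite ler_norml; move: HJ; rewrite -/s; clear - HM G0 c0; lra.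
apply: (HL (M - (i0 + j0))%N
  (fun u v => g (i0 + u)%N (j0 + v)%N - s * (i0 + u + (j0 + v))%:R
              - (g i0 j0 - s * (i0 + j0)%:R))).
- by nlia.
- by move=> u v uv; rewrite subr_ge0; apply: Gmin; nlia.
- by rewrite !addn0 subrr.
- move=> u v uv; rewrite addnS.
  have := gu (i0 + u)%N (j0 + v)%N ltac:(nlia).
  by rewrite addSn -natr1 !ler_norml /s; clear - e0 e1; lra.
- move=> u v uv; rewrite addnS.
  have := gv (i0 + u)%N (j0 + v)%N ltac:(nlia).
  by rewrite addnS -natr1 !ler_norml /s; clear - e0 e1; lra.
move=> u v h hh uvh.
set i := (i0 + u)%N; set j := (j0 + v)%N.
have ijM : (i + j + 2 * h <= M)%N by rewrite /i /j; nlia.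
have [far|[h' [hh' h'M Hh']]] := alt i j h ltac:(nlia) ijM.
  (* Here [(i, j)] is within [L] of the minimum, so [g i j] is at most [s * (i + j)] up to a
     multiple of [L]. As [s >= 1], the sum [(M - (i + j)) + s * (i + j)] is at most [s * M], and [J]
     comes out too small. *)
  exfalso; move: far.
  have m1 := gmove' (i + h)%N j h ltac:(nlia).
  have m2 := gmove' i j h ltac:(nlia).
  have m3 := gmove i0 j0 u ltac:(rewrite /i /j in ijM; nlia).
  have m4 := gmove' i j0 v ltac:(rewrite /i /j in ijM *; nlia).
  have uL : u%:R + v%:R + 2 * h%:R <= L%:R :> R.
    by rewrite -natrM -!natrD ler_nat.
  have y1 : (i + j)%:R = (i0 + j0)%:R + u%:R + v%:R :> R.
    by rewrite /i /j !natrD; ring.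
  have y2 : (M - (i + j))%:R = M%:R - (i + j)%:R :> R.
    by rewrite natrB //; nlia.
  have y3 : s * (i + j)%:R - (i + j)%:R <= s * M%:R - M%:R.
    have : (i + j)%:R <= M%:R :> R by rewrite ler_nat; nlia.
    by rewrite /s; clear - e0; nra.
  have h_ge0 : 0 <= h%:R :> R by [].
  have u_ge0 : 0 <= u%:R :> R by [].
  have v_ge0 : 0 <= v%:R :> R by [].
  have sy : s * (i + j)%:R = s * (i0 + j0)%:R + s * u%:R + s * v%:R by rewrite y1; ring.
  have su : 0 <= s * u%:R by rewrite mulr_ge0.
  have sv : 0 <= s * v%:R by rewrite mulr_ge0.
  move: HJ; rewrite -/s /mixed y2; rewrite !ler_norml in m1 m2 m3 m4.
  rewrite -/i in m3; rewrite -/j in m4.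
  by clear - HM G0 c0 m1 m2 m3 m4 uL y3 sy su sv h_ge0 u_ge0 v_ge0; lra.
exists h'; split => //; first by rewrite /i /j in h'M; nlia.
have a1 : (i0 + (u + h') = i + h')%N by rewrite /i; nlia.
have a2 : (j0 + (v + h') = j + h')%N by rewrite /j; nlia.
have a3 : (i0 + (u + h) = i + h)%N by rewrite /i; nlia.
have a4 : (j0 + (v + h) = j + h)%N by rewrite /j; nlia.
rewrite a1 a2 a3 a4 -/i -/j.
(* The constant [c] consumes half of the gain; what is left is the rate [e / 2] given to
   [no_bad]. *)
have hc : c <= e * h'%:R.
  rewrite ler_pdivrMr // in Hh0; apply: le_trans Hh0 _.
  by rewrite mulrC ler_pM2l // ler_nat; nlia.
move: Hh'; rewrite /mixed !natrD /s; clear - hc; lra.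
Qed.

(** * Hats, ramps and test lines *)

Lemma count_le (R : realType) (b : R) (n : nat) : -1 <= b -> b < n%:R ->
  b < \sum_(j < n) (j%:R <= b)%R%:R <= b + 1.
Proof.
move=> b1; elim: n => [|n IH] bn; first by rewrite big_ord0 bn; lra.
rewrite big_ord_recr /=; have [nb|nb] := leP n%:R b; last first.
  by rewrite addr0 IH.
rewrite (eq_bigr (fun=> 1)) => [|j _].
  by rewrite sumr_const card_ord natr1 bn -natr1 lerD2r.
by rewrite (le_trans _ nb) // ler_nat ltnW.
Qed.

Lemma count_between (R : realType) (a b : R) (n : nat) :
  -1 <= a -> a <= b -> b < n%:R ->
  b - a - 1 <= \sum_(j < n) ((a < j%:R) && (j%:R <= b))%R%:R <= b - a + 1.
Proof.
move=> a1 ab bn.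
have /andP[u1 u2] := count_le (le_trans a1 ab) bn.
have /andP[v1 v2] := count_le a1 (le_lt_trans ab bn).
have -> : \sum_(j < n) ((a < j%:R) && (j%:R <= b))%R%:R
   = \sum_(j < n) (j%:R <= b)%R%:R - \sum_(j < n) (j%:R <= a)%R%:R :> R.
  rewrite -sumrB; apply: eq_bigr => j _.
  have [ja|aj] := leP j%:R a; first by rewrite (le_trans ja ab) subrr.
  by rewrite subr0.
by apply/andP; split; lra.
Qed.

Definition ramp (R : realType) (z : R) : R := Num.max 0 z.

(** A trapezoid rule: beyond the integral and the boundary term [z / 2] the error is
    [mu * f * (1 - f) / 2], with [f] in [[0, 1]] given by [z = mu * (n + f)], hence at most
    [mu / 8]. *)
Lemma ramp_sum (R : realType) (mu z : R) (n : nat) :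
  0 < mu -> 0 <= z -> z <= n%:R * mu ->
  z ^+ 2 / (2 * mu) + z / 2 <= \sum_(i < n) ramp (z - i%:R * mu)
    <= z ^+ 2 / (2 * mu) + z / 2 + mu / 8.
Proof.
move=> mu0 z0; elim: n => [|n IH] zn.
  have -> : z = 0 by lra.
  rewrite big_ord0 expr0n /= !mul0r; lra.
rewrite big_ord_recr /=; have [zn'|nz] := leP z (n%:R * mu).
  by rewrite /ramp [Num.max 0 (z - n%:R * mu)]max_l ?subr_le0 // addr0; apply: IH.
have H k : (k <= n)%N -> ramp (z - k%:R * mu) = z - k%:R * mu.
  move=> kn; rewrite /ramp max_r // subr_ge0 (le_trans _ (ltW nz)) //.
  by rewrite ler_pM2r // ler_nat.
rewrite (eq_bigr (fun k : 'I_n => z - k%:R * mu)); last by move=> k _; rewrite H // ltnW.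
rewrite H // sumrB sumr_const card_ord -mulr_suml.
have gauss : (\sum_(k < n) k%:R : R) = n%:R * (n%:R - 1) / 2.
  elim: (n) => [|p IHp]; first by rewrite big_ord0 !mul0r.
  by rewrite big_ord_recr /= IHp -[p.+1%:R]natr1; field.
rewrite gauss -[z *+ n]mulr_natl; rewrite -[n.+1%:R]natr1 in zn.
have [f fE] : exists f, z = mu * (n%:R + f).
  exists (z / mu - n%:R); rewrite mulrDr mulrBr mulrCA divff ?gt_eqF //; lra.
have f0 : 0 <= f.
  by move: nz; rewrite fE mulrDr mulrC ltrDl => /ltW; rewrite pmulr_rge0.
have f1 : f <= 1.
  by move: zn; rewrite fE (mulrC mu) ler_pM2r // lerD2l.
have e2 : z ^+ 2 / (2 * mu) = mu * (n%:R + f) ^+ 2 / 2.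
  by rewrite fE; field; rewrite gt_eqF.
rewrite e2 fE.
have g1 : 0 <= mu * (f * (1 - f)) by apply: mulr_ge0; [exact: ltW | apply: mulr_ge0 => //; lra].
have g2 : 0 <= mu * (1 / 4 - f * (1 - f)).
  apply: mulr_ge0; first exact: ltW.
  by have := @exprn_even_ge0 R 2 (f - 1 / 2) isT; rewrite expr2; lra.
by apply/andP; split; lra.
Qed.

Definition hat (R : realType) (w z : R) : R := Num.max 0 (1 - `|z| / w).

Lemma hat_ge0 (R : realType) (w z : R) : 0 <= hat w z.
Proof. by rewrite /hat le_max lexx. Qed.

Lemma hat_le1 (R : realType) (w z : R) : 0 < w -> hat w z <= 1.
Proof. by move=> w0; rewrite /hat ge_max ler01 /= gerBl divr_ge0 // ltW. Qed.

Lemma hat_out (R : realType) (w z : R) : 0 < w -> w <= `|z| -> hat w z = 0.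
Proof.
by move=> w0 wz; rewrite /hat max_l // subr_le0 ler_pdivlMr // mul1r.
Qed.

Lemma hat_scale (R : realType) (w z a : R) : a != 0 -> 0 < w ->
  hat w (a * z) = hat (w / `|a|) z.
Proof.
move=> a0 w0; rewrite /hat normrM invfM invrK.
by congr (Num.max _ (_ - _)); ring.
Qed.

Lemma hat_ramp (R : realType) (w z : R) : 0 < w ->
  hat w z = (ramp (z + w) - 2 * ramp z + ramp (z - w)) / w.
Proof.
move=> w0; apply: (canRL (mulfK (lt0r_neq0 w0))).
rewrite /hat maxr_pMl ?ltW // mul0r mulrBl mul1r mulfVK ?gt_eqF // /ramp.
have [z0|z0] := leP 0 z; [rewrite (ger0_norm z0) | rewrite (ltr0_norm z0)];
have [?|?] := leP 0 (z - w); have [?|?] := leP 0 (z + w);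
first [have [?|?] := leP 0 (w - z); lra | have [?|?] := leP 0 (w - - z); lra].
Qed.

(** A hat is a second difference of ramps, so the boundary terms [z / 2] cancel and the error is of
    order [mu / w] instead of 1. *)
Lemma hat_sum (R : realType) (mu w z : R) (n : nat) : 0 < mu -> 0 < w ->
  w <= z -> z + w <= n%:R * mu ->
  w / mu - mu / (4 * w) <= \sum_(i < n) hat w (z - i%:R * mu)
    <= w / mu + mu / (4 * w).
Proof.
move=> mu0 w0 wz zn.
have -> : \sum_(i < n) hat w (z - i%:R * mu)
   = (\sum_(i < n) ramp (z + w - i%:R * mu) - 2 * \sum_(i < n) ramp (z - i%:R * mu)
      + \sum_(i < n) ramp (z - w - i%:R * mu)) / w.
  rewrite mulr_sumr -sumrB -big_split /= mulr_suml.
  apply: eq_bigr => i _; rewrite hat_ramp //; congr (_ / _).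
  by congr (ramp _ - _ + ramp _); ring.
have := @ramp_sum _ mu (z + w) n mu0 ltac:(lra) zn.
have := @ramp_sum _ mu z n mu0 ltac:(lra) ltac:(lra).
have := @ramp_sum _ mu (z - w) n mu0 ltac:(lra) ltac:(lra).
move: (\sum_(i < n) _) (\sum_(i < n) _) (\sum_(i < n) _) => S1 S2 S3.
move=> /andP[a1 a2] /andP[b1 b2] /andP[c1 c2].
have e : w / mu = ((z + w) ^+ 2 / (2 * mu) - 2 * (z ^+ 2 / (2 * mu))
                  + (z - w) ^+ 2 / (2 * mu)) / w.
  by field; rewrite !gt_eqF.
have e' : mu / (4 * w) = (mu / 4) / w by field; rewrite gt_eqF.
rewrite e e' -mulrBl -mulrDl !ler_pM2r ?invr_gt0 //.
by apply/andP; split; lra.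
Qed.

Definition cut (R : realType) (m : R) : R := Num.max 0 (Num.min 1 (2 - `|m|)).

Lemma cut_ge0 (R : realType) (m : R) : 0 <= cut m.
Proof. by rewrite /cut le_max lexx. Qed.

Lemma cut_le1 (R : realType) (m : R) : cut m <= 1.
Proof. by rewrite /cut ge_max ler01 /= ge_min lexx. Qed.

Lemma cut_in (R : realType) (m : R) : `|m| <= 1 -> cut m = 1.
Proof. by move=> m1; rewrite /cut min_l ?max_r //; lra. Qed.

Lemma cut_out (R : realType) (m : R) : 2 <= `|m| -> cut m = 0.
Proof. by move=> m2; rewrite /cut min_r ?max_l //; lra. Qed.

Lemma cut_lip (R : realType) (m p : R) : cut m - cut p <= `|m - p|.
Proof.
have H : `|p| - `|m| <= `|m - p| by rewrite distrC lerB_dist.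
rewrite /cut; have := normr_ge0 (m - p).
have [?|?] := leP 1 (2 - `|m|); have [?|?] := leP 1 (2 - `|p|);
have [?|?] := leP 0 (2 - `|m|); have [?|?] := leP 0 (2 - `|p|);
by rewrite ?(@max_r _ R 0 1) //; lra.
Qed.

(* [t] and [T] are the two scales, [-8 + i mu] the slopes of the test lines, [(a, b)]
   the difference of two points.  The main terms of the two hats cancel. *)
Definition corr (R : realType) (mu t T K : R) (n : nat) (a b : R) : R :=
  \sum_(i < n) cut (- 8 + i%:R * mu)
    * (hat t (b - (- 8 + i%:R * mu) * a) - hat T (b - (- 8 + i%:R * mu) * a) / K).

Lemma corr_le (R : realType) (mu t T K : R) n a b : 0 < t -> 0 < T -> 0 < K ->
  corr mu t T K n a b <= n%:R.
Proof.
move=> t0 T0 K0; have -> : n%:R = \sum_(i < n) (1 : R) by rewrite sumr_const card_ord.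
apply: ler_sum => i _.
have h0 : 0 <= hat T (b - (- 8 + i%:R * mu) * a) / K.
  by rewrite divr_ge0 ?hat_ge0 // ltW.
have h1 := hat_le1 (b - (- 8 + i%:R * mu) * a) t0.
have c0 := cut_ge0 (- 8 + i%:R * mu); have c1 := cut_le1 (- 8 + i%:R * mu).
have : cut (- 8 + i%:R * mu) * (1 - (hat t (b - (- 8 + i%:R * mu) * a)
        - hat T (b - (- 8 + i%:R * mu) * a) / K)) >= 0.
  by apply: mulr_ge0 => //; lra.
by lra.
Qed.

Lemma corr_steep (R : realType) (mu t T K : R) n a b : 0 < t -> t <= T ->
  2 * `|a| + T <= `|b| -> corr mu t T K n a b = 0.
Proof.
move=> t0 tT hb; apply: big1 => i _; set m := - 8 + _.
have [m2|m2] := leP 2 `|m|; first by rewrite cut_out // mul0r.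
have h : T <= `|b - m * a|.
  have h1 := lerB_dist b (m * a).
  have h2 : `|m * a| <= 2 * `|a| by rewrite normrM ler_wpM2r // ltW.
  by lra.
by rewrite !hat_out ?mul0r ?subrr ?mulr0 //; lra.
Qed.

(** The two hat sums agree to main order after division by [K]. What remains is the variation of
    [cut] over the slopes where a hat is nonzero, contributing [2 * T * B / a ^+ 2], and
    discretization errors of total size at most [1 / B], which [1 <= B ^+ 2 * T] and [|a| <= 1]
    bound by [T * B / a ^+ 2]. *)
Lemma corr_far (R : realType) (mu t T K B : R) (n : nat) a b :
  0 < mu -> 0 < t -> T = K * t -> t = B * mu -> 1 <= K -> 1 <= B -> 1 <= B ^+ 2 * T ->
  16 <= n%:R * mu ->
  T <= `|a| -> `|a| <= 1 -> `|b| <= 5 * `|a| ->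
  corr mu t T K n a b <= 3 * T * B / a ^+ 2.
Proof.
move=> mu0 t0 TK tB K1 B1 B2T n16 Ta a1 ba.
have T0 : 0 < T by rewrite TK mulr_gt0 //; lra.
have na0 : 0 < `|a| by lra.
have a0 : a != 0 by rewrite -normr_gt0.
set z := b / a + 8.
have zb : `|b / a| <= 5 by rewrite normrM normfV ler_pdivrMr.
set wt := t / `|a|; set wT := T / `|a|.
have wt0 : 0 < wt by rewrite divr_gt0.
have wT0 : 0 < wT by rewrite divr_gt0.
have wT1 : wT <= 1 by rewrite ler_pdivrMr // mul1r.
have wtT : wt <= wT by rewrite ler_pM2r ?invr_gt0 // TK; nra.
have hE w (i : 'I_n) : 0 < w ->
    hat w (b - (- 8 + i%:R * mu) * a) = hat (w / `|a|) (z - i%:R * mu).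
  move=> w0; rewrite -hat_scale //; congr hat.
  by rewrite /z !mulrDr mulrCA divff // mulr1; ring.
have zlo : 3 <= z by move: zb; rewrite /z ler_norml; lra.
have zhi : z <= 13 by move: zb; rewrite /z ler_norml; lra.
have /andP[_ s1] := @hat_sum _ mu wt z n mu0 wt0 ltac:(lra) ltac:(lra).
have /andP[s2 s3] := @hat_sum _ mu wT z n mu0 wT0 ltac:(lra) ltac:(lra).
set St := \sum_(i < n) hat wt _ in s1; set ST := \sum_(i < n) hat wT _ in s2 s3.
have K0 : 0 < K by lra.
(* The cutoff is frozen at [z - 8 = b / a], the slope joining the two points. It is 1-Lipschitz and
   both hats vanish at slope distance [wT], so freezing costs [wT] per term. *)
have main : corr mu t T K n a b
    <= cut (z - 8) * (St - ST / K) + wT * (St + ST / K).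
  rewrite /corr /St /ST !mulr_suml -sumrB -big_split /= !mulr_sumr -big_split /=.
  apply: ler_sum => i _; rewrite !hE // -/wt -/wT.
  set p := - 8 + _; set ht := hat wt _; set hT := hat wT _.
  have ht0 : 0 <= ht by apply: hat_ge0.
  have hT0 : 0 <= hT / K by rewrite divr_ge0 ?hat_ge0 // ltW.
  have [far|near] := leP wT `|z - i%:R * mu|.
    have -> : ht = 0 by apply: hat_out => //; lra.
    have -> : hT = 0 by apply: hat_out.
    by rewrite !mul0r subrr addr0 !mulr0 addr0.
  have e : p - (z - 8) = - (z - i%:R * mu) by rewrite /p; ring.
  have l1 := cut_lip p (z - 8); have l2 := cut_lip (z - 8) p.
  rewrite e normrN in l1; rewrite distrC e normrN in l2.
  have u1 : (cut p - cut (z - 8)) * ht <= wT * ht by apply: ler_wpM2r => //; lra.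
  have u2 : (cut (z - 8) - cut p) * (hT / K) <= wT * (hT / K).
    by apply: ler_wpM2r => //; lra.
  by lra.
apply: (le_trans main).
have Bg : mu / wt <= 1 / B.
  have -> : mu / wt = `|a| / B by rewrite /wt tB; field; rewrite !gt_eqF //; lra.
  by apply: ler_wpM2r => //; rewrite invr_ge0; lra.
have BgT : mu / wT <= 1 / B.
  by apply: le_trans Bg; rewrite ler_pM2l // lef_pV2.
have q1 : mu / (4 * wt) = (mu / wt) / 4 by rewrite invfM; ring.
have q2 : mu / (4 * wT) = (mu / wT) / 4 by rewrite invfM; ring.
have wTK : wT / K = wt by rewrite /wT /wt TK; field; rewrite gt_eqF // gt_eqF.
have STlo : wt / mu - (mu / wT) / 4 <= ST / K.
  rewrite ler_pdivlMr // (le_trans _ s2) // q2 -wTK.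
  have : 0 <= mu / wT * (K - 1) by apply: mulr_ge0; [rewrite divr_ge0 // ltW | lra].
  have -> : (wT / K / mu - mu / wT / 4) * K = wT / mu - mu / wT / 4 * K.
    by field; rewrite !gt_eqF.
  by lra.
have SThi : ST / K <= wt / mu + (mu / wT) / 4.
  rewrite ler_pdivrMr // (le_trans s3) // q2 -wTK.
  have : 0 <= mu / wT * (K - 1) by apply: mulr_ge0; [rewrite divr_ge0 // ltW | lra].
  have -> : (wT / K / mu + mu / wT / 4) * K = wT / mu + mu / wT / 4 * K.
    by field; rewrite !gt_eqF.
  by lra.
have c0 := cut_ge0 (z - 8); have c1 := cut_le1 (z - 8).
have Bi0 : 0 < 1 / B by rewrite divr_gt0 //; lra.
have p1 : cut (z - 8) * (St - ST / K) <= 1 * (1 / B / 2).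
  have le1 : St - ST / K <= 1 / B / 2 by lra.
  have [neg|pos] := leP (St - ST / K) 0.
    by apply: (@le_trans _ _ 0); [rewrite mulr_ge0_le0 | lra].
  by apply: ler_pM => //; rewrite ltW.
have p2 : wT * (St + ST / K) <= wT * (2 * (wt / mu)) + 1 * (1 / B / 2).
  have le1 : St + ST / K <= 2 * (wt / mu) + 1 / B / 2 by lra.
  apply: (@le_trans _ _ (wT * (2 * (wt / mu) + 1 / B / 2))).
    by rewrite ler_pM2l.
  by rewrite mulrDr lerD2l ler_wpM2r //; lra.
have e3 : wT * (2 * (wt / mu)) = 2 * (T * B / a ^+ 2).
  rewrite /wT /wt -[a ^+ 2]real_normK ?num_real // tB.
  by field; rewrite !gt_eqF.
have e4 : 1 / B <= T * B / a ^+ 2.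
  rewrite ler_pdivrMr; last lra.
  have a21 : a ^+ 2 <= 1 by rewrite -real_normK ?num_real // expr_le1 // ltW.
  have a20 : 0 < a ^+ 2 by rewrite -real_normK ?num_real // exprn_gt0.
  rewrite mulrAC ler_pdivlMr // mul1r (le_trans a21) // (le_trans B2T) //.
  by rewrite expr2; lra.
have -> : 3 * T * B / a ^+ 2 = 3 * (T * B / a ^+ 2) by ring.
by lra.
Qed.

(** * Bin counts and their deviation from block averages *)

Definition inbin (R : realType) (len c u : R) : bool := (c <= u) && (u < c + len).

(** The windows of length [len] that contain both points start in an interval of length
    [len - |u - u'|]: the hat is the autocorrelation of a window. *)
Lemma bin_count (R : realType) (nu len c u u' : R) (N : nat) :
  0 < nu -> 0 < len -> c + len <= u -> c + len <= u' ->
  u < c + N%:R * nu -> u' < c + N%:R * nu ->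
  len / nu * hat len (u - u') - 1
    <= \sum_(j < N) (inbin len (c + j%:R * nu) u && inbin len (c + j%:R * nu) u')%:R
    <= len / nu * hat len (u - u') + 1.
Proof.
move=> nu0 len0; wlog uu' : u u' / u <= u'.
  move=> H h1 h2 h3 h4; have [uu'|/ltW u'u] := leP u u'; first exact: H.
  have := H _ _ u'u h2 h1 h4 h3; rewrite /hat distrC.
  by under eq_bigr do rewrite andbC.
move=> cu cu' uN u'N.
have E (j : 'I_N) : inbin len (c + j%:R * nu) u && inbin len (c + j%:R * nu) u'
    = ((u' - c - len) / nu < j%:R) && (j%:R <= (u - c) / nu).
  rewrite /inbin ltr_pdivrMr // ler_pdivlMr //.
  apply/idP/idP.
    by case/andP=> /andP[a1 a2] /andP[a3 a4]; apply/andP; split; lra.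
  by case/andP=> a1 a2; apply/andP; split; apply/andP; split; lra.
under eq_bigr do rewrite E.
have [big|small] := leP len `|u - u'|.
  rewrite hat_out // mulr0 big1 => [|j _]; first by apply/andP; split; lra.
  rewrite -E /inbin; rewrite ler0_norm in big; last lra.
  by case: andP => // -[/andP[a1 a2] /andP[a3 a4]]; lra.
have hE : len / nu * hat len (u - u') = (u - c) / nu - (u' - c - len) / nu.
  rewrite /hat max_r; last by rewrite subr_ge0 ler_pdivrMr // mul1r ltW.
  by rewrite ler0_norm; [field; rewrite !gt_eqF | lra].
have nui : 0 < nu^-1 by rewrite invr_gt0.
rewrite hE; apply: count_between.
- apply: (@le_trans _ _ 0); first by lra.
  by apply: mulr_ge0; [lra | exact: ltW].
- by rewrite ler_pM2r //; rewrite ler0_norm in small; lra.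
- by rewrite ltr_pdivrMr //; lra.
Qed.

Lemma inbin_split (R : realType) (t c u : R) (K : nat) : 0 <= t ->
  \sum_(r < K) (inbin t (c + r%:R * t) u)%:R = (inbin (K%:R * t) c u)%:R :> R.
Proof.
move=> t0; elim: K => [|K IH].
  by rewrite big_ord0 /inbin mul0r addr0; case: leP => //= h; rewrite ltNge h.
rewrite big_ord_recr /= IH -natrD; congr (_%:R); rewrite /inbin -[K.+1%:R]natr1 mulrDl mul1r addrA.
have Kt : 0 <= K%:R * t by rewrite mulr_ge0.
have [h1|h1] := leP c u; last first.
  by have [h2|//] := leP (c + K%:R * t) u; exfalso; lra.
have [h2|h2] := ltP u (c + K%:R * t) => /=.
  by have [//|h3] := ltP u (c + K%:R * t + t); exfalso; lra.
by [].
Qed.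

Lemma variance (R : realType) (K : nat) (v : nat -> R) (r : 'I_K) :
  (v r - (\sum_(k < K) v k) / K%:R) ^+ 2
    <= \sum_(k < K) v k ^+ 2 - (\sum_(k < K) v k) ^+ 2 / K%:R.
Proof.
have K0 : 0 < K%:R :> R by rewrite ltr0n; case: K r => // -[].
set S := \sum_(k < K) v k; set a := S / K%:R.
have -> : \sum_(k < K) v k ^+ 2 - S ^+ 2 / K%:R = \sum_(k < K) (v k - a) ^+ 2.
  under [RHS]eq_bigr do rewrite sqrrB.
  rewrite big_split /= sumrB sumr_const card_ord.
  have -> : \sum_(i < K) (v i * a) *+ 2 = (S * a) *+ 2.
    by rewrite /S mulr_suml -sumrMnl.
  rewrite -[a ^+ 2 *+ K]mulr_natl /a; field; by rewrite gt_eqF.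
rewrite (bigD1 r) //= lerDl; apply: sumr_ge0 => i _; exact: exprn_even_ge0.
Qed.

Definition binpos (R : realType) (nu : R) (j : nat) : R := - 20 + j%:R * nu.

Definition bincount (R : realType) (I : finType) (A : {set I}) (s : I -> R)
    (nu t : R) (j : nat) : R :=
  \sum_(p in A) (inbin t (binpos nu j) (s p))%:R.

(** The high-frequency part of the projected points: one bin of length [t] against the mean over the
    [K] bins of its block. Comparing two window lengths plays the role of a Fourier cutoff. *)
Definition deviation (R : realType) (I : finType) (A : {set I}) (s : I -> R)
    (nu t : R) (K nA r j : nat) : R :=
  bincount A s nu t (j + r * nA)
    - (\sum_(k < K) bincount A s nu t (j + k * nA)) / K%:R.

Lemma binposD (R : realType) (nu t : R) nA j k : t = nA%:R * nu ->
  binpos nu (j + k * nA) = binpos nu j + k%:R * t.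
Proof. by move=> ->; rewrite /binpos natrD natrM; ring. Qed.

Lemma blockE (R : realType) (I : finType) (A : {set I}) (s : I -> R) (nu t : R) K nA j :
  0 <= t -> t = nA%:R * nu ->
  \sum_(k < K) bincount A s nu t (j + k * nA)
    = \sum_(p in A) (inbin (K%:R * t) (binpos nu j) (s p))%:R.
Proof.
move=> t0 tE; rewrite /bincount exchange_big /=; apply: eq_bigr => p _.
by under eq_bigr do rewrite (binposD _ _ tE); rewrite inbin_split.
Qed.

Lemma sqr_indicators (R : realType) (I : finType) (A : {set I}) (P : pred I) :
  (\sum_(p in A) (P p)%:R : R) ^+ 2 = \sum_(p in A) \sum_(q in A) (P p && P q)%:R.
Proof.
rewrite expr2 mulr_suml; apply: eq_bigr => p _; rewrite mulr_sumr.
by apply: eq_bigr => q _; rewrite -natrM mulnb.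
Qed.

(** One deviation is bounded by the whole variance of its block. Expanding the squares into pairs of
    points, [bin_count] turns the pair counts into hats of widths [t] and [K * t]; rounding costs 1
    for each of the [K] bins and [1 / K] for the block, at most [2 * K] together. *)
Lemma deviation_sum (R : realType) (I : finType) (A : {set I}) (s : I -> R)
    (nu t : R) (K nA N : nat) (r : 'I_K) :
  0 < nu -> 0 < t -> t = nA%:R * nu -> (0 < K)%N -> K%:R * t <= 1 ->
  (forall p, p \in A -> - 10 <= s p <= 10) -> 40 <= N%:R * nu ->
  \sum_(j < N) deviation A s nu t K nA r j ^+ 2
    <= \sum_(p in A) \sum_(q in A)
        (K%:R * nA%:R * (hat t (s p - s q) - hat (K%:R * t) (s p - s q) / K%:R)
         + 2 * K%:R).
Proof.
move=> nu0 t0 tE K0 T1 sA N40.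
have KR : 1 <= K%:R :> R by rewrite ler1n.
have T0 : 0 < K%:R * t by rewrite mulr_gt0 // ltr0n.
apply: (@le_trans _ _ (\sum_(j < N) (\sum_(k < K) bincount A s nu t (j + k * nA) ^+ 2
         - (\sum_(k < K) bincount A s nu t (j + k * nA)) ^+ 2 / K%:R))).
  by apply: ler_sum => j _; apply: (variance (fun k => bincount A s nu t (j + k * nA))).
rewrite sumrB exchange_big /= -mulr_suml.
under eq_bigr do under eq_bigr do rewrite /bincount (binposD _ _ tE) sqr_indicators.
under [X in _ - X / _]eq_bigr do rewrite (blockE _ _ _ _ (ltW t0) tE) sqr_indicators.
under eq_bigr do rewrite exchange_big /=; rewrite exchange_big /= .
rewrite [X in _ - X / _]exchange_big /= mulr_suml -sumrB.
apply: ler_sum => p pA.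
under eq_bigr do rewrite exchange_big /=; rewrite exchange_big /=.
rewrite [X in _ - X / _]exchange_big /= mulr_suml -sumrB.
apply: ler_sum => q qA.
have /andP[p1 p2] := sA _ pA; have /andP[q1 q2] := sA _ qA.
have tT : t <= K%:R * t by rewrite ler_peMl // ltW.
have nuT : t / nu = nA%:R by rewrite tE mulfK // gt_eqF.
have up (k : 'I_K) : \sum_(j < N) (inbin t (binpos nu j + k%:R * t) (s p)
     && inbin t (binpos nu j + k%:R * t) (s q))%:R <= nA%:R * hat t (s p - s q) + 1.
  have kt : 0 <= k%:R * t <= 1.
    apply/andP; split; first by apply: mulr_ge0 => //; exact: ltW.
    by apply: le_trans T1; rewrite ler_pM2r // ler_nat ltnW.
  have /andP[k1 k2] := kt.
  have /andP[_] := @bin_count _ nu t (- 20 + k%:R * t) (s p) (s q) N nu0 t0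
    ltac:(lra) ltac:(lra) ltac:(lra) ltac:(lra).
  rewrite nuT; under eq_bigr do rewrite addrAC; exact.
have lo := @bin_count _ nu (K%:R * t) (- 20) (s p) (s q) N nu0 T0
    ltac:(lra) ltac:(lra) ltac:(lra) ltac:(lra).
have /andP[{}lo _] := lo.
have e0 : K%:R * t / nu = K%:R * nA%:R by rewrite -mulrA nuT.
have up' := ler_sum (P := xpredT) (index_enum 'I_K) (fun k _ => up k).
rewrite sumr_const card_ord in up'.
have Ki : 0 < (K%:R : R)^-1 by rewrite invr_gt0; lra.
apply: (le_trans (lerB up' (ler_wpM2r (ltW Ki) lo))).
rewrite -[_ *+ K]mulr_natl.
have e : (K%:R * nA%:R * hat (K%:R * t) (s p - s q) - 1) / K%:R
   = nA%:R * hat (K%:R * t) (s p - s q) - K%:R^-1.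
  by field; rewrite gt_eqF //; lra.
have Ki1 : (K%:R : R)^-1 <= 1 by rewrite invf_le1 //; lra.
rewrite e0 e.
have -> : K%:R * nA%:R * (hat t (s p - s q) - hat (K%:R * t) (s p - s q) / K%:R)
  = K%:R * (nA%:R * hat t (s p - s q)) - nA%:R * hat (K%:R * t) (s p - s q).
  by field; rewrite gt_eqF //; lra.
by lra.
Qed.

(** * The high-low inequality *)

Lemma cauchy_schwarz (R : realType) (J : finType) (a b : J -> R) :
  (\sum_i a i * b i) ^+ 2 <= (\sum_i a i ^+ 2) * (\sum_i b i ^+ 2).
Proof.
have : 0 <= \sum_i \sum_j (a i * b j - a j * b i) ^+ 2.
  by apply: sumr_ge0 => i _; apply: sumr_ge0 => j _; exact: exprn_even_ge0.
have -> : \sum_i \sum_j (a i * b j - a j * b i) ^+ 2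
   = \sum_i \sum_j (a i ^+ 2 * b j ^+ 2) + \sum_i \sum_j (b i ^+ 2 * a j ^+ 2)
     - 2 * \sum_i \sum_j (a i * b i) * (a j * b j).
  rewrite mulr_sumr -sumrN -!big_split /=; apply: eq_bigr => i _.
  rewrite mulr_sumr -sumrN -!big_split /=; apply: eq_bigr => j _; ring.
have E (u v : J -> R) : \sum_i \sum_j u i * v j = (\sum_i u i) * (\sum_j v j).
  by rewrite mulr_suml; apply: eq_bigr => i _; rewrite mulr_sumr.
by rewrite !E expr2; lra.
Qed.

Definition slant (R : realType) (I : finType) (x m y : I -> R) (j k : I) : R :=
  y j - y k - m k * (x j - x k).

Definition incid (R : realType) (I : finType) (A : {set I}) (x m y : I -> R)
    (w : R) : R :=
  \sum_(k in A) \sum_(j in A) (`|slant x m y j k| < w)%R%:R.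

(** Pairs are sorted by the integer part [d] of [|x p - x q| / T], where [T = K * t]. For [d >= 1] a
    pair contributes at most [3 * B / (d ^ 2 * T)] and there are at most [(d + 1) * MP] of them: a
    harmonic sum, bounded by [K], and [K / T = 1 / t]. This gives 6; the class [d = 0], with the
    trivial bound [n <= 17 * B / t], gives 17. *)
Lemma corr_total (R : realType) (I : finType) (A : {set I}) (x y : I -> R)
    (mu t K B MP : R) (n D : nat) :
  (forall p, p \in A -> 0 <= x p <= 1) ->
  0 < mu -> 0 < t -> t = B * mu -> 1 <= K -> 1 <= B -> 1 <= B ^+ 2 * (K * t) ->
  16 <= n%:R * mu <= 17 -> 1 <= D%:R * (K * t) ->
  \sum_(d < D) (d.+1%:R)^-1 <= K -> 0 <= MP ->
  (forall p, p \in A -> forall d : nat,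
     \sum_(q in A) ((d%:R * (K * t) <= `|x p - x q|) && (`|x p - x q| <= d.+1%:R * (K * t))
         && (`|y p - y q| <= (2 * d%:R + 3) * (K * t)))%R%:R <= d.+1%:R * MP) ->
  \sum_(p in A) \sum_(q in A) corr mu t (K * t) K n (x p - x q) (y p - y q)
    <= #|A|%:R * MP * (23 * B / t).
Proof.
move=> x01 mu0 t0 tB K1 B1 BT /andP[n16 n17] DT harm MP0 HMP.
have [T TE] : {T | T = K * t} by exists (K * t).
rewrite -TE in BT DT HMP *.
have T0 : 0 < T by rewrite TE mulr_gt0 //; lra.
have tT : t <= T by rewrite TE; nra.
rewrite -mulrA [X in _ <= X]mulr_natl -sumr_const; apply: ler_sum => p pA.
pose w (d : nat) : R := if d is 0%N then n%:R else 3 * B / (d%:R ^+ 2 * T).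
pose ind (d : nat) q : R :=
  ((d%:R * T <= `|x p - x q|) && (`|x p - x q| <= d.+1%:R * T)
         && (`|y p - y q| <= (2 * d%:R + 3) * T))%R%:R.
have w0 d : 0 <= w d.
  case: d => [|d] //=; rewrite divr_ge0 //; first by rewrite mulr_ge0 //; lra.
  by rewrite mulr_ge0 ?exprn_ge0 // ltW.
have pt q : q \in A ->
    corr mu t T K n (x p - x q) (y p - y q) <= \sum_(d < D.+1) w d * ind d q.
  move=> qA; set a := x p - x q; set b := y p - y q.
  have a1 : `|a| <= 1.
    by have := x01 _ pA; have := x01 _ qA; rewrite ler_norml /a; lra.
  pose d := Num.truncn (`|a| / T).
  have /andP[d1 d2] : d%:R <= `|a| / T < d.+1%:R.
    by apply: truncn_itv; rewrite divr_ge0 // ltW.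
  rewrite ler_pdivlMr // in d1; rewrite ltr_pdivrMr // in d2.
  have dD : (d < D.+1)%N.
    rewrite ltnS -(ler_nat R) -(ler_pM2r T0); lra.
  have rest : w d * ind d q <= \sum_(d < D.+1) w d * ind d q.
    rewrite (bigD1 (Ordinal dD)) //= lerDl; apply: sumr_ge0 => i _.
    by rewrite mulr_ge0 ?w0 // /ind.
  apply: le_trans rest; rewrite -natr1 in d2.
  (* Above this height [|b| >= 2 * |a| + T], so no test slope contributes; this fixes the window
     [(2 * d + 3) * T] in the counting hypothesis. *)
  have [bs|bb] := leP `|b| ((2 * d%:R + 3) * T); last first.
    rewrite corr_steep //; first by rewrite mulr_ge0 ?w0 // /ind.
    by apply: le_trans (ltW bb); rewrite mulrDl; lra.
  have -> : ind d q = 1 by rewrite /ind -/a -/b d1 bs -natr1 (ltW d2).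
  rewrite mulr1; case: d d1 d2 bs {dD} => [|d] d1 d2 bs.
    by apply: corr_le => //; lra.
  have d11 : 1 <= d.+1%:R :> R by rewrite ler1n.
  have Ta : T <= `|a| by apply: le_trans d1; rewrite ler_peMl // ltW.
  apply: le_trans (@corr_far R mu t T K B n a b mu0 t0 TE tB K1 B1 BT n16 Ta a1 _) _.
    apply: le_trans bs _; apply: (@le_trans _ _ (5 * (d.+1%:R * T))); last by rewrite ler_pM2l.
    by rewrite mulrA ler_pM2r //; lra.
  have dT0 : 0 < d.+1%:R * T by rewrite mulr_gt0.
  have da : (d.+1%:R * T) ^+ 2 <= a ^+ 2.
    by rewrite -[a ^+ 2]real_normK ?num_real // ler_pXn2r // nnegrE // ltW.
  have -> : w d.+1 = 3 * T * B / (d.+1%:R * T) ^+ 2.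
    have dn : d.+1%:R != 0 :> R by rewrite gt_eqF //; lra.
    have Tn : T != 0 by rewrite gt_eqF.
    by move: dn; rewrite /w; move: (d.+1%:R) => e dn; field; rewrite dn Tn.
  apply: ler_wpM2l; first by apply: mulr_ge0; [apply: mulr_ge0 => //; exact: ltW|clear - B1; lra].
  have dT2 : 0 < (d.+1%:R * T) ^+ 2 by rewrite exprn_gt0.
  by rewrite lef_pV2 // posrE (lt_le_trans dT2).
apply: (le_trans (ler_sum _ pt)).
rewrite exchange_big /=.
under eq_bigr do rewrite -mulr_sumr.
apply: (@le_trans _ _ (\sum_(d < D.+1) w d * (d.+1%:R * MP))).
  by apply: ler_sum => d _; apply: ler_wpM2l => //; apply: HMP.
rewrite big_ord_recl /= mul1r.
have step (d : 'I_D) : w d.+1 * (d.+2%:R * MP) <= 6 * B * MP / T * d.+1%:R^-1.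
  have d0 : 0 < d.+1%:R :> R by rewrite ltr0n.
  have d2 : d.+2%:R <= 2 * d.+1%:R :> R by rewrite -natrM ler_nat mul2n -addnn addSn ltnS leq_addl.
  have -> : 6 * B * MP / T * d.+1%:R^-1 = w d.+1 * (2 * d.+1%:R * MP).
    have Tn : T != 0 by rewrite gt_eqF.
    by move: d0; rewrite /w; move: (d.+1%:R) => e' e0; field; rewrite Tn gt_eqF.
  by apply: ler_wpM2l => //; apply: ler_wpM2r.
have bnd : 0 <= 6 * B * MP / T.
  by rewrite divr_ge0 //; [apply: mulr_ge0 => //; clear - B1; lra|exact: ltW].
have st : \sum_(d < D) w d.+1 * (d.+2%:R * MP) <= 6 * B * MP / T * K.
  apply: (@le_trans _ _ (\sum_(d < D) 6 * B * MP / T * d.+1%:R^-1)).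
    by apply: ler_sum.
  by rewrite -mulr_sumr ler_wpM2l.
have e : 6 * B * MP / T * K = 6 * (MP * (B / t)) by rewrite TE; field; rewrite !gt_eqF //; lra.
have n17' : n%:R <= 17 * (B / t).
  have -> : 17 * (B / t) = 17 / mu by rewrite tB; field; rewrite !gt_eqF //; lra.
  by rewrite ler_pdivlMr.
have n17'' : n%:R * MP <= 17 * (B / t) * MP by rewrite ler_wpM2r.
rewrite /bump /=; under eq_bigr do rewrite add1n.
have -> : 23 * B / t = 23 * (B / t) by rewrite mulrA.
by lra.
Qed.

(** * Test lines and the comparison of two scales *)

Definition slope (R : realType) (mu : R) (i : nat) : R := - 8 + i%:R * mu.

(** Test lines next to the line of slope [m] and intercept [c]. The slope lies just below [m], and
    bin number [tau] of the block starting at position [j] lies just below [c]; one-sided choices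
    give the displacement on [0 <= x <= 1] a fixed sign. *)
Definition tests (R : realType) (t mu nu : R) (tau : nat) (m c : R) (i j : nat) : bool :=
  ((m - t < slope mu i) && (slope mu i <= m))
  && ((c - 2 * t < binpos nu j + tau%:R * t) && (binpos nu j + tau%:R * t <= c - t)).

Lemma arith_count (R : realType) (s h lo : R) (n : nat) (hi : R) :
  0 < h -> s <= lo -> lo <= hi -> hi < s + n%:R * h ->
  (hi - lo) / h - 1
    <= \sum_(i < n) ((lo < s + i%:R * h) && (s + i%:R * h <= hi))%R%:R
    <= (hi - lo) / h + 1.
Proof.
move=> h0 slo lohi hin.
have -> : (hi - lo) / h = (hi - s) / h - (lo - s) / h.
  by rewrite -mulrBl; congr (_ / _); ring.
rewrite (eq_bigr (fun i : 'I_n =>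
  (((lo - s) / h < i%:R) && (i%:R <= (hi - s) / h))%R%:R)); last first.
  by move=> i _; rewrite ltr_pdivrMr // ler_pdivlMr // ltrBlDl lerBrDl.
apply: count_between; last by rewrite ltr_pdivrMr // ltrBlDl.
  apply: (@le_trans _ _ 0); first by lra.
  by apply: divr_ge0; [rewrite subr_ge0|exact: ltW].
by rewrite ler_pM2r ?invr_gt0 // lerD2r.
Qed.

Lemma tests_count (R : realType) (t mu nu B C m c : R) (tau NI NJ : nat) :
  0 < mu -> 0 < nu -> 0 < t -> t <= 1 -> t = B * mu -> t = C * nu -> 4 <= B -> 4 <= C ->
  tau%:R * t <= 1 -> 16 <= NI%:R * mu -> 40 <= NJ%:R * nu ->
  0 <= m <= 1 -> -1 <= c <= 1 ->
  B * C / 2 <= \sum_(i < NI) \sum_(j < NJ) (tests t mu nu tau m c i j)%:R <= 2 * (B * C).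
Proof.
move=> mu0 nu0 t0 t1 tB tC B4 C4 taut NI16 NJ40 /andP[m0 m1] /andP[c0 c1].
have taut0 : 0 <= tau%:R * t by apply: mulr_ge0 => //; exact: ltW.
have /andP[u1 u2] := @arith_count R (- 8) mu (m - t) NI m mu0 ltac:(lra) ltac:(lra) ltac:(lra).
have /andP[v1 v2] := @arith_count R (- 20 + tau%:R * t) nu (c - 2 * t) NJ (c - t) nu0
  ltac:(lra) ltac:(lra) ltac:(lra).
have eB : (m - (m - t)) / mu = B by rewrite subKr tB mulfK // gt_eqF.
have eC : (c - t - (c - 2 * t)) / nu = C.
  have -> : c - t - (c - 2 * t) = C * nu by rewrite -tC; ring.
  by rewrite mulfK // gt_eqF.
rewrite eB in u1 u2; rewrite eC in v1 v2.
set U := \sum_(i < NI) _ in u1 u2; set V := \sum_(j < NJ) _ in v1 v2.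
have -> : \sum_(i < NI) \sum_(j < NJ) (tests t mu nu tau m c i j)%:R = U * V.
  rewrite /U mulr_suml; apply: eq_bigr => i _; rewrite /V mulr_sumr.
  apply: eq_bigr => j _; rewrite -natrM mulnb /tests /slope /binpos.
  by rewrite [- 20 + _ + j%:R * nu]addrAC.
clear - u1 u2 v1 v2 B4 C4; apply/andP; split; nra.
Qed.

(** On [0 <= x <= 1] the test line differs from line [k] only by shifts of order [t]. Points in the
    tested bin therefore have slant below [4 * t], and points of slant below [K * t / 4] fall into
    the block, whose middle bin is the tested one; [16 <= K] leaves room for the shifts. *)
Lemma test_deviation (R : realType) (I : finType) (A : {set I}) (x m y : I -> R)
    (t mu nu : R) (K nA i j : nat) (k : I) :
  (forall p, p \in A -> 0 <= x p <= 1) ->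
  0 < t -> t = nA%:R * nu -> (16 <= K)%N ->
  tests t mu nu (K %/ 2) (m k) (y k - m k * x k) i j ->
  deviation A (fun p => y p - slope mu i * x p) nu t K nA (K %/ 2) j
   <= \sum_(p in A) (`|slant x m y p k| < 4 * t)%R%:R
      - (\sum_(p in A) (`|slant x m y p k| < K%:R * t / 4)%R%:R) / K%:R.
Proof.
move=> x01 t0 tE K16 /andP[/andP[i1 i2] /andP[j1 j2]].
have K0 : 0 < K%:R :> R by rewrite ltr0n (leq_trans _ K16).
rewrite /deviation (blockE _ _ _ _ (ltW t0) tE) /bincount.
have tau1 : K%:R <= 2 * (K %/ 2)%:R + 1 :> R.
  by rewrite -natrM natr1 ler_nat; nlia.
have tau2 : 2 * (K %/ 2)%:R <= K%:R :> R.
  by rewrite -natrM ler_nat; nlia.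
have K16' : 16 <= K%:R :> R by rewrite ler_nat.
have bx p : p \in A -> 0 <= (m k - slope mu i) * x p <= t.
  by move=> /x01 /andP[p0 p1]; clear - i1 i2 p0 p1; apply/andP; split; nra.
have sE p : slant x m y p k
    = (y p - slope mu i * x p) - (m k - slope mu i) * x p - (y k - m k * x k).
  by rewrite /slant; ring.
apply: lerB.
  apply: ler_sum => p pA; rewrite ler_nat; rewrite (binposD _ _ tE).
  have /andP[q1 q2] := bx _ pA.
  case: (boolP (inbin _ _ _)) => // /andP[h1 h2].
  rewrite lt0b sE ltr_norml; apply/andP; split.
    by clear - q1 q2 h1 h2 j1 j2 t0; lra.
  by clear - q1 q2 h1 h2 j1 j2 t0; lra.
rewrite ler_pM2r ?invr_gt0 //; apply: ler_sum => p pA; rewrite ler_nat.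
have /andP[q1 q2] := bx _ pA.
case: (boolP (_ < K%:R * t / 4)) => //; rewrite sE ltr_norml => /andP[h1 h2].
rewrite lt0b /inbin.
have T1 : (K %/ 2)%:R * t >= K%:R * t / 2 - t / 2 by clear - t0 tau1; nra.
have T2 : (K %/ 2)%:R * t <= K%:R * t / 2 by clear - t0 tau2; nra.
have T3 : 16 * t <= K%:R * t by rewrite ler_pM2r.
apply/andP; split.
  by clear - q1 q2 h1 h2 j1 j2 t0 T1 T2 T3; lra.
by clear - q1 q2 h1 h2 j1 j2 t0 T1 T2 T3; lra.
Qed.

(** A consequence of a bound, of order [MP], on the points in a square of side [T]: the region for
    [d] is covered by a number of such squares of order [d + 1]. It contains every pair with a
    nonzero correlation. *)
Definition spread (R : realType) (I : finType) (A : {set I}) (x y : I -> R)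
    (T MP : R) : Prop :=
  forall p, p \in A -> forall d : nat,
     \sum_(q in A) ((d%:R * T <= `|x p - x q|) && (`|x p - x q| <= d.+1%:R * T)
         && (`|y p - y q| <= (2 * d%:R + 3) * T))%R%:R <= d.+1%:R * MP.

(** [57 = 23 + 34]: the first part is [corr_total], the second is the rounding error [2 * K] per
    pair over slopes of total weight at most [17 * B / t], absorbed by [#|A| <= nA] and [1 <= MP].
    The restriction to slopes in [[-1, 1]] selects the range where [cut] is 1. *)
Lemma deviation_total (R : realType) (I : finType) (A : {set I}) (x y : I -> R)
    (mu nu t B MP : R) (K D nA NI NJ tau : nat) :
  (forall p, p \in A -> 0 <= x p <= 1) -> (forall p, p \in A -> 0 <= y p <= 1) ->
  0 < mu -> 0 < nu -> 0 < t -> t = B * mu -> t = nA%:R * nu -> (tau < K)%N ->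
  1 <= B -> 1 <= B ^+ 2 * (K%:R * t) -> K%:R * t <= 1 ->
  16 <= NI%:R * mu <= 17 -> 40 <= NJ%:R * nu ->
  1 <= D%:R * (K%:R * t) -> \sum_(d < D) (d.+1%:R)^-1 <= K%:R :> R ->
  1 <= MP -> (#|A| <= nA)%N -> spread A x y (K%:R * t) MP ->
  \sum_(i < NI) \sum_(j < NJ) (if `|slope mu i| <= 1 then
      deviation A (fun p => y p - slope mu i * x p) nu t K nA tau j else 0) ^+ 2
    <= 57 * (K%:R * nA%:R * #|A|%:R * MP * B / t).
Proof.
move=> x01 y01 mu0 nu0 t0 tB tE tauK B1 BT KT NI16 NJ40 DT harm MP1 AnA HMP.
have K0 : (0 < K)%N by case: K tauK {BT KT DT harm HMP}.
have K1 : 1 <= K%:R :> R by rewrite ler1n.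
pose F i p q := K%:R * nA%:R * (hat t (y p - y q - slope mu i * (x p - x q))
   - hat (K%:R * t) (y p - y q - slope mu i * (x p - x q)) / K%:R) + 2 * K%:R : R.
apply: (@le_trans _ _ (\sum_(i < NI) cut (slope mu i) * \sum_(p in A) \sum_(q in A) F i p q)).
  apply: ler_sum => i _; have [mi|mi] := leP `|slope mu i| 2; last first.
    rewrite big1 ?cut_out ?mul0r //; first exact: ltW.
    by move=> j _; case: leP => [h|_]; [exfalso; lra|rewrite expr0n].
  set s := fun p => y p - slope mu i * x p.
  have H : \sum_(j < NJ) deviation A s nu t K nA tau j ^+ 2 <= \sum_(p in A) \sum_(q in A) F i p q.
    have -> : \sum_(p in A) \sum_(q in A) F i p q = \sum_(p in A) \sum_(q in A)
        (K%:R * nA%:R * (hat t (s p - s q) - hat (K%:R * t) (s p - s q) / K%:R)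
         + 2 * K%:R).
      apply: eq_bigr => p _; apply: eq_bigr => q _; rewrite /F.
      by have -> : y p - y q - slope mu i * (x p - x q) = s p - s q by rewrite /s; ring.
    apply: (@deviation_sum R I A s nu t K nA NJ (Ordinal tauK)) => // p pA.
    have /andP[p1 p2] := x01 _ pA; have /andP[p3 p4] := y01 _ pA.
    move: mi; rewrite ler_norml /s => /andP[m1 m2].
    by clear - p1 p2 p3 p4 m1 m2; apply/andP; split; nra.
  have S0 : 0 <= \sum_(j < NJ) deviation A s nu t K nA tau j ^+ 2.
    by apply: sumr_ge0 => j _; exact: exprn_even_ge0.
  have [m1|m1] := leP `|slope mu i| 1; first by rewrite cut_in // mul1r.
  rewrite big1 => [|j _]; last by rewrite expr0n.
  by rewrite mulr_ge0 ?cut_ge0 // (le_trans S0).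
have e : \sum_(i < NI) cut (slope mu i) * \sum_(p in A) \sum_(q in A) F i p q
   = K%:R * nA%:R * (\sum_(p in A) \sum_(q in A)
       corr mu t (K%:R * t) K%:R NI (x p - x q) (y p - y q))
     + (\sum_(i < NI) cut (slope mu i)) * (2 * K%:R) * #|A|%:R ^+ 2.
  pose H i p q := hat t (y p - y q - slope mu i * (x p - x q))
    - hat (K%:R * t) (y p - y q - slope mu i * (x p - x q)) / K%:R : R.
  have E1 i : \sum_(p in A) \sum_(q in A) F i p q
      = K%:R * nA%:R * (\sum_(p in A) \sum_(q in A) H i p q) + 2 * K%:R * #|A|%:R ^+ 2.
    have [c cE] : {c : R | c = 2 * K%:R} by exists (2 * K%:R).
    have [b bE] : {b : R | b = K%:R * nA%:R} by exists (K%:R * nA%:R).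
    rewrite /F -/(H i _ _) -cE -bE mulr_sumr.
    have -> : c * #|A|%:R ^+ 2 = \sum_(p in A) (c * #|A|%:R).
      by rewrite sumr_const -[RHS]mulr_natr expr2 mulrA.
    rewrite -big_split /=; apply: eq_bigr => p _; rewrite mulr_sumr.
    by rewrite big_split /= sumr_const mulr_natr.
  under eq_bigr do rewrite E1 mulrDr; rewrite big_split /= -mulr_suml -mulrA; congr (_ + _).
    under eq_bigr do rewrite mulrCA; rewrite -mulr_sumr; congr (_ * _).
    under [RHS]eq_bigr do rewrite exchange_big /=; rewrite exchange_big /=.
    apply: eq_bigr => i _; rewrite mulr_sumr; apply: eq_bigr => p _.
    by rewrite mulr_sumr.
  by rewrite -?mulr_suml ?mulrA.
rewrite e.
have /andP[_ NI17] := NI16.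
have h1 := corr_total x01 mu0 t0 tB K1 B1 BT NI16 DT harm (le_trans ler01 MP1) HMP.
have h2 : \sum_(i < NI) cut (slope mu i) <= 17 * (B / t).
  have -> : 17 * (B / t) = 17 / mu by rewrite tB; field; rewrite !gt_eqF //; lra.
  rewrite ler_pdivlMr // (le_trans _ NI17) // ler_pM2r //.
  have -> : NI%:R = \sum_(i < NI) 1 :> R by rewrite sumr_const card_ord.
  by apply: ler_sum => i _; apply: cut_le1.
have [G GE] : {G | G = B / t} by exists (B / t).
have G0 : 0 <= G by rewrite GE divr_ge0 ?ltW //; clear - B1; lra.
rewrite -GE in h2; rewrite -[23 * B / t]mulrA -GE in h1.
have -> : 57 * (K%:R * nA%:R * #|A|%:R * MP * B / t)
    = 23 * (K%:R * nA%:R * #|A|%:R * MP * G) + 34 * (K%:R * nA%:R * #|A|%:R * MP * G).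
  by rewrite GE; ring.
have KnA : 0 <= K%:R * nA%:R :> R by rewrite mulr_ge0.
apply: lerD.
  apply: (le_trans (ler_wpM2l KnA h1)).
  by rewrite le_eqVlt; apply/orP; left; apply/eqP; ring.
have n2 : #|A|%:R ^+ 2 <= nA%:R * #|A|%:R * MP :> R.
  rewrite expr2; have a1 : #|A|%:R * #|A|%:R <= nA%:R * #|A|%:R :> R.
    by rewrite ler_wpM2r // ler_nat.
  by apply: (le_trans a1); rewrite ler_peMr // mulr_ge0.
apply: (@le_trans _ _ (17 * G * (2 * K%:R) * (nA%:R * #|A|%:R * MP))).
  have cut0 : 0 <= \sum_(i < NI) cut (slope mu i).
    by apply: sumr_ge0 => i _; apply: cut_ge0.
  have K2 : 0 <= 2 * K%:R :> R by clear - K1; lra.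
  apply: (ler_pM _ _ _ n2); [exact: mulr_ge0|exact: exprn_even_ge0|exact: ler_wpM2r].
by rewrite le_eqVlt; apply/orP; left; apply/eqP; ring.
Qed.

(** The dual of a bound on points in small squares: lines in a box of side [t] in the plane of
    slopes and intercepts. *)
Definition packed (R : realType) (I : finType) (A : {set I}) (m c : I -> R)
    (t ML : R) : Prop :=
  forall a b, \sum_(k in A) (((a <= m k) && (m k < a + t))
                 && ((b <= c k) && (c k < b + t)))%R%:R <= ML.

Lemma ceil_mult (R : realType) (a h : R) : 0 <= a -> 0 < h -> h <= 1 ->
  exists n : nat, a <= n%:R * h <= a + 1.
Proof.
move=> a0 h0 h1; exists (Num.truncn (a / h)).+1.
have /andP[d1 d2] : (Num.truncn (a / h))%:R <= a / h < (Num.truncn (a / h)).+1%:R.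
  by apply: truncn_itv; rewrite divr_ge0 // ltW.
rewrite ltr_pdivrMr // in d2; rewrite ler_pdivlMr // in d1.
by rewrite (ltW d2) /= -natr1 mulrDl mul1r; apply: lerD.
Qed.

(** If line [k] has too few points at the fine scale compared with the coarse one, every test line
    next to it has a correspondingly negative deviation. Summing over [k] and applying
    Cauchy-Schwarz over the test lines pairs the square sum of the deviations, controlled by
    [spread], with the multiplicities of the tests, controlled by [packed]. *)
Lemma high_low (R : realType) (I : finType) (A : {set I}) (x m y : I -> R)
    (t MP ML : R) (K D : nat) :
  (forall p, p \in A -> 0 <= x p <= 1) -> (forall p, p \in A -> 0 <= m p <= 1) ->
  (forall p, p \in A -> 0 <= y p <= 1) ->
  0 < t -> (16 <= K)%N -> K%:R * t <= 1 -> 1 <= D%:R * (K%:R * t) ->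
  \sum_(d < D) (d.+1%:R)^-1 <= K%:R :> R -> 1 <= MP ->
  spread A x y (K%:R * t) MP -> packed A m (fun k => y k - m k * x k) t ML ->
  incid A x m y (K%:R * t / 4) / K%:R
    - 64 * #|A|%:R * Num.sqrt (K%:R * MP * ML / t) <= incid A x m y (4 * t).
Proof.
move=> x01 m01 y01 t0 K16 KT DT harm MP1 HMP HML.
have [->|A0] := eqVneq A finset.set0.
  by rewrite /incid !big_set0 mul0r cards0 mulr0 mul0r subr0.
have n1 : (0 < #|A|)%N by rewrite card_gt0.
have K16' : 16 <= K%:R :> R by rewrite ler_nat.
have t1 : t <= 1.
  by apply: le_trans KT; clear - K16' t0; nra.
(* Bins finer than [t / #|A|] make their rounding error harmless, and [D <= B] gives
   [1 <= B ^+ 2 * (K * t)]. The summands 4 serve [tests_count]. *)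
pose nA := (#|A| + 4)%N; pose Bn := (D + 4)%N.
have [B BE] : {B : R | B = Bn%:R} by exists Bn%:R.
have [C CE] : {C : R | C = nA%:R} by exists nA%:R.
have B4 : 4 <= B by rewrite BE ler_nat /Bn leq_addl.
have C4 : 4 <= C by rewrite CE ler_nat /nA leq_addl.
have BD : D%:R <= B by rewrite BE ler_nat /Bn leq_addr.
pose mu := t / B; pose nu := t / C.
have mu0 : 0 < mu by rewrite divr_gt0 //; clear - B4; lra.
have nu0 : 0 < nu by rewrite divr_gt0 //; clear - C4; lra.
have tB : t = B * mu by rewrite /mu mulrC mulfVK // gt_eqF //; clear - B4; lra.
have tC : t = C * nu by rewrite /nu mulrC mulfVK // gt_eqF //; clear - C4; lra.
have [NI NI16] : exists NI : nat, 16 <= NI%:R * mu <= 17.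
  have -> : 17 = 16 + 1 :> R by ring.
  by apply: ceil_mult => //; clear - tB B4 mu0 t1; nra.
have [NJ /andP[NJ40 _]] : exists NJ : nat, 40 <= NJ%:R * nu <= 40 + 1.
  by apply: ceil_mult => //; clear - tC C4 nu0 t1; nra.
pose tau := (K %/ 2)%N.
have tauK : (tau < K)%N by rewrite /tau; clear - K16; lia.
have taut : tau%:R * t <= 1.
  by apply: le_trans KT; rewrite ler_pM2r // ler_nat ltnW.
have BT : 1 <= B ^+ 2 * (K%:R * t).
  apply: (le_trans DT); rewrite ler_wpM2r //.
    by apply: mulr_ge0 => //; exact: ltW.
  by apply: (le_trans BD); clear - B4; nra.
pose c k := y k - m k * x k.
pose dev i j := deviation A (fun p => y p - slope mu i * x p) nu t K nA tau j.
pose W k i j : R := (tests t mu nu tau (m k) (c k) i j)%:R.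
pose X k := \sum_(p in A) (`|slant x m y p k| < 4 * t)%R%:R
      - (\sum_(p in A) (`|slant x m y p k| < K%:R * t / 4)%R%:R) / K%:R : R.
have BC : 0 < B * C by rewrite mulr_gt0 //; [clear - B4|clear - C4]; lra.
have Wc k : k \in A -> B * C / 2 <= \sum_(i < NI) \sum_(j < NJ) W k i j <= 2 * (B * C).
  move=> kA; have /andP[NI16' _] := NI16; apply: tests_count => //; first exact: m01.
  have /andP[? ?] := x01 _ kA; have /andP[? ?] := m01 _ kA; have /andP[? ?] := y01 _ kA.
  have h1 : 0 <= m k * x k by apply: mulr_ge0.
  have h2 : m k * x k <= 1 by apply: mulr_ile1.
  by rewrite /c; move: (m k * x k) h1 h2 => u u0 u1; apply/andP; split; lra.
have HX k : k \in A ->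
    - (2 / (B * C) * \sum_(i < NI) \sum_(j < NJ) W k i j * `|dev i j|) <= X k.
  move=> kA; have /andP[W1 _] := Wc k kA.
  have S0 : 0 <= \sum_(i < NI) \sum_(j < NJ) W k i j * `|dev i j|.
    by apply: sumr_ge0 => i _; apply: sumr_ge0 => j _; rewrite mulr_ge0 // /W.
  have g0 : 0 < 2 / (B * C) by rewrite divr_gt0.
  have [X0|X0] := leP 0 (X k).
    by apply: le_trans X0; rewrite oppr_le0 mulr_ge0 // ltW.
  have key : (- X k) * (\sum_(i < NI) \sum_(j < NJ) W k i j)
      <= \sum_(i < NI) \sum_(j < NJ) W k i j * `|dev i j|.
    rewrite mulr_sumr; apply: ler_sum => i _; rewrite mulr_sumr; apply: ler_sum => j _.
    rewrite mulrC /W; case E: tests; last by rewrite !mul0r.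
    rewrite !mul1r; have tE : t = nA%:R * nu by rewrite -CE.
    have := test_deviation x01 t0 tE K16 E; rewrite -/(X k) -/(dev i j) => h.
    by have := ler_norm (- dev i j); rewrite normrN; clear - h; lra.
  have key2 : (- X k) * (B * C / 2) <= \sum_(i < NI) \sum_(j < NJ) W k i j * `|dev i j|.
    by apply: le_trans key; rewrite ler_wpM2l // oppr_ge0 ltW.
  rewrite lerNl -ler_pdivrMl // invf_div.
  by rewrite mulrC.
pose co i j := \sum_(k in A) W k i j.
have HT : incid A x m y (4 * t) - incid A x m y (K%:R * t / 4) / K%:R
    >= - (2 / (B * C) * \sum_(i < NI) \sum_(j < NJ) co i j * `|dev i j|).
  have -> : incid A x m y (4 * t) - incid A x m y (K%:R * t / 4) / K%:R = \sum_(k in A) X k.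
    by rewrite /incid mulr_suml -sumrB.
  have -> : \sum_(i < NI) \sum_(j < NJ) co i j * `|dev i j|
     = \sum_(k in A) \sum_(i < NI) \sum_(j < NJ) W k i j * `|dev i j|.
    rewrite [RHS]exchange_big /=; apply: eq_bigr => i _.
    rewrite [RHS]exchange_big /=; apply: eq_bigr => j _.
    by rewrite /co mulr_suml.
  by rewrite mulr_sumr -sumrN; apply: ler_sum.
have co_ge0 i j : 0 <= co i j by apply: sumr_ge0 => k _; rewrite /W.
have coML i j : co i j <= ML.
  apply: le_trans (HML (slope mu i) (binpos nu j + tau%:R * t + t)).
  apply: ler_sum => k kA; rewrite /W ler_nat /tests -/(c k).
  case: (boolP ((_ && _) && _)) => // /andP[/andP[i1 i2] /andP[j1 j2]].
  rewrite lt0b; clear - i1 i2 j1 j2.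
  by apply/andP; split; apply/andP; split; lra.
(* Since [m] lies in [[0, 1]] and [t <= 1], only slopes in [[-1, 1]] are ever tested, so the other
   deviations may be replaced by 0. *)
pose b i j := (if `|slope mu i| <= 1 then dev i j else 0).
have cob i j : co i j * `|dev i j| = co i j * `|b i j|.
  rewrite /b; case: leP => // i1; rewrite normr0 mulr0.
  suff -> : co i j = 0 by rewrite mul0r.
  apply: big1 => k kA; rewrite /W /tests.
  case: (boolP ((_ && _) && _)) => // /andP[/andP[i2 i3] _]; exfalso.
  have /andP[m0 m1] := m01 _ kA; move: i1; rewrite ltNge ler_norml => /negP; apply.
  by clear - i2 i3 m0 m1 t1; apply/andP; split; lra.
have n1' : 1 <= #|A|%:R :> R by rewrite ler1n.
have b2 : \sum_(i < NI) \sum_(j < NJ) b i j ^+ 2 <= 57 * (K%:R * C * #|A|%:R * MP * B / t).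
  rewrite CE; apply: deviation_total NI16 NJ40 DT harm MP1 _ HMP => //.
  - by rewrite -CE.
  - by clear - B4; lra.
  - by rewrite /nA leq_addr.
have c2 : \sum_(i < NI) \sum_(j < NJ) co i j ^+ 2 <= ML * (#|A|%:R * (2 * (B * C))).
  apply: (@le_trans _ _ (ML * \sum_(k in A) \sum_(i < NI) \sum_(j < NJ) W k i j)).
    rewrite [X in _ <= _ * X]exchange_big /= mulr_sumr; apply: ler_sum => i _.
    rewrite [X in _ <= _ * X]exchange_big /= mulr_sumr; apply: ler_sum => j _.
    by rewrite expr2 ler_wpM2r.
  have ML0 : 0 <= ML by apply: le_trans (HML 0 0); apply: sumr_ge0.
  rewrite ler_wpM2l // [X in _ <= X]mulr_natl -sumr_const; apply: ler_sum => k kA.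
  by have /andP[] := Wc k kA.
pose S := \sum_(i < NI) \sum_(j < NJ) co i j * `|dev i j|.
have S0 : 0 <= S by apply: sumr_ge0 => i _; apply: sumr_ge0 => j _; rewrite mulr_ge0.
have CS : S ^+ 2 <= (\sum_(i < NI) \sum_(j < NJ) co i j ^+ 2)
     * (\sum_(i < NI) \sum_(j < NJ) b i j ^+ 2).
  have := cauchy_schwarz (fun ij : 'I_NI * 'I_NJ => co ij.1 ij.2)
    (fun ij => `|b ij.1 ij.2|).
  rewrite -(pair_big xpredT xpredT (fun (i : 'I_NI) (j : 'I_NJ) => co i j * `|b i j|)) /=.
  rewrite -(pair_big xpredT xpredT (fun (i : 'I_NI) (j : 'I_NJ) => co i j ^+ 2)) /=.
  rewrite -(pair_big xpredT xpredT (fun (i : 'I_NI) (j : 'I_NJ) => `|b i j| ^+ 2)) /=.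
  under [X in X ^+ 2 <= _]eq_bigr do under eq_bigr do rewrite -cob.
  by under [X in _ <= _ * X]eq_bigr do under eq_bigr do rewrite real_normK ?num_real //.
have ML0 : 0 <= ML by apply: le_trans (HML 0 0); apply: sumr_ge0.
have [Z ZE] : {Z | Z = K%:R * MP * ML / t} by exists (K%:R * MP * ML / t).
have Z0 : 0 <= Z.
  rewrite ZE; apply: divr_ge0; last exact: ltW.
  by apply: mulr_ge0 => //; apply: mulr_ge0 => //; exact: le_trans MP1.
have S2 : S ^+ 2 <= 114 * (#|A|%:R * (B * C)) ^+ 2 * Z.
  have pos (h : nat -> nat -> R) : 0 <= \sum_(i < NI) \sum_(j < NJ) h i j ^+ 2.
    by apply: sumr_ge0 => i _; apply: sumr_ge0 => j _; exact: exprn_even_ge0.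
  apply: (le_trans CS); apply: (le_trans (ler_pM (pos _) (pos _) c2 b2)).
  by rewrite le_eqVlt; apply/orP; left; apply/eqP; rewrite ZE; ring.
have S3 : S <= 32 * (#|A|%:R * (B * C)) * Num.sqrt Z.
  rewrite -(@ler_pXn2r _ 2) ?nnegrE //; last first.
    by apply: mulr_ge0; [apply: mulr_ge0 => //; apply: mulr_ge0 => //; exact: ltW|exact: sqrtr_ge0].
  apply: (le_trans S2); rewrite [X in _ <= X]exprMn sqr_sqrtr //; apply: ler_wpM2r => //.
  rewrite [X in _ <= X]exprMn; apply: ler_wpM2r; first exact: exprn_even_ge0.
  by rewrite -natrX ler_nat.
have F : 2 / (B * C) * S <= 64 * #|A|%:R * Num.sqrt Z.
  rewrite mulrAC ler_pdivrMr //.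
  have -> : 64 * #|A|%:R * Num.sqrt Z * (B * C) = 2 * (32 * (#|A|%:R * (B * C)) * Num.sqrt Z).
    by ring.
  by rewrite ler_pM2l.
by rewrite -ZE; clear - F HT; rewrite -/S in HT; lra.
Qed.

(** * Uniform families *)

Definition cls (I : finType) (T : eqType) (A : {set I}) (f : I -> T) (g : I) : {set I} :=
  [set k in A | f k == f g].

Lemma mem_cls (I : finType) (T : eqType) (A : {set I}) (f : I -> T) (g k : I) :
  (k \in cls A f g) = (k \in A) && (f k == f g).
Proof. by rewrite inE. Qed.

Lemma cls_card_gt0 (R : realType) (I : finType) (T : eqType) (A : {set I}) (f : I -> T) g :
  g \in A -> 0 < #|cls A f g|%:R :> R.
Proof. by move=> gA; rewrite ltr0n; apply/card_gt0P; exists g; rewrite mem_cls gA eqxx. Qed.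

Lemma cls_eq (I : finType) (T : eqType) (A : {set I}) (f : I -> T) (g k : I) :
  f k = f g -> cls A f k = cls A f g.
Proof. by move=> fkg; apply/setP => u; rewrite !mem_cls fkg. Qed.

(** Each [g] is met once for every member of its class, with the inverse weight. Sums over classes
    are thus written as sums over elements, without forming the set of classes. *)
Lemma class_average (R : realType) (I : finType) (T : eqType) (A : {set I}) (f : I -> T)
    (F : I -> R) :
  \sum_(k in A) (\sum_(g in cls A f k) F g) / #|cls A f k|%:R = \sum_(g in A) F g.
Proof.
under eq_bigr do rewrite mulr_suml.
rewrite (exchange_big_dep (mem A)) /=; last by move=> k g _; rewrite mem_cls => /andP[].
apply: eq_bigr => g gA.
transitivity (\sum_(k in cls A f g) F g / #|cls A f g|%:R).
  apply: eq_big => [k|k /andP[_]]; first by rewrite !mem_cls gA /= eq_sym.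
  by rewrite mem_cls => /andP[_ /eqP /cls_eq ->].
by rewrite sumr_const -[LHS]mulr_natr mulfVK // gt_eqF // cls_card_gt0.
Qed.

(* The number of nonempty classes. *)
Definition ncl (R : realType) (I : finType) (T : eqType) (A : {set I}) (f : I -> T) : R :=
  \sum_(g in A) (#|cls A f g|%:R)^-1.

Lemma inv_card_ge0 (R : realType) (I : finType) (C : {set I}) : 0 <= (#|C|%:R : R)^-1.
Proof. by rewrite invr_ge0. Qed.

Lemma ncl_ge0 (R : realType) (I : finType) (T : eqType) (A : {set I}) (f : I -> T) :
  0 <= ncl R A f.
Proof. by apply: sumr_ge0 => g _; apply: inv_card_ge0. Qed.

Lemma cls_card_le (I : finType) (T : eqType) (A : {set I}) (f : I -> T) g :
  (#|cls A f g| <= #|A|)%N.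
Proof. by apply/subset_leq_card/fintype.subsetP => k; rewrite mem_cls => /andP[]. Qed.

Lemma ncl_ge1 (R : realType) (I : finType) (T : eqType) (A : {set I}) (f : I -> T) :
  (0 < #|A|)%N -> 1 <= ncl R A f.
Proof.
move=> A0; have An : #|A|%:R != 0 :> R by rewrite pnatr_eq0 -lt0n.
have -> : 1 = \sum_(g in A) (#|A|%:R)^-1 :> R by rewrite sumr_const -[X in _ = X]mulr_natl mulfV.
apply: ler_sum => g gA; rewrite lef_pV2 ?posrE ?cls_card_gt0 ?ltr0n //.
by rewrite ler_nat cls_card_le.
Qed.

Lemma ncl_refine (R : realType) (I : finType) (T T' : eqType) (A : {set I})
    (f : I -> T) (f' : I -> T') :
  (forall g k, g \in A -> k \in A -> f' k = f' g -> f k = f g) -> ncl R A f <= ncl R A f'.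
Proof.
move=> ff; apply: ler_sum => g gA.
rewrite lef_pV2 ?posrE ?cls_card_gt0 // ler_nat; apply/subset_leq_card/fintype.subsetP => k.
by rewrite !mem_cls => /andP[kA /eqP fk]; rewrite kA /=; apply/eqP; apply: ff.
Qed.

Lemma sum_class_inv (R : realType) (I : finType) (T : eqType) (A : {set I}) (f : I -> T) t :
  \sum_(g in A | f g == t) (#|cls A f g|%:R)^-1 <= 1 :> R.
Proof.
case: (pickP [pred g | (g \in A) && (f g == t)]) => [g0 /= /andP[g0A /eqP <-]|no].
  rewrite (_ : \sum_(g in A | _) _ = \sum_(k in cls A f g0) (#|cls A f g0|%:R)^-1).
    by rewrite sumr_const -[X in X <= _]mulr_natl mulfV // gt_eqF // cls_card_gt0.
  apply: eq_big => [k|k /andP[_ /eqP /cls_eq -> //]]; by rewrite mem_cls.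
by rewrite big_pred0.
Qed.

Lemma ncl_le_size (R : realType) (I : finType) (T : eqType) (A : {set I}) (f : I -> T)
    (L : seq T) : (forall g, g \in A -> f g \in L) -> ncl R A f <= (size L)%:R.
Proof.
move=> fL; rewrite -sum1_size natr_sum.
apply: (@le_trans _ _ (\sum_(t <- L) \sum_(g in A | f g == t) (#|cls A f g|%:R)^-1)).
  under [X in _ <= X]eq_bigr do rewrite big_mkcondr.
  rewrite exchange_big /=; apply: ler_sum => g gA.
  have := fL g gA; elim: L {fL} => // t L IH; rewrite inE big_cons => /orP[/eqP ->|/IH h].
    rewrite eqxx lerDl; apply: sumr_ge0 => s _; case: ifP => _ //; exact: inv_card_ge0.
  by apply: (le_trans h); rewrite lerDr; case: ifP => _ //; exact: inv_card_ge0.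
by apply: ler_sum => t _; apply: sum_class_inv.
Qed.

Lemma ncl_labels (R : realType) (I : finType) (T T' : eqType) (A : {set I})
    (f : I -> T) (f' : I -> T') (s : nat) :
  (forall g, g \in A -> exists2 L : seq T, (size L <= s)%N &
     forall k, k \in cls A f' g -> f k \in L) ->
  ncl R A (fun g => (f' g, f g)) <= s%:R * ncl R A f'.
Proof.
move=> HL; rewrite {1}/ncl -(class_average A f') mulr_sumr; apply: ler_sum => k kA.
rewrite ler_wpM2r ?inv_card_ge0 //; have [L Ls fL] := HL k kA.
apply: (@le_trans _ _ (ncl R (cls A f' k) f)); last first.
  by apply: (le_trans (ncl_le_size R fL)); rewrite ler_nat.
apply: ler_sum => g; rewrite mem_cls => /andP[gA /eqP gk].
rewrite lef_pV2 ?posrE ?cls_card_gt0 //; last by rewrite mem_cls gA gk eqxx.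
rewrite ler_nat; apply/subset_leq_card/fintype.subsetP => u.
by rewrite !mem_cls xpair_eqE gk => /andP[/andP[-> ->] ->].
Qed.

Lemma ncl_subset (R : realType) (I : finType) (T : eqType) (A B : {set I}) (f : I -> T) :
  B \subset A -> ncl R B f <= ncl R A f.
Proof.
move=> /fintype.subsetP BA.
rewrite [X in X <= _](_ : _ =
    \sum_(g in A) if g \in B then (#|cls B f g|%:R)^-1 else 0); last first.
  rewrite -big_mkcondr; apply: eq_bigl => g; case gB: (g \in B); last by rewrite andbF.
  by rewrite (BA _ gB).
rewrite -(class_average A f); apply: ler_sum => k kA.
rewrite ler_pdivrMr ?cls_card_gt0 // mulVf ?gt_eqF ?cls_card_gt0 //.
apply: le_trans (@sum_class_inv R I T B f (f k)).
rewrite -big_mkcondr /= le_eqVlt; apply/orP; left; apply/eqP; apply: eq_bigl => g.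
by rewrite mem_cls; case gB: (g \in B); rewrite ?andbF //= andbT BA.
Qed.

(** There are [ncl R A f] classes, and a light one has fewer than [#|A| / (lam * ncl R A f)]
    elements. *)
Lemma light_bound (R : realType) (I : finType) (T : eqType) (A : {set I}) (f : I -> T)
    (lam : R) :
  0 < lam -> (0 < #|A|)%N ->
  lam * #|[set g in A | #|cls A f g|%:R * (lam * ncl R A f) < #|A|%:R]|%:R <= #|A|%:R :> R.
Proof.
move=> lam0 A0; set B := [set g in A | _].
have N1 := ncl_ge1 R f A0; have N0 := lt_le_trans ltr01 N1.
have An : 0 < #|A|%:R :> R by rewrite ltr0n.
have h : #|B|%:R * (lam * ncl R A f / #|A|%:R) <= ncl R A f.
  rewrite mulr_natl -sumr_const big_mkcond /= [X in _ <= X]big_mkcond /=.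
  apply: ler_sum => g _; rewrite inE; case gA: (g \in A) => //=.
  case: ifP => [h|_]; last exact: inv_card_ge0.
  have c0 : 0 < #|cls A f g|%:R :> R by rewrite cls_card_gt0.
  rewrite ler_pdivrMr // [X in _ <= X]mulrC ler_pdivlMr // mulrC; exact: ltW.
rewrite -(ler_pM2r N0) [X in _ <= X]mulrC -ler_pdivrMr //.
by apply: le_trans h; rewrite le_eqVlt; apply/orP; left; apply/eqP; ring.
Qed.

Lemma heavy_bound (R : realType) (I : finType) (T : eqType) (A : {set I}) (f : I -> T)
    (b : R) : 0 < b ->
  ncl R [set g in A | b < #|cls A f g|%:R] f * b <= #|[set g in A | (b < #|cls A f g|%:R)%R]|%:R.
Proof.
move=> b0; set B := [set g in A | _].
rewrite -[X in _ <= X]mulr1 mulr_natl -sumr_const /ncl mulr_suml; apply: ler_sum => g gB.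
have eB : cls B f g = cls A f g.
  apply/setP => k; rewrite !mem_cls inE; case: (k \in A) => //=.
  case: eqP => [/(@cls_eq _ _ A) ->|_]; last by rewrite andbF.
  by move: gB; rewrite inE => /andP[_ ->].
rewrite mulrC ler_pdivrMr ?mul1r ?cls_card_gt0 // eB.
by move: gB; rewrite inE => /andP[_ /ltW].
Qed.

Lemma ncl_cauchy (R : realType) (I : finType) (T : eqType) (A : {set I}) (f : I -> T) :
  #|A|%:R ^+ 2 <= ncl R A f * \sum_(g in A) #|cls A f g|%:R.
Proof.
pose u g : R := if g \in A then Num.sqrt (#|cls A f g|%:R^-1) else 0.
pose v g : R := if g \in A then Num.sqrt #|cls A f g|%:R else 0.
have := cauchy_schwarz u v.
have -> : \sum_g u g * v g = #|A|%:R.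
  rewrite -sumr_const [RHS]big_mkcond; apply: eq_bigr => g _; rewrite /u /v.
  case: ifP => gA; last by rewrite mul0r.
  by rewrite -sqrtrM ?inv_card_ge0 // mulVf ?gt_eqF ?cls_card_gt0 // sqrtr1.
have -> : \sum_g u g ^+ 2 = ncl R A f.
  rewrite /ncl [RHS]big_mkcond; apply: eq_bigr => g _; rewrite /u.
  by case: ifP => gA; rewrite ?expr0n // sqr_sqrtr // inv_card_ge0.
have -> // : \sum_g v g ^+ 2 = \sum_(g in A) #|cls A f g|%:R.
rewrite [RHS]big_mkcond; apply: eq_bigr => g _; rewrite /v.
by case: ifP => gA; rewrite ?expr0n // sqr_sqrtr.
Qed.

(* [Y] maximizes [#|Y| ^ a] divided by the product of its class counts; the elements in
   overfull classes are few, for otherwise they would beat the maximum, and are discarded. *)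
Lemma uniform_subset (R : realType) (I J : finType) (T : eqType) (A : {set I})
    (f : J -> I -> T) (Q B : R) (a : nat) :
  (0 < #|A|)%N -> (0 < a)%N -> 0 < Q -> (forall z, ncl R A (f z) <= B) ->
  B ^+ #|J| <= Q ^+ a -> (2 * #|J|%:R) ^+ a <= Q ->
  exists Y : {set I}, [/\ Y \subset A, #|A|%:R <= 2 * Q * #|Y|%:R &
    forall z g, g \in Y -> #|cls Y (f z) g|%:R * ncl R Y (f z) <= 2 * Q * #|Y|%:R].
Proof.
move=> A0 a0 Q0 NB BQ JQ.
pose P (Y : {set I}) := (Y \subset A) && (0 < #|Y|)%N.
pose Phi (Y : {set I}) : R := #|Y|%:R ^+ a / \prod_z ncl R Y (f z).
have PA : P A by rewrite /P fintype.subxx.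
have [Y0 /andP[Y0A n0] Ymax] : exists2 Y, P Y & forall Y', P Y' -> Phi Y' <= Phi Y.
  by case: (arg_maxP Phi PA) => Y PY H; exists Y.
set n := #|Y0| in n0.
have N1 (Y : {set I}) z : (0 < #|Y|)%N -> 1 <= ncl R Y (f z) by apply: ncl_ge1.
have prod0 (Y : {set I}) : (0 < #|Y|)%N -> 0 < \prod_z ncl R Y (f z).
  by move=> Yn; apply: prodr_gt0 => z _; apply: lt_le_trans (N1 _ _ Yn).
have nR : 0 < n%:R :> R by rewrite ltr0n.
have An : #|A|%:R <= n%:R * Q.
  rewrite -(@ler_pXn2r _ a) ?nnegrE //; last by apply: mulr_ge0; exact: ltW.
  have := Ymax _ PA; rewrite /Phi ler_pdivrMr ?prod0 // => h.
  apply: (le_trans h); rewrite mulrAC ler_pdivrMr ?prod0 // exprMn -mulrA.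
  apply: ler_wpM2l; first by rewrite exprn_ge0 // ltW.
  apply: (@le_trans _ _ (B ^+ #|J|)).
    rewrite -prodr_const; apply: ler_prod => z _; rewrite NB andbT.
    exact: ncl_ge0.
  apply: (le_trans BQ); rewrite ler_peMr //; first by rewrite exprn_ge0 // ltW.
  apply: (@le_trans _ _ (\prod_(z : J) 1)); first by rewrite big1_eq.
  by apply: ler_prod => z _; rewrite ler01 N1.
pose H z := [set g in Y0 | Q * n%:R / ncl R Y0 (f z) < #|cls Y0 (f z) g|%:R].
have HY z : H z \subset Y0 by apply/fintype.subsetP => g; rewrite inE => /andP[].
(* Passing to [H z] divides the count at [z] by at least [Q]. If [H z] were larger than stated, the
   numerator would shrink by less than [(2 * #|J|) ^ a <= Q], contradicting the maximality of
   [Y0]. *)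
have Hn z : 2 * #|J|%:R * #|H z|%:R <= n%:R :> R.
  have [-> |H0] := posnP #|H z|; first by rewrite mulr0 ltW.
  rewrite -(@ler_pXn2r _ a) ?nnegrE //.
  have PH : P (H z) by rewrite /P (fintype.subset_trans (HY z)).
  have := Ymax _ PH; rewrite /Phi ler_pdivrMr ?prod0 // mulrAC ler_pdivlMr ?prod0 // => h.
  have NQ : (\prod_w ncl R (H z) (f w)) * Q <= \prod_w ncl R Y0 (f w).
    rewrite (bigD1 z) //= [X in _ <= X](bigD1 z) //= mulrAC.
    apply: ler_pM.
    - by rewrite mulr_ge0 ?ncl_ge0 // ltW.
    - by apply: prodr_ge0 => w _; apply: ncl_ge0.
    - have b0 : 0 < Q * n%:R / ncl R Y0 (f z).
        by rewrite divr_gt0 ?mulr_gt0 // (lt_le_trans _ (N1 _ _ n0)).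
      have := @heavy_bound R I T Y0 (f z) _ b0; rewrite -/(H z) => hb.
      have hn : #|H z|%:R <= n%:R :> R by rewrite ler_nat; apply: subset_leq_card.
      have := le_trans hb hn.
      rewrite mulrA ler_pdivrMr ?(lt_le_trans _ (N1 _ _ n0)) // mulrA [n%:R * _]mulrC.
      by rewrite ler_pM2r.
    apply: ler_prod => w _; rewrite ncl_ge0 /=; exact: ncl_subset.
  have pH := prod0 _ H0; have pY := prod0 _ n0.
  have h2 : (#|H z|%:R ^+ a * Q) * (\prod_w ncl R (H z) (f w))
      <= n%:R ^+ a * (\prod_w ncl R (H z) (f w)).
    apply: le_trans h; rewrite -mulrA ler_wpM2l ?exprn_ge0 //.
    by rewrite mulrC.
  rewrite ler_pM2r // in h2.
  rewrite exprMn mulrC; apply: le_trans h2; rewrite ler_wpM2l // exprn_ge0 //.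
pose Y := Y0 :\: \bigcup_z H z.
have YY0 : Y \subset Y0 by apply: subsetDl.
have Hsum : 2 * #|\bigcup_z H z|%:R <= n%:R :> R.
  have [J0|J0] := posnP #|J|.
    by rewrite big_pred0 ?cards0 ?mulr0 ?ltW // => z; have := fintype0 z J0.
  have JR : 0 < #|J|%:R :> R by rewrite ltr0n.
  have h1 : #|\bigcup_z H z|%:R <= \sum_z #|H z|%:R :> R.
    rewrite -natr_sum ler_nat; elim/big_rec2: _ => [|z k U _ h]; first by rewrite cards0.
    by apply: (leq_trans (leq_card_setU _ _)); rewrite leq_add2l.
  have h2 : #|J|%:R * (2 * \sum_z #|H z|%:R) <= #|J|%:R * n%:R :> R.
    have -> : #|J|%:R * n%:R = \sum_(z : J) n%:R :> R by rewrite sumr_const -[RHS]mulr_natl.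
    rewrite mulr_sumr mulr_sumr.
    apply: ler_sum => z _; apply: le_trans (Hn z).
    by rewrite mulrA [#|J|%:R * 2]mulrC.
  rewrite ler_pM2l // in h2; apply: le_trans h2; rewrite ler_pM2l //.
have Yn : n%:R <= 2 * #|Y|%:R :> R.
  have e : (n <= #|Y| + #|\bigcup_z H z|)%N.
    rewrite /n -(cardsID (\bigcup_z H z) Y0) addnC leq_add2l.
    by apply/subset_leq_card/subsetIr.
  have : n%:R <= #|Y|%:R + #|\bigcup_z H z|%:R :> R by rewrite -natrD ler_nat.
  by clear - Hsum; lra.
exists Y; split; first exact: (fintype.subset_trans YY0).
  by apply: (le_trans An); clear - Yn Q0; nra.
move=> z g; rewrite inE => /andP[gH gY0].
have gnH : ~~ (g \in H z).
  by apply: contra gH => gz; apply/bigcupP; exists z.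
have N0 := lt_le_trans ltr01 (N1 Y0 z n0).
have hc : #|cls Y0 (f z) g|%:R * ncl R Y0 (f z) <= Q * n%:R.
  by move: gnH; rewrite inE gY0 /= -leNgt ler_pdivlMr.
apply: (@le_trans _ _ (#|cls Y0 (f z) g|%:R * ncl R Y0 (f z))).
  apply: ler_pM => //; [exact: ncl_ge0| |exact: ncl_subset].
  rewrite ler_nat; apply/subset_leq_card/fintype.subsetP => k; rewrite !mem_cls.
  by move=> /andP[kY ->]; rewrite (fintype.subsetP YY0).
by apply: (le_trans hc); clear - Yn Q0; nra.
Qed.

(** * Sheared cells *)

Lemma floor_shift (R : realType) (n : int) (u : R) :
  Num.floor (n%:~R + u) = n + Num.floor u.
Proof. by rewrite floorDzr ?intr_int // intrKfloor. Qed.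

Lemma floor_close (R : realType) (s : int) (u v : R) :
  u - v < s%:~R -> Num.floor u <= Num.floor v + s.
Proof.
move=> uv; rewrite -ltzD1 -(ltr_int R) !intrD.
have := floor_le u; have := floorD1_gt v; rewrite intrD.
by move: (Num.floor u)%:~R (Num.floor v)%:~R => *; lra.
Qed.

Lemma floor_eq_dist (R : realType) (u v : R) :
  Num.floor u = Num.floor v -> `|u - v| < 1.
Proof.
move=> uv; have := floor_le u; have := floorD1_gt v; have := floor_le v.
have := floorD1_gt u; rewrite uv intrD ltr_norml.
by move: (Num.floor v)%:~R => *; apply/andP; split; lra.
Qed.

(* [y] is measured from the line through the corner of the [(x, m)]-box, so that all cells
   of a level are images of each other under affine maps preserving [slant] up to
   a constant factor. *)
Definition cell (R : realType) (I : Type) (Q : nat) (x m y : I -> R) (i j : nat) (g : I) :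
    int * int * int :=
  let a := Num.floor (x g * Q%:R ^+ i) in
  let b := Num.floor (m g * Q%:R ^+ j) in
  (a, b, Num.floor ((y g - b%:~R / Q%:R ^+ j * (x g - a%:~R / Q%:R ^+ i)) * Q%:R ^+ (i + j))).

Section Local.
Variables (R : realType) (I : Type) (Q : nat) (x m y : I -> R) (i j : nat)
  (l : int * int * int).
Definition locx g : R := x g * Q%:R ^+ i - (l.1.1)%:~R.
Definition locm g : R := m g * Q%:R ^+ j - (l.1.2)%:~R.
Definition locy g : R :=
  (y g - l.1.2%:~R / Q%:R ^+ j * (x g - l.1.1%:~R / Q%:R ^+ i)) * Q%:R ^+ (i + j) - l.2%:~R.
(** Composition law for labels: [r] is a label in the coordinates centred at [l], the result is the
    global one. The cross term comes from the shear. *)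
Definition embed (h1 h2 : nat) (r : int * int * int) : int * int * int :=
  (l.1.1 * Q%:Z ^+ h1 + r.1.1, l.1.2 * Q%:Z ^+ h2 + r.1.2,
   l.2 * Q%:Z ^+ (h1 + h2) + l.1.2 * Q%:Z ^+ h2 * r.1.1 + r.2).
End Local.

Lemma embed_inj (Q : nat) l h1 h2 : injective (embed Q l h1 h2).
Proof.
move=> [[r1 r2] r3] [[s1 s2] s3]; rewrite /embed /= => -[/addrI -> /addrI ->].
by move/addrI => ->.
Qed.

(** Self-similarity: local coordinates shift every floor by an integer, so they induce the same
    partitions at finer levels, and a cell can be treated as the unit cube. *)
Lemma cell_local (R : realType) (I : Type) (Q : nat) (x m y : I -> R) i j l h1 h2 g :
  (0 < Q)%N ->
  cell Q x m y (i + h1) (j + h2) g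
  = embed Q l h1 h2 (cell Q (locx Q x i l) (locm Q m j l) (locy Q x y i j l) h1 h2 g).
Proof.
move=> Q0; case: l => [[a b] c]; rewrite /cell /embed /locx /locm /locy /=.
have q0 : Q%:R != 0 :> R by rewrite pnatr_eq0 -lt0n.
have eX n : (Q%:Z ^+ n)%:~R = Q%:R ^+ n :> R by rewrite rmorphXn.
have e1 : Num.floor (x g * Q%:R ^+ (i + h1))
   = a * Q%:Z ^+ h1 + Num.floor ((x g * Q%:R ^+ i - a%:~R) * Q%:R ^+ h1).
  by rewrite -floor_shift intrM eX exprD; congr Num.floor; ring.
have e2 : Num.floor (m g * Q%:R ^+ (j + h2))
   = b * Q%:Z ^+ h2 + Num.floor ((m g * Q%:R ^+ j - b%:~R) * Q%:R ^+ h2).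
  by rewrite -floor_shift intrM eX exprD; congr Num.floor; ring.
rewrite e1 e2; congr (_, _, _).
move: (Num.floor ((x g * Q%:R ^+ i - _) * _)) (Num.floor ((m g * Q%:R ^+ j - _) * _)) => r1 r2.
rewrite -floor_shift; congr Num.floor; rewrite !(intrD, intrM) !eX !exprD.
have p0 n : Q%:R ^+ n != 0 :> R by rewrite expf_neq0.
move: (p0 i) (p0 j) (p0 h1) (p0 h2).
move: (Q%:R ^+ i) (Q%:R ^+ j) (Q%:R ^+ h1) (Q%:R ^+ h2) => qi qj q1 q2 i0 j0 h10 h20.
by field; rewrite i0 j0 h10 h20.
Qed.

Lemma loc_range (R : realType) (I : Type) (Q : nat) (x m y : I -> R) i j l g :
  cell Q x m y i j g = l ->
  [/\ 0 <= locx Q x i l g < 1, 0 <= locm Q m j l g < 1 & 0 <= locy Q x y i j l g < 1].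
Proof.
move=> <-; rewrite /cell /locx /locm /locy /=.
by split; rewrite subr_ge0 floor_le /= ltrBlDl; have := floorD1_gt;
  move=> H; apply: (lt_le_trans (H _ _)); rewrite intrD.
Qed.

Lemma slant_local (R : realType) (I : finType) (Q : nat) (x m y : I -> R) i j l g k :
  (0 < Q)%N ->
  slant (locx Q x i l) (locm Q m j l) (locy Q x y i j l) g k
    = slant x m y g k * Q%:R ^+ (i + j).
Proof.
move=> Q0; case: l => [[a b] c]; rewrite /slant /locx /locm /locy /= exprD.
have p0 n : Q%:R ^+ n != 0 :> R by rewrite expf_neq0 // pnatr_eq0 -lt0n.
move: (p0 i) (p0 j); move: (Q%:R ^+ i) (Q%:R ^+ j) => qi qj i0 j0.
by field; rewrite i0 j0.
Qed.

Lemma cls_local (R : realType) (I : finType) (Q : nat) (x m y : I -> R) i j l h1 h2 g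
    (A : {set I}) :
  (0 < Q)%N ->
  cls A (cell Q (locx Q x i l) (locm Q m j l) (locy Q x y i j l) h1 h2) g
    = cls A (cell Q x m y (i + h1) (j + h2)) g.
Proof.
move=> Q0; apply/setP => k; rewrite !mem_cls; congr (_ && _).
by rewrite !(cell_local _ _ _ _ _ l) // (inj_eq (@embed_inj _ _ _ _)).
Qed.

Definition irange (c : int) (n : nat) : seq int := [seq c + k%:Z | k <- iota 0 n].

Lemma size_irange c n : size (irange c n) = n.
Proof. by rewrite size_map size_iota. Qed.

Lemma mem_irange (c u : int) n : c <= u -> u < c + n%:Z -> u \in irange c n.
Proof.
move=> cu un; apply/mapP; exists `|u - c|%N; last by rewrite gez0_abs ?subr_ge0 //; ring.
by rewrite mem_iota /= add0n -ltz_nat gez0_abs ?subr_ge0 // ltrBlDl.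
Qed.

Definition labels (c1 : int) n1 (c2 : int) n2 (c3 : int) n3 : seq (int * int * int) :=
  [seq (p, v) | p <- [seq (s, u) | s <- irange c1 n1, u <- irange c2 n2], v <- irange c3 n3].

Lemma size_labels c1 n1 c2 n2 c3 n3 : size (labels c1 n1 c2 n2 c3 n3) = (n1 * n2 * n3)%N.
Proof. by rewrite !size_allpairs !size_irange. Qed.

Lemma mem_labels c1 n1 c2 n2 c3 n3 (r : int * int * int) :
  c1 <= r.1.1 < c1 + n1%:Z -> c2 <= r.1.2 < c2 + n2%:Z -> c3 <= r.2 < c3 + n3%:Z ->
  r \in labels c1 n1 c2 n2 c3 n3.
Proof.
case: r => [[r1 r2] r3] /= /andP[? ?] /andP[? ?] /andP[? ?].
by apply: allpairs_f; [apply: allpairs_f|]; apply: mem_irange.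
Qed.

Lemma floor_range (R : realType) (u : R) (a : int) (n : nat) :
  a%:~R <= u -> u < a%:~R + n%:R -> a <= Num.floor u < a + n%:Z.
Proof. by move=> h1 h2; rewrite floor_ge_int h1 floor_lt_int intrD. Qed.

(** After the shear the height lies in [(-1, 1)], hence the factor 2 in the number of heights. *)
Lemma unit_cell (R : realType) (I : Type) (Q : nat) (x m y : I -> R) h1 h2 g :
  (0 < Q)%N -> 0 <= x g < 1 -> 0 <= m g < 1 -> 0 <= y g < 1 ->
  cell Q x m y h1 h2 g
    \in labels 0 (Q ^ h1) 0 (Q ^ h2) (- (Q ^ (h1 + h2))%:Z) (2 * Q ^ (h1 + h2)).
Proof.
move=> Q0 /andP[x0 x1] /andP[m0 m1] /andP[y0 y1].
have q0 n : 0 < Q%:R ^+ n :> R by rewrite exprn_gt0 // ltr0n.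
have nX n : (Q ^ n)%N%:R = Q%:R ^+ n :> R by rewrite natrX.
have eN n : (- (Q ^ n)%:Z)%:~R = - Q%:R ^+ n :> R by rewrite intrN -pmulrn nX.
set a := Num.floor (x g * Q%:R ^+ h1); set b := Num.floor (m g * Q%:R ^+ h2).
have /andP[b0 b1] : 0 <= (b%:~R : R) / Q%:R ^+ h2 < 1.
  rewrite divr_ge0 ?ler0z ?floor_ge0 ?mulr_ge0 ?(ltW (q0 _)) //=.
  by rewrite ltr_pdivrMr // mul1r (le_lt_trans (floor_le _)) // gtr_pMl.
have /andP[a0 a1] : 0 <= x g - a%:~R / Q%:R ^+ h1 < 1.
  rewrite subr_ge0 ler_pdivrMr // floor_le /= (le_lt_trans _ x1) // gerBl.
  by rewrite divr_ge0 ?ler0z ?floor_ge0 ?mulr_ge0 ?(ltW (q0 _)).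
have p0 : 0 <= b%:~R / Q%:R ^+ h2 * (x g - a%:~R / Q%:R ^+ h1) by apply: mulr_ge0.
have p1 : b%:~R / Q%:R ^+ h2 * (x g - a%:~R / Q%:R ^+ h1) < 1 by apply: mulr_ilt1.
apply: mem_labels => /=; apply: floor_range; rewrite ?nX ?add0r ?eN.
- by rewrite mulr_ge0 // ltW.
- by rewrite gtr_pMl.
- by rewrite mulr_ge0 // ltW.
- by rewrite gtr_pMl.
- by rewrite -mulN1r ler_pM2r //; move: y0 p1; clear; lra.
- have -> : - Q%:R ^+ (h1 + h2) + (2 * Q ^ (h1 + h2))%N%:R = 1 * Q%:R ^+ (h1 + h2) :> R.
    by rewrite natrM nX; ring.
  by rewrite ltr_pM2r //; move: y1 p0; clear; lra.
Qed.

Lemma floor_nest (R : realType) (Q : nat) (u v : R) h : (0 < Q)%N ->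
  Num.floor (u * Q%:R ^+ h) = Num.floor (v * Q%:R ^+ h) -> Num.floor u = Num.floor v.
Proof.
move=> Q0 uv; have q0 : 0 < Q%:R ^+ h :> R by rewrite exprn_gt0 // ltr0n.
have H (n : int) : (n <= Num.floor u) = (n <= Num.floor v).
  have e (w : R) : (n <= Num.floor w) = (n * Q%:Z ^+ h <= Num.floor (w * Q%:R ^+ h)).
    by rewrite !floor_ge_int intrM rmorphXn ler_pM2r.
  by rewrite !e uv.
by apply/eqP; rewrite eq_le H lexx -H lexx.
Qed.

(** Cells are nested in [x] and [m] but not in [y], because the finer cell is sheared along another
    slope. In local coordinates that shear moves heights by at most 1 and the fine cell has height
    at most 1, so only five coarse heights are possible. *)
Lemma coarse_labels (R : realType) (I : Type) (Q : nat) (x m y : I -> R) i j h1 h2 g k l :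
  (0 < Q)%N -> cell Q x m y i j g = l ->
  cell Q x m y (i + h1) (j + h2) k = cell Q x m y (i + h1) (j + h2) g ->
  cell Q x m y i j k \in labels l.1.1 1 l.1.2 1 (l.2 - 2) 5.
Proof.
move=> Q0 lE E; have [gx gm gy] := loc_range lE.
have q0 n : 0 < Q%:R ^+ n :> R by rewrite exprn_gt0 // ltr0n.
have Ex : (cell Q x m y i j k).1.1 = l.1.1.
  by rewrite -lE; case: E => + _ _; rewrite exprD mulrA [x g * _]mulrA => /(floor_nest Q0).
have Em : (cell Q x m y i j k).1.2 = l.1.2.
  by rewrite -lE; case: E => _ + _; rewrite exprD mulrA [m g * _]mulrA => /(floor_nest Q0).
have kx : 0 <= locx Q x i l k < 1.
  by have [] := loc_range (erefl (cell Q x m y i j k)); rewrite /locx Ex.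
have yk := floor_eq_dist (congr1 snd E).
have E' := E; rewrite !(cell_local _ _ _ _ _ l) // in E'; move/embed_inj in E'.
have rm : 0 <= ((cell Q (locx Q x i l) (locm Q m j l) (locy Q x y i j l) h1 h2 g).1.2%:~R : R)
    / Q%:R ^+ h2 < 1.
  have /andP[g0 g1] := gm.
  rewrite /= divr_ge0 ?ler0z ?floor_ge0 ?mulr_ge0 ?(ltW (q0 _)) //=.
  by rewrite ltr_pdivrMr // mul1r (le_lt_trans (floor_le _)) // gtr_pMl.
have {}yk := floor_eq_dist (congr1 snd E').
move: E' => [Ea Eb _].
move: yk; rewrite /= Ea Eb; move: rm => /=.
set r1 := Num.floor (_ * Q%:R ^+ h1); set r2 := _ / Q%:R ^+ h2 => /andP[r20 r21].
rewrite -mulrBl normrM (gtr0_norm (q0 _)) => yk.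
have Qn : 1 <= Q%:R ^+ (h1 + h2) :> R by rewrite exprn_ege1 // ler1n.
have {}yk : `|locy Q x y i j l k - locy Q x y i j l g
   - r2 * (locx Q x i l k - locx Q x i l g)| < 1.
  have -> : locy Q x y i j l k - locy Q x y i j l g
   - r2 * (locx Q x i l k - locx Q x i l g)
   = locy Q x y i j l k - r2 * (locx Q x i l k - r1%:~R / Q%:R ^+ h1) -
     (locy Q x y i j l g - r2 * (locx Q x i l g - r1%:~R / Q%:R ^+ h1)) by ring.
  by apply: le_lt_trans yk; rewrite ler_peMr.
have {}yk : `|locy Q x y i j l k - locy Q x y i j l g| < 2.
  have h := ler_normB (locy Q x y i j l k - locy Q x y i j l g
   - r2 * (locx Q x i l k - locx Q x i l g)) (- (r2 * (locx Q x i l k - locx Q x i l g))).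
  rewrite opprK subrK in h; apply: (le_lt_trans h).
  have : `|- (r2 * (locx Q x i l k - locx Q x i l g))| <= 1.
    rewrite normrN normrM (ger0_norm r20) mulr_ile1 //; first exact: ltW.
    by move: gx kx; rewrite ler_norml => /andP[? ?] /andP[? ?]; apply/andP; split; lra.
  by move: yk; lra.
move: yk; rewrite /locy ltr_norml => /andP[yk1 yk2].
apply: mem_labels.
- by rewrite Ex lexx /= ltrDl.
- by rewrite Em lexx /= ltrDl.
have K2 : (cell Q x m y i j k).2 = Num.floor ((y k - l.1.2%:~R / Q%:R ^+ j *
   (x k - l.1.1%:~R / Q%:R ^+ i)) * Q%:R ^+ (i + j)).
  by rewrite -Ex -Em.
have L2 : l.2 = Num.floor ((y g - l.1.2%:~R / Q%:R ^+ j *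
   (x g - l.1.1%:~R / Q%:R ^+ i)) * Q%:R ^+ (i + j)).
  by rewrite -lE.
rewrite K2 L2 lerBlDr; apply/andP; split.
  by apply: floor_close; move: yk1; rewrite /=; lra.
have : Num.floor ((y k - l.1.2%:~R / Q%:R ^+ j *
   (x k - l.1.1%:~R / Q%:R ^+ i)) * Q%:R ^+ (i + j)) <= l.2 + 2.
  rewrite L2.
  by apply: floor_close; move: yk2; rewrite /=; lra.
by move=> h; apply: (le_lt_trans h); rewrite -L2 -addrA ltrD2l.
Qed.

Lemma ncl_unit (R : realType) (I : finType) (Q : nat) (x m y : I -> R) (A : {set I}) h1 h2 :
  (0 < Q)%N -> (forall g, g \in A -> 0 <= x g < 1) -> (forall g, g \in A -> 0 <= m g < 1) ->
  (forall g, g \in A -> 0 <= y g < 1) ->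
  ncl R A (cell Q x m y h1 h2) <= (2 * Q ^ (2 * (h1 + h2)))%N%:R.
Proof.
move=> Q0 x01 m01 y01.
apply: (le_trans (ncl_le_size R (fun g gA => unit_cell h1 h2 Q0 (x01 g gA) (m01 g gA) (y01 g gA)))).
rewrite size_labels ler_nat mulnCA leq_mul2l /=.
by rewrite mul2n -addnn !expnD leqnn.
Qed.

Lemma ncl_fine (R : realType) (I : finType) (Q : nat) (x m y : I -> R) (A : {set I}) i j h1 h2 :
  (0 < Q)%N ->
  ncl R A (cell Q x m y (i + h1) (j + h2))
    <= (2 * Q ^ (2 * (h1 + h2)))%N%:R * ncl R A (cell Q x m y i j).
Proof.
move=> Q0; apply: le_trans (@ncl_labels R I _ _ A (cell Q x m y (i + h1) (j + h2)) _ _ _).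
  by apply: ncl_refine => g k gA kA /(congr1 snd).
move=> g gA; set l := cell Q x m y i j g.
exists [seq embed Q l h1 h2 r | r <- labels 0 (Q ^ h1) 0 (Q ^ h2)
  (- (Q ^ (h1 + h2))%:Z) (2 * Q ^ (h1 + h2))].
  rewrite size_map size_labels mulnCA leq_mul2l /=.
  by rewrite mul2n -addnn !expnD leqnn.
move=> k; rewrite mem_cls => /andP[kA /eqP kl]; have [? ? ?] := loc_range kl.
by rewrite (cell_local _ _ _ _ _ l) //; apply: map_f; apply: unit_cell.
Qed.

Lemma ncl_joint (R : realType) (I : finType) (Q : nat) (x m y : I -> R) (A : {set I}) i j h1 h2 :
  (0 < Q)%N ->
  ncl R A (fun g => (cell Q x m y (i + h1) (j + h2) g, cell Q x m y i j g))
    <= 5 * ncl R A (cell Q x m y (i + h1) (j + h2)).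
Proof.
move=> Q0; apply: ncl_labels => g gA.
set l := cell Q x m y i j g; exists (labels l.1.1 1 l.1.2 1 (l.2 - 2) 5).
  by rewrite size_labels.
by move=> k; rewrite mem_cls => /andP[kA /eqP kl]; apply: coarse_labels kl.
Qed.

Lemma ncl_coarse (R : realType) (I : finType) (Q : nat) (x m y : I -> R) (A : {set I}) i j h1 h2 :
  (0 < Q)%N ->
  ncl R A (cell Q x m y i j) <= 5 * ncl R A (cell Q x m y (i + h1) (j + h2)).
Proof.
move=> Q0; apply: le_trans (ncl_joint _ _ _ _ _ _ _ _ Q0).
by apply: ncl_refine => g k gA kA /(congr1 snd).
Qed.

(** * Incidences inside a cell *)

Lemma card_le_labels (R : realType) (I : finType) (T : eqType) (A S : {set I})
    (F : I -> T) (L : seq T) (f : R) :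
  0 <= f -> S \subset A -> (forall g, g \in S -> F g \in L) ->
  (forall g, g \in A -> #|cls A F g|%:R <= f) -> #|S|%:R <= (size L)%:R * f.
Proof.
move=> f0 SA SL Af; apply: (@le_trans _ _ (ncl R S F * f)); last first.
  by rewrite ler_wpM2r //; apply: ncl_le_size.
rewrite -[X in X <= _]mulr1 mulr_natl -sumr_const /ncl mulr_suml; apply: ler_sum => g gS.
rewrite mulrC ler_pdivlMr ?cls_card_gt0 // mul1r.
apply: le_trans (Af g (fintype.subsetP SA _ gS)).
rewrite ler_nat; apply/subset_leq_card/fintype.subsetP => k.
by rewrite !mem_cls => /andP[kS ->]; rewrite (fintype.subsetP SA).
Qed.

Lemma unit_floor (R : realType) (q u : R) : 0 <= u < 1 -> Num.floor (u * q ^+ 0) = 0.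
Proof. by move=> u01; apply: floor_def; rewrite expr0 mulr1 add0r. Qed.

Lemma cell_point (R : realType) (I : Type) (Q : nat) (x m y : I -> R) h g : 0 <= m g < 1 ->
  cell Q x m y h 0 g = (Num.floor (x g * Q%:R ^+ h), 0, Num.floor (y g * Q%:R ^+ h)).
Proof. by move=> mg; rewrite /cell (unit_floor _ mg) addn0 !mul0r subr0. Qed.

(** Level [(h, 0)] sees only the point of a flag; level [(0, h)] sees only its line, through the
    rounded slope and the resulting intercept. *)
Lemma cell_line (R : realType) (I : Type) (Q : nat) (x m y : I -> R) h g : 0 <= x g < 1 ->
  cell Q x m y 0 h g = (0, Num.floor (m g * Q%:R ^+ h),
    Num.floor ((y g - (Num.floor (m g * Q%:R ^+ h))%:~R / Q%:R ^+ h * x g) * Q%:R ^+ h)).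
Proof. by move=> xg; rewrite /cell (unit_floor _ xg) add0n mul0r subr0. Qed.

Section Unit.
Variables (R : realType) (I : finType) (Q : nat) (x m y : I -> R) (A : {set I}).
Hypothesis Q0 : (0 < Q)%N.
Hypothesis x01 : forall g, g \in A -> 0 <= x g < 1.
Hypothesis m01 : forall g, g \in A -> 0 <= m g < 1.
Hypothesis y01 : forall g, g \in A -> 0 <= y g < 1.

(** Four errors of size [1 / Q ^ h]: the height of the point, the intercept of the line, the
    rounding of its slope, and the horizontal displacement of the point. *)
Lemma flag_slant h g j k : g \in A -> j \in A -> k \in A ->
  cell Q x m y h 0 j = cell Q x m y h 0 g -> cell Q x m y 0 h k = cell Q x m y 0 h g ->
  `|slant x m y j k| < 4 / Q%:R ^+ h.
Proof using Q0 x01 m01 y01.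
move=> gA jA kA; rewrite !cell_point ?m01 // !cell_line ?x01 // => -[jx jy] [km ky].
have q0 : 0 < Q%:R ^+ h :> R by rewrite exprn_gt0 // ltr0n.
have := floor_eq_dist jx; have := floor_eq_dist jy; have := floor_eq_dist ky.
rewrite km -!mulrBl !normrM (gtr0_norm q0) -!ltr_pdivlMr // => ky' jy' jx'.
set w := 1 / Q%:R ^+ h in ky' jy' jx'.
have -> : 4 / Q%:R ^+ h = w + w + w + w by rewrite /w; ring.
set be := (Num.floor (m g * Q%:R ^+ h))%:~R / Q%:R ^+ h in ky'.
have be1 : 0 <= m k - be <= w.
  rewrite /be -km subr_ge0 ler_pdivrMr // floor_le /= lerBlDl /w -mulrDl ler_pdivlMr //.
  by have := floorD1_gt (m k * Q%:R ^+ h); rewrite intrD => /ltW.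
have -> : slant x m y j k = (y j - y g) - (y k - be * x k - (y g - be * x g))
   - (m k - be) * (x g - x k) - m k * (x j - x g) by rewrite /slant; ring.
have /andP[x0 x1] := x01 gA; have /andP[x0' x1'] := x01 kA; have /andP[m0 m1] := m01 kA.
have h1 : `|(m k - be) * (x g - x k)| <= w.
  rewrite normrM -[X in _ <= X]mulr1; apply: ler_pM => //.
    by rewrite ger0_norm //; case/andP: be1.
  by rewrite ler_norml; apply/andP; split; lra.
have h2 : `|m k * (x j - x g)| <= w.
  rewrite normrM -[X in _ <= X]mul1r; apply: ler_pM => //; last exact: ltW.
  by rewrite ger0_norm // ltW.
apply: le_lt_trans (ler_normB _ _) _; apply: ltr_leD => //.
apply: le_lt_trans (ler_normB _ _) _; apply: ltr_leD => //.
by apply: le_lt_trans (ler_normB _ _) _; apply: ltrD.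
Qed.

(** The point cell and the line cell fix [x] and [m] at scale [Q ^ -h], but [y] only at the same
    scale, whereas cells of level [(h, h)] have height [Q ^ -2h]. So [Q ^ h] of them remain. *)
Lemma flag_count h (G : {set I}) (f : R) j k : 0 <= f -> G \subset A ->
  (forall g, g \in A -> #|cls A (cell Q x m y h h) g|%:R <= f) ->
  #|[set g in G | (cell Q x m y h 0 g == cell Q x m y h 0 j)
              && (cell Q x m y 0 h g == cell Q x m y 0 h k)]|%:R <= Q%:R ^+ h * f.
Proof using Q0 x01 m01 y01.
move=> f0 GA Af.
have q0 : 0 < Q%:R ^+ h :> R by rewrite exprn_gt0 // ltr0n.
set a := (cell Q x m y h 0 j).1.1; set l := cell Q x m y 0 h k.
pose L := labels a 1 l.1.2 1 (l.2 * Q%:Z ^+ h + l.1.2 * a) (Q ^ h).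
have -> : Q%:R ^+ h = (size L)%:R :> R by rewrite size_labels !mul1n natrX.
apply: card_le_labels Af => //.
  by apply/fintype.subsetP => g; rewrite inE => /andP[/(fintype.subsetP GA)].
move=> g; rewrite inE => /and3P[/(fintype.subsetP GA) gA /eqP ga /eqP gl].
have ea : Num.floor (x g * Q%:R ^+ h) = a by rewrite /a -ga.
have eb : Num.floor (m g * Q%:R ^+ h) = l.1.2 by rewrite -gl.
have ec : Num.floor ((y g - l.1.2%:~R / Q%:R ^+ h * x g) * Q%:R ^+ h) = l.2.
  by rewrite -gl cell_line ?x01.
apply: mem_labels; rewrite /= ?ea ?eb ?lexx ?ltrDl //.
have -> : (y g - l.1.2%:~R / Q%:R ^+ h * (x g - a%:~R / Q%:R ^+ h)) * Q%:R ^+ (h + h)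
  = ((y g - l.1.2%:~R / Q%:R ^+ h * x g) * Q%:R ^+ h) * Q%:R ^+ h + l.1.2%:~R * a%:~R.
  by rewrite exprD; field; rewrite gt_eqF.
set u := (_ * Q%:R ^+ h) in ec *.
have u1 := floor_le u; have u2 := floorD1_gt u; rewrite ec intrD in u1 u2.
apply: floor_range; rewrite intrD !intrM rmorphXn /=; first by rewrite lerD2r ler_pM2r.
by rewrite addrAC ltrD2r natrX -[X in _ + X]mul1r -mulrDl ltr_pM2r.
Qed.

(** Double counting of triples [(g, j, k)] where [j] shares the point cell of [g] and [k] its line
    cell. Each [g] in [G] has at least [p * l] such pairs, each pair is incident by [flag_slant],
    and each comes from at most [Q ^ h * f] flags. *)
Lemma init_incidence h (G : {set I}) (p l f : R) : 0 <= p -> 0 <= l -> 0 <= f ->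
  G \subset A ->
  (forall g, g \in G -> p <= #|cls A (cell Q x m y h 0) g|%:R) ->
  (forall g, g \in G -> l <= #|cls A (cell Q x m y 0 h) g|%:R) ->
  (forall g, g \in A -> #|cls A (cell Q x m y h h) g|%:R <= f) ->
  #|G|%:R * (p * l) <= Q%:R ^+ h * f * incid A x m y (4 / Q%:R ^+ h).
Proof using Q0 x01 m01 y01.
move=> p0 l0 f0 GA Gp Gl Af.
pose Pt g j : R := (cell Q x m y h 0 g == cell Q x m y h 0 j)%:R.
pose Ln g k : R := (cell Q x m y 0 h g == cell Q x m y 0 h k)%:R.
have cardE (F : I -> int * int * int) g :
    #|cls A F g|%:R = \sum_(j in A) (F g == F j)%:R :> R.
  rewrite -sumr_const big_mkcond /= [RHS]big_mkcond /=; apply: eq_bigr => j _.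
  by rewrite mem_cls eq_sym; case: (j \in A) => //=; case: eqP.
apply: (@le_trans _ _ (\sum_(g in G) (\sum_(j in A) Pt g j) * (\sum_(k in A) Ln g k))).
  rewrite mulr_natl -sumr_const; apply: ler_sum => g gG; apply: ler_pM => //.
    by rewrite -cardE Gp.
  by rewrite -cardE Gl.
have -> : \sum_(g in G) (\sum_(j in A) Pt g j) * (\sum_(k in A) Ln g k)
   = \sum_(k in A) \sum_(j in A) \sum_(g in G) Pt g j * Ln g k.
  rewrite [RHS]exchange_big /= ; under [RHS]eq_bigr do rewrite exchange_big /=.
  rewrite [RHS]exchange_big /=; apply: eq_bigr => g _; rewrite mulr_suml.
  by apply: eq_bigr => j _; rewrite mulr_sumr.
rewrite /incid mulr_sumr; apply: ler_sum => k kA; rewrite mulr_sumr; apply: ler_sum => j jA.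
set S := [set g in G | (cell Q x m y h 0 g == cell Q x m y h 0 j)
              && (cell Q x m y 0 h g == cell Q x m y 0 h k)].
have -> : \sum_(g in G) Pt g j * Ln g k = #|S|%:R.
  rewrite -sumr_const big_mkcond /= [RHS]big_mkcond /=; apply: eq_bigr => g _.
  by rewrite inE /Pt /Ln -natrM mulnb; case: (g \in G) => //=; case: (_ && _).
have [->|/card_gt0P[g]] := posnP #|S|.
  by rewrite !mulr_ge0 // exprn_ge0.
rewrite inE => /and3P[/(fintype.subsetP GA) gA /eqP gj /eqP gk].
by rewrite (@flag_slant h g j k) // mulr1; apply: flag_count.
Qed.
End Unit.

(** * One high-low step in terms of cell counts *)

Lemma harmonic_dyadic (R : realType) (k : nat) :
  \sum_(d < 2 ^ k) (d.+1%:R)^-1 <= k.+1%:R :> R.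
Proof.
elim: k => [|k IH]; first by rewrite expn0 big_ord1 invr1.
rewrite expnS mul2n -addnn big_split_ord /= -natr1; apply: lerD => //.
have p0 : 0 < (2 ^ k)%N%:R :> R by rewrite ltr0n expn_gt0.
apply: (@le_trans _ _ (\sum_(d < 2 ^ k) ((2 ^ k)%N%:R)^-1)).
  apply: ler_sum => d _; rewrite lef_pV2 ?posrE //.
  by rewrite ler_nat -addnS leq_addr.
by rewrite sumr_const card_ord -[X in X <= _]mulr_natl mulfV // gt_eqF.
Qed.

Lemma sum_indicator (R : realType) (I : finType) (A : {set I}) (P : pred I) :
  \sum_(q in A) (P q)%:R = #|[set q in A | P q]|%:R :> R.
Proof.
rewrite -sumr_const big_mkcond /= [RHS]big_mkcond /=; apply: eq_bigr => q _.
by rewrite inE; case: (q \in A) => //=; case: (P q).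
Qed.

Lemma sqrt_le_mul (R : realType) (a b w : R) : 0 <= a -> 0 <= b -> w <= a ^+ 2 ->
  Num.sqrt (w * b) <= a * Num.sqrt b.
Proof.
move=> a0 b0 wa; rewrite -[a in X in _ <= X](ger0_norm a0) -sqrtr_sqr.
by rewrite -sqrtrM ?exprn_even_ge0 // ler_wsqrtr // ler_wpM2r.
Qed.

Lemma constant_bound (R : realType) : 16 * 3298 * 6 <= 600 * 600 :> R.
Proof. lra. Qed.

Section Unit.
Variables (R : realType) (I : finType) (Q : nat) (x m y : I -> R) (A : {set I}).
Hypothesis Q0 : (0 < Q)%N.
Hypothesis x01 : forall g, g \in A -> 0 <= x g < 1.
Hypothesis m01 : forall g, g \in A -> 0 <= m g < 1.
Hypothesis y01 : forall g, g \in A -> 0 <= y g < 1.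

(** A length [T] is 16 cell sides. The two sides of [x g] need [2 * 17] columns of [64 * d + 97]
    cells each, at most [34 * 97 * (d + 1)] in all. *)
Lemma spread_cells h (T p : R) : 0 <= p -> T * Q%:R ^+ h = 16 ->
  (forall g, g \in A -> #|cls A (cell Q x m y h 0) g|%:R <= p) ->
  spread A x y T (3298 * p).
Proof using Q0 x01 m01 y01.
move=> p0; have [q qE] : {q : R | q = Q%:R ^+ h} by exists (Q%:R ^+ h).
rewrite -qE => Tq Ap g gA d.
have q0 : 0 < q by rewrite qE exprn_gt0 // ltr0n.
rewrite sum_indicator; set S := [set _ in A | _].
set X := Num.floor (x g * q); set Y := Num.floor (y g * q).
pose L1 := labels (X + (16 * d)%N%:Z) 17 0 1 (Y - (32 * d + 48)%N%:Z) (64 * d + 97).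
pose L2 := labels (X - (16 * d + 16)%N%:Z) 17 0 1 (Y - (32 * d + 48)%N%:Z) (64 * d + 97).
have e32 : (32 * d + 48)%N%:R = 32 * d%:R + 48 :> R by rewrite natrD natrM.
have e64 : (64 * d + 97)%N%:R = 64 * d%:R + 97 :> R by rewrite natrD natrM.
have e16 : (16 * d)%N%:R = 16 * d%:R :> R by rewrite natrM.
have e16' : (16 * d + 16)%N%:R = 16 * d%:R + 16 :> R by rewrite natrD natrM.
have SL k : k \in S -> cell Q x m y h 0 k \in L1 ++ L2.
  rewrite inE => /andP[kA]; rewrite -andbA => /and3P[d1 d2 d3].
  rewrite cell_point ?m01 // mem_cat -qE.
  have X1 := floor_le (x g * q); have X2 := floorD1_gt (x g * q).
  have Y1 := floor_le (y g * q); have Y2 := floorD1_gt (y g * q).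
  rewrite -/X -/Y !intrD in X1 X2 Y1 Y2.
  have d3' : `|y g - y k| * q <= 16 * (2 * d%:R + 3).
    by rewrite [16 * _]mulrC -Tq mulrA ler_pM2r.
  have d1' : 16 * d%:R <= `|x g - x k| * q.
    by rewrite [16 * _]mulrC -Tq mulrA ler_pM2r.
  have d2' : `|x g - x k| * q <= 16 * d.+1%:R.
    by rewrite [16 * _]mulrC -Tq mulrA ler_pM2r.
  rewrite -[d.+1%:R]natr1 in d2'.
  have Yr : Y - (32 * d + 48)%N%:Z <= Num.floor (y k * q)
      < Y - (32 * d + 48)%N%:Z + (64 * d + 97)%N%:Z.
    move: d3'; rewrite -[X in _ * X](gtr0_norm q0) -normrM mulrBl ler_norml => /andP[e1 e2].
    apply: floor_range; rewrite intrB -!pmulrn ?e32 ?e64; clear - e1 e2 Y1 Y2; lra.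
  have [xs|xs] := leP (x g) (x k).
    apply/orP; left; apply: mem_labels => //=.
    rewrite ler0_norm ?subr_le0 // opprB mulrBl in d1' d2'.
    by apply: floor_range; rewrite intrD -!pmulrn e16; clear - d1' d2' X1 X2; lra.
  apply/orP; right; apply: mem_labels => //=.
  rewrite ger0_norm ?subr_ge0 ?mulrBl in d1' d2'; [|exact: ltW..].
  by apply: floor_range; rewrite intrB -!pmulrn e16'; clear - d1' d2' X1 X2; lra.
have SA : S \subset A by apply/fintype.subsetP => k; rewrite inE => /andP[].
apply: (le_trans (card_le_labels p0 SA SL Ap)).
rewrite mulrA ler_wpM2r // size_cat !size_labels -natrM ler_nat.
by clear; lia.
Qed.

Lemma packed_cells h (t l : R) : 0 <= l -> t * Q%:R ^+ h <= 1 ->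
  (forall g, g \in A -> #|cls A (cell Q x m y 0 h) g|%:R <= l) ->
  packed A m (fun k => y k - m k * x k) t (6 * l).
Proof using Q0 x01 m01 y01.
move=> l0 tq Al a b; set q := Q%:R ^+ h in tq.
have q0 : 0 < q by rewrite exprn_gt0 // ltr0n.
rewrite sum_indicator; set S := [set _ in A | _].
pose L := labels 0 1 (Num.floor (a * q)) 2 (Num.floor (b * q)) 3.
have -> : 6 = (size L)%:R :> R by rewrite size_labels.
have SA : S \subset A by apply/fintype.subsetP => k; rewrite inE => /andP[].
apply: (card_le_labels l0 SA _ Al) => k.
rewrite inE => /andP[kA /andP[/andP[m1 m2] /andP[c1 c2]]].
rewrite cell_line ?x01 // -/q; set be := Num.floor (m k * q).
have A1 := floor_le (a * q); have A2 := floorD1_gt (a * q).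
have B1 := floor_le (b * q); have B2 := floorD1_gt (b * q).
have M1 := floor_le (m k * q); have M2 := floorD1_gt (m k * q).
rewrite -/be !intrD in A1 A2 B1 B2 M1 M2.
have m1' : a * q <= m k * q by rewrite ler_pM2r.
have m2' : m k * q < a * q + 1.
  by apply: (@lt_le_trans _ _ (a * q + t * q)); rewrite ?lerD2l // -mulrDl ltr_pM2r.
have c1' : b * q <= (y k - m k * x k) * q by rewrite ler_pM2r.
have c2' : (y k - m k * x k) * q < b * q + 1.
  by apply: (@lt_le_trans _ _ (b * q + t * q)); rewrite ?lerD2l // -mulrDl ltr_pM2r.
have e : (y k - be%:~R / q * x k) * q = (y k - m k * x k) * q + (m k * q - be%:~R) * x k.
  by field; rewrite gt_eqF.
have /andP[x0 x1] := x01 kA.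
have f0 : 0 <= (m k * q - be%:~R) * x k by rewrite mulr_ge0 // subr_ge0.
have f1 : (m k * q - be%:~R) * x k <= 1.
  by rewrite mulr_ile1 // ?subr_ge0 // ?lerBlDl; apply: ltW.
apply: mem_labels => //=; apply: floor_range; rewrite ?e.
- by clear - A1 m1'; lra.
- by clear - A2 m2'; lra.
- by move: f0; clear - B1 c1'; lra.
- by move: f1; clear - B2 c2'; lra.
Qed.

(** [high_low] with [t = 1 / Q ^ (h + 1)] and [K = 16 * Q], so that [4 * t] and [K * t / 4] are the
    two consecutive scales. For [D = Q ^ h = 2 ^ (e * h)] the harmonic sum is at most [e * h + 1],
    hence at most [K]. *)
Lemma scale_step h (e : nat) (p l : R) :
  Q = (2 ^ e)%N -> (e * h < 16 * Q)%N -> (16 <= Q ^ h)%N -> 1 <= p -> 0 <= l ->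
  (forall g, g \in A -> #|cls A (cell Q x m y h 0) g|%:R <= p) ->
  (forall g, g \in A -> #|cls A (cell Q x m y 0 h) g|%:R <= l) ->
  incid A x m y (4 / Q%:R ^+ h) / (16 * Q%:R)
    - 64 * 600 * #|A|%:R * Q%:R * Num.sqrt (Q%:R ^+ h * p * l)
  <= incid A x m y (4 / Q%:R ^+ h.+1).
Proof using Q0 x01 m01 y01.
move=> Qe eh Qh p1 l0 Ap Al; set q := Q%:R ^+ h.
have q0 : 0 < q by rewrite exprn_gt0 // ltr0n.
have QR : 0 < Q%:R :> R by rewrite ltr0n.
have q16 : 16 <= q by rewrite /q -natrX ler_nat.
have p0 : 0 <= p by apply: le_trans p1.
have w01 (w : I -> R) : (forall g, g \in A -> 0 <= w g < 1) ->
    forall g, g \in A -> 0 <= w g <= 1.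
  by move=> H g /H /andP[-> /ltW].
have Kt : (16 * Q)%N%:R * (1 / (q * Q%:R)) = 16 / q :> R.
  by rewrite natrM; field; rewrite !gt_eqF.
have := @high_low R I A x m y (1 / (q * Q%:R)) (3298 * p) (6 * l) (16 * Q) (Q ^ h)
  (w01 _ x01) (w01 _ m01) (w01 _ y01).
rewrite Kt => HL.
have tq : 1 / (q * Q%:R) * q <= 1.
  rewrite div1r invfM mulrC mulrA mulfV ?gt_eqF // mul1r invf_le1 //.
  by rewrite ler1n.
have {HL} := HL.
have -> : 16 / q / 4 = 4 / q by field; rewrite gt_eqF.
have -> : 4 * (1 / (q * Q%:R)) = 4 / Q%:R ^+ h.+1 by rewrite exprSr mulrA mulr1.
move=> HL; apply: le_trans (HL _ _ _ _ _ _ _ _).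
- rewrite natrM lerD2l lerN2.
  have -> : 16 * Q%:R * (3298 * p) * (6 * l) / (1 / (q * Q%:R))
     = (16 * 3298 * 6) * (Q%:R ^+ 2 * (q * p * l)) by field; rewrite !gt_eqF.
  have qpl : 0 <= q * p * l by rewrite !mulr_ge0 // ltW.
  have s1 : Num.sqrt ((16 * 3298 * 6) * (Q%:R ^+ 2 * (q * p * l)))
      <= 600 * Q%:R * Num.sqrt (q * p * l).
    have Q1 : 0 <= 600 * Q%:R :> R by apply: mulr_ge0; [exact: ler0n|exact: ltW].
    rewrite mulrA; apply: (sqrt_le_mul Q1 qpl).
    rewrite exprMn; apply: ler_wpM2r; first exact: exprn_even_ge0.
    by rewrite expr2; exact: constant_bound.
  have -> : 64 * 600 * #|A|%:R * Q%:R * Num.sqrt (q * p * l)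
     = 64 * #|A|%:R * (600 * Q%:R * Num.sqrt (q * p * l)) by ring.
  by apply: ler_wpM2l s1; apply: mulr_ge0; exact: ler0n.
- by rewrite divr_gt0 // mulr_gt0.
- by rewrite leq_pmulr.
- by rewrite ler_pdivrMr // mul1r.
- by rewrite natrX mulrC mulfVK ?gt_eqF // ler1n.
- by rewrite Qe -expnM; apply: (le_trans (harmonic_dyadic R _)); rewrite ler_nat -Qe.
- by apply: (le_trans p1); rewrite ler_peMl // ler1n.
- apply: spread_cells Ap => //.
  by rewrite mulfVK // gt_eqF.
- by apply: packed_cells Al.
Qed.
End Unit.

(** * Iteration over the scales inside a cell *)

Definition ncell (R : realType) (I : finType) (Q : nat) (x m y : I -> R) (Y : {set I})
  (i j : nat) : R := ncl R Y (cell Q x m y i j).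

Definition uniform (R : realType) (I : finType) (Q M : nat) (x m y : I -> R)
    (Y : {set I}) : Prop :=
  forall i j, (i + j <= M)%N -> forall g, g \in Y ->
    #|cls Y (cell Q x m y i j) g|%:R * ncell Q x m y Y i j <= 2 * Q%:R * #|Y|%:R.

Lemma eqW (R : realType) (a b : R) : a = b -> a <= b.
Proof. by move=> ->. Qed.

Lemma leaky_recursion (R : realType) (B : nat -> R) (u v : R) (h H : nat) :
  0 <= u -> 0 <= v -> u <= B h ->
  (forall s, (h <= s)%N -> (s < H)%N -> B s / 16 - v <= B s.+1) -> (h <= H)%N ->
  u / 16 ^+ (H - h) - 2 * v <= B H.
Proof.
move=> u0 v0 uB step hH.
suff {hH} K k : (h + k <= H)%N -> u / 16 ^+ k - 2 * v <= B (h + k)%N.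
  by have := K (H - h)%N; rewrite subnKC // leqnn => /(_ isT).
elim: k => [|k IH] hk; first by rewrite expr0 divr1 addn0; lra.
rewrite addnS in hk *; have := step _ (leq_addr k h) hk.
have := IH (ltnW hk); have -> : u / 16 ^+ k.+1 = (u / 16 ^+ k) / 16.
  by rewrite exprS invfM mulrCA mulrC.
by move: (u / 16 ^+ k) => w; lra.
Qed.

Lemma incid_local (R : realType) (I : finType) (Q : nat) (x m y : I -> R) (S : {set I})
    i j l H : (0 < Q)%N ->
  incid S (locx Q x i l) (locm Q m j l) (locy Q x y i j l) (4 / Q%:R ^+ H)
    = incid S x m y (4 / Q%:R ^+ (i + j + H)).
Proof.
move=> Q0; have q0 n : 0 < Q%:R ^+ n :> R by rewrite exprn_gt0 // ltr0n.
apply: eq_bigr => k _; apply: eq_bigr => g _; congr (nat_of_bool _)%:R.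
rewrite slant_local // normrM (gtr0_norm (q0 _)) -ltr_pdivlMr //.
by rewrite -mulrA -invfM [Q%:R ^+ H * _]mulrC -exprD.
Qed.

Lemma cls_subset (I : finType) (T : eqType) (S Y : {set I}) (f : I -> T) g :
  S \subset Y -> (#|cls S f g| <= #|cls Y f g|)%N.
Proof.
move=> /fintype.subsetP SY; apply/subset_leq_card/fintype.subsetP => k.
by rewrite !mem_cls => /andP[/SY -> ->].
Qed.

(** The direct count starts the normalized incidences at [Q ^ -3]. Each high-low step divides them
    by 16 and subtracts [Q ^ -6], as long as the counts at that scale are large. Since
    [2 * 16 ^ M <= Q], all steps together lose less than one further power of [Q]. *)
Lemma local_incidence (R : realType) (I : finType) (Q e M i j h H : nat) (x m y : I -> R)
    (Y S G : {set I}) l (be : R) :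
  Q = (2 ^ e)%N -> (e * M < 16 * Q)%N -> 2 * 16 ^+ M <= Q%:R :> R ->
  64 * 600 * 16 <= Q%:R :> R -> (0 < h)%N -> (h + h <= H)%N -> (i + j + H = M)%N ->
  (0 < #|S|)%N -> S \subset Y -> (forall g, g \in S -> cell Q x m y i j g = l) ->
  G \subset S -> uniform Q M x m y Y -> 0 < be ->
  ncell Q x m y Y (i + h) j * ncell Q x m y Y i (j + h)
    = be * (ncell Q x m y Y i j * ncell Q x m y Y (i + h) (j + h)) ->
  (forall s, (h <= s)%N -> (s <= H)%N ->
     (ncell Q x m y Y i j * Q%:R ^+ s * be * Q%:R ^+ 10) ^+ 2 * Q%:R ^+ s
       <= ncell Q x m y Y (i + s) j * ncell Q x m y Y i (j + s)) ->
  #|Y|%:R <= 8 * ncell Q x m y Y i j * #|S|%:R ->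
  #|S|%:R * ncell Q x m y Y i j <= 2 * Q%:R * #|Y|%:R -> #|S|%:R <= 4 * #|G|%:R :> R ->
  (forall g, g \in G -> #|Y|%:R <=
     40 * ncell Q x m y Y (i + h) j * #|cls S (cell Q x m y (i + h) j) g|%:R) ->
  (forall g, g \in G -> #|Y|%:R <=
     40 * ncell Q x m y Y i (j + h) * #|cls S (cell Q x m y i (j + h)) g|%:R) ->
  #|S|%:R ^+ 2 <= Q%:R ^+ H * be * Q%:R ^+ 4 * incid S x m y (4 / Q%:R ^+ M).
Proof.
move=> Qe eM QM Q614 h0 hH ijH S0 SY Sl GS unif be0 beE far n8 rN r4 GP GL.
have Q0 : (0 < Q)%N by rewrite Qe expn_gt0.
have QR : 0 < Q%:R :> R by rewrite ltr0n.
have Q1 : 1 <= Q%:R :> R by rewrite ler1n.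
have Y0 : (0 < #|Y|)%N by apply: leq_trans S0 _; apply: subset_leq_card.
have n0 : 0 < #|Y|%:R :> R by rewrite ltr0n.
have r0 : 0 < #|S|%:R :> R by rewrite ltr0n.
have N1 a b : 1 <= ncell Q x m y Y a b by apply: ncl_ge1.
have N0 a b : 0 < ncell Q x m y Y a b by apply: lt_le_trans (N1 a b).
have q0 s : 0 < Q%:R ^+ s :> R by rewrite exprn_gt0.
pose X := locx Q x i l; pose Mm := locm Q m j l; pose Z := locy Q x y i j l.
have X01 g : g \in S -> 0 <= X g < 1 by move=> /Sl gl; have [] := loc_range gl.
have M01 g : g \in S -> 0 <= Mm g < 1 by move=> /Sl gl; have [] := loc_range gl.
have Z01 g : g \in S -> 0 <= Z g < 1 by move=> /Sl gl; have [] := loc_range gl.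
have cellS a b g : g \in S -> (i + a + (j + b) <= M)%N ->
    #|cls S (cell Q X Mm Z a b) g|%:R <= 2 * Q%:R * #|Y|%:R / ncell Q x m y Y (i + a) (j + b).
  move=> gS abM; rewrite cls_local // ler_pdivlMr //.
  apply: le_trans (unif _ _ abM g (fintype.subsetP SY _ gS)).
  by rewrite ler_pM2r // ler_nat cls_subset.
pose Inc s := incid S X Mm Z (4 / Q%:R ^+ s).
have -> : incid S x m y (4 / Q%:R ^+ M) = Inc H by rewrite /Inc incid_local // ijH.
set A0 := ncell Q x m y Y i j in beE far n8 rN.
have hinit : #|S|%:R ^+ 2 <= Q%:R ^+ h * be * Q%:R ^+ 3 * Inc h.
  set A1 := ncell Q x m y Y (i + h) j in beE GP; set A2 := ncell Q x m y Y i (j + h) in beE GL.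
  have A10 : 0 < A1 by apply: N0.
  have A20 : 0 < A2 by apply: N0.
  pose A3 := ncell Q x m y Y (i + h) (j + h); have A30 : 0 < A3 by apply: N0.
  have p0 : 0 <= #|Y|%:R / (40 * A1) by rewrite divr_ge0 ?mulr_ge0 // ltW.
  have l0 : 0 <= #|Y|%:R / (40 * A2) by rewrite divr_ge0 ?mulr_ge0 // ltW.
  have f0 : 0 <= 2 * Q%:R * #|Y|%:R / A3 by rewrite divr_ge0 ?mulr_ge0 // ltW.
  have := @init_incidence R I Q X Mm Z S Q0 X01 M01 Z01 h G _ _ _ p0 l0 f0 GS.
  rewrite -/(Inc h) => INI.
  have {INI} INI : #|G|%:R * (#|Y|%:R / (40 * A1) * (#|Y|%:R / (40 * A2)))
      <= Q%:R ^+ h * (2 * Q%:R * #|Y|%:R / A3) * Inc h.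
    apply: INI => [g gG|g gG|g gS].
    - by rewrite cls_local // addn0 ler_pdivrMr ?mulr_gt0 // mulrC GP.
    - by rewrite cls_local // addn0 ler_pdivrMr ?mulr_gt0 // mulrC GL.
    - by apply: cellS => //; rewrite addnACA -ijH leq_add2l.
  have I0 : 0 <= Inc h by apply: sumr_ge0 => k _; apply: sumr_ge0.
  have h1 : #|G|%:R * #|Y|%:R * A3 <= (40 * A1) * (40 * A2) * (2 * Q%:R) * (Q%:R ^+ h * Inc h).
    have z0 : 0 < #|Y|%:R / ((40 * A1) * (40 * A2) * A3).
      apply: divr_gt0 => //; apply: mulr_gt0 => //; apply: mulr_gt0; exact: mulr_gt0.
    rewrite -(ler_pM2r z0); move: INI; congr (_ <= _); field; rewrite ?gt_eqF //.
  have A00 : 0 < A0 by apply: N0.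
  rewrite -/A3 in beE.
  have {}h1 : #|G|%:R * #|Y|%:R * A3 <= 40 * 40 * 2 * Q%:R * (be * (A0 * A3)) * (Q%:R ^+ h * Inc h).
    by apply: (le_trans h1); rewrite -beE; apply/eqW; ring.
  have h2 : #|G|%:R * #|Y|%:R <= 40 * 40 * 2 * be * A0 * Q%:R * (Q%:R ^+ h * Inc h).
    by rewrite -(ler_pM2r A30); apply: (le_trans h1); apply/eqW; ring.
  have h3 : #|S|%:R ^+ 2 <= 16 * 40 * 40 * Q%:R ^+ 2 * (be * (Q%:R ^+ h * Inc h)).
    rewrite -(ler_pM2r A00).
    apply: (@le_trans _ _ ((4 * #|G|%:R) * (2 * Q%:R * #|Y|%:R))).
      have rA : 0 <= #|S|%:R * A0 by apply: mulr_ge0; exact: ltW.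
      by have := ler_pM (ltW r0) rA r4 rN; rewrite [#|S|%:R * (_ * A0)]mulrA -expr2.
    have -> : 4 * #|G|%:R * (2 * Q%:R * #|Y|%:R) = 8 * Q%:R * (#|G|%:R * #|Y|%:R) :> R by ring.
    have -> : 16 * 40 * 40 * Q%:R ^+ 2 * (be * (Q%:R ^+ h * Inc h)) * A0
      = 8 * Q%:R * (40 * 40 * 2 * be * A0 * Q%:R * (Q%:R ^+ h * Inc h)) by ring.
    by rewrite ler_pM2l // mulr_gt0.
  apply: (le_trans h3).
  have -> : Q%:R ^+ h * be * Q%:R ^+ 3 * Inc h
     = Q%:R * Q%:R ^+ 2 * (be * (Q%:R ^+ h * Inc h)) by ring.
  rewrite ler_wpM2r //; first by rewrite !mulr_ge0 // ltW.
  by rewrite ler_pM2r //; move: Q614; lra.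
(* The factor [Q ^ s] removes the expected decay, so the loss [16 * Q] of a high-low step becomes a
   factor 16. *)
pose B s := Inc s * (Q%:R ^+ s * be / #|S|%:R ^+ 2).
have S20 : 0 < #|S|%:R ^+ 2 :> R by rewrite exprn_gt0.
have A00 : 0 < A0 by apply: N0.
have Bh : (Q%:R ^+ 3)^-1 <= B h.
  rewrite /B mulrA ler_pdivlMr // -ler_pdivlMl ?invr_gt0 // invrK.
  by apply: (le_trans hinit); apply/eqW; ring.
have step s : (h <= s)%N -> (s < H)%N -> B s / 16 - (Q%:R ^+ 6)^-1 <= B s.+1.
  move=> hs sH; set A1 := ncell Q x m y Y (i + s) j; set A2 := ncell Q x m y Y i (j + s).
  have A10 : 0 < A1 by apply: N0.
  have A20 : 0 < A2 by apply: N0.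
  have [g0 g0S] : exists g0, g0 \in S by apply/card_gt0P.
  have sM : (i + j + s <= M)%N by rewrite -ijH leq_add2l ltnW.
  have ps g : g \in S -> #|cls S (cell Q X Mm Z s 0) g|%:R <= 2 * Q%:R * #|Y|%:R / A1.
    move=> gS; have := cellS s 0%N g gS; rewrite !addn0 addnAC; exact.
  have ls g : g \in S -> #|cls S (cell Q X Mm Z 0 s) g|%:R <= 2 * Q%:R * #|Y|%:R / A2.
    move=> gS; have := cellS 0%N s g gS; rewrite !addn0 addnA; exact.
  have p1 : 1 <= 2 * Q%:R * #|Y|%:R / A1.
    by apply: le_trans (ps _ g0S); rewrite ler1n -(ltr0n R) cls_card_gt0.
  have l0 : 0 <= 2 * Q%:R * #|Y|%:R / A2 by apply: le_trans (ls _ g0S).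
  have Q16 : (16 <= Q)%N.
    by rewrite -(ler_nat R); move: Q614; lra.
  have es : (e * s < 16 * Q)%N.
    apply: leq_ltn_trans eM; rewrite leq_mul2l (leq_trans _ sM) ?orbT //.
    by rewrite leq_addl.
  have Qs : (16 <= Q ^ s)%N.
    apply: (leq_trans Q16); rewrite -[X in (X <= _)%N]expn1 leq_exp2l.
      exact: leq_trans h0 hs.
    by apply: leq_trans Q16.
  have := @scale_step R I Q X Mm Z S Q0 X01 M01 Z01 s e _ _ Qe es Qs p1 l0 ps ls.
  rewrite -/(Inc s) -/(Inc s.+1) => ST.
  have Es0 : 0 < A0 * Q%:R ^+ s * be * Q%:R ^+ 10 by rewrite !mulr_gt0.
  have sq : Num.sqrt (Q%:R ^+ s * (2 * Q%:R * #|Y|%:R / A1) * (2 * Q%:R * #|Y|%:R / A2))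
     <= 16 * Q%:R * #|S|%:R / (Q%:R ^+ s * be * Q%:R ^+ 10).
    apply: (@le_trans _ _ (2 * Q%:R * #|Y|%:R / (A0 * Q%:R ^+ s * be * Q%:R ^+ 10))).
      have w0 : 0 <= 2 * Q%:R * #|Y|%:R / (A0 * Q%:R ^+ s * be * Q%:R ^+ 10).
        by rewrite divr_ge0 ?mulr_ge0 // ltW.
      rewrite -[X in _ <= X](ger0_norm w0) -sqrtr_sqr ler_wsqrtr //.
      have A120 : 0 < A1 * A2 by rewrite mulr_gt0.
      have -> : Q%:R ^+ s * (2 * Q%:R * #|Y|%:R / A1) * (2 * Q%:R * #|Y|%:R / A2)
         = (2 * Q%:R * #|Y|%:R) ^+ 2 * (Q%:R ^+ s / (A1 * A2)).
        by field; rewrite !gt_eqF.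
      rewrite [X in _ <= X]exprMn ler_wpM2l ?exprn_even_ge0 // ler_pdivrMr // exprVn.
      rewrite -ler_pdivrMl ?invr_gt0 ?exprn_gt0 // invrK.
      by apply: far => //; exact: ltnW.
    have q1 : 0 < Q%:R ^+ s * be * Q%:R ^+ 10 by rewrite !mulr_gt0.
    have -> : 2 * Q%:R * #|Y|%:R / (A0 * Q%:R ^+ s * be * Q%:R ^+ 10)
       = (2 * Q%:R / (Q%:R ^+ s * be * Q%:R ^+ 10)) * (#|Y|%:R / A0).
      by rewrite -!mulrA !invfM; ring.
    have -> : 16 * Q%:R * #|S|%:R / (Q%:R ^+ s * be * Q%:R ^+ 10)
       = (2 * Q%:R / (Q%:R ^+ s * be * Q%:R ^+ 10)) * (8 * #|S|%:R) by ring.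
    rewrite ler_wpM2l //; first by rewrite divr_ge0 ?mulr_ge0 // ltW.
    by rewrite ler_pdivrMr // mulrAC.
  (* Of the ten spare powers of [Q], three are spent here and one on normalizing at the next scale;
     this leaves [Q ^ -6]. *)
  have err : 64 * 600 * #|S|%:R * Q%:R * Num.sqrt (Q%:R ^+ s * (2 * Q%:R * #|Y|%:R / A1)
       * (2 * Q%:R * #|Y|%:R / A2)) <= Q%:R ^+ 3 * #|S|%:R ^+ 2 / (Q%:R ^+ s * be * Q%:R ^+ 10).
    have c0 : 0 <= 64 * 600 * #|S|%:R * Q%:R :> R.
      apply: mulr_ge0; last exact: ltW.
      by apply: mulr_ge0; [apply: mulr_ge0; exact: ler0n|exact: ler0n].
    apply: (le_trans (ler_wpM2l c0 sq)).
    have -> : 64 * 600 * #|S|%:R * Q%:R * (16 * Q%:R * #|S|%:R / (Q%:R ^+ s * be * Q%:R ^+ 10))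
      = (64 * 600 * 16) * (Q%:R ^+ 2 * #|S|%:R ^+ 2 / (Q%:R ^+ s * be * Q%:R ^+ 10)) by ring.
    have -> : Q%:R ^+ 3 * #|S|%:R ^+ 2 / (Q%:R ^+ s * be * Q%:R ^+ 10)
      = Q%:R * (Q%:R ^+ 2 * #|S|%:R ^+ 2 / (Q%:R ^+ s * be * Q%:R ^+ 10)) by ring.
    apply: ler_wpM2r Q614; apply: divr_ge0; first by apply: mulr_ge0; exact: ltW.
    by rewrite ltW // !mulr_gt0.
  have ST' : Inc s / (16 * Q%:R) - Q%:R ^+ 3 * #|S|%:R ^+ 2 / (Q%:R ^+ s * be * Q%:R ^+ 10)
     <= Inc s.+1 by apply: le_trans ST; rewrite lerD2l lerN2.
  have c0 : 0 < Q%:R ^+ s.+1 * be / #|S|%:R ^+ 2 by rewrite divr_gt0 // mulr_gt0.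
  rewrite -(ler_pM2r c0) -/(B s.+1) in ST'; apply: le_trans ST'; apply/eqW.
  rewrite /B [Q%:R ^+ s.+1]exprS; have sp := q0 s; move: (Q%:R ^+ s) sp => qs qs0.
  by field; rewrite !gt_eqF.
have BH := leaky_recursion (ltW (_ : 0 < (Q%:R ^+ 3)^-1)) (ltW (_ : 0 < (Q%:R ^+ 6)^-1)) Bh step
   (leq_trans (leq_addr h h) hH).
have {BH} BH : (Q%:R ^+ 3)^-1 / 16 ^+ (H - h) - 2 * (Q%:R ^+ 6)^-1 <= B H.
  by apply: BH; rewrite invr_gt0.
have B4 : (Q%:R ^+ 4)^-1 <= B H.
  apply: le_trans BH.
  have e1 : 2 / Q%:R ^+ 4 <= (Q%:R ^+ 3)^-1 / 16 ^+ (H - h) :> R.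
    have p16 : 0 < 16 ^+ (H - h) :> R by rewrite exprn_gt0.
    rewrite ler_pdivlMr // mulrAC ler_pdivrMr // [Q%:R ^+ 4]exprSr mulrA mulVf ?gt_eqF //.
    rewrite mul1r; apply: le_trans QM; rewrite ler_pM2l // ler_weXn2l //; first by rewrite ler1n.
    by rewrite -ijH; apply: leq_trans (leq_subr _ _) (leq_addl _ _).
  have e2 : 2 * (Q%:R ^+ 6)^-1 <= (Q%:R ^+ 4)^-1 :> R.
    rewrite ler_pdivrMr // [Q%:R ^+ 6](exprD _ 4 2) mulrA mulVf ?gt_eqF // mul1r.
    by move: Q614; rewrite expr2; nra.
  by move: e1 e2; lra.
rewrite /B mulrA ler_pdivlMr // in B4.
rewrite -[X in X <= _](mulKf (x := Q%:R ^+ 4)) ?gt_eqF // mulrCA.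
apply: (le_trans (ler_wpM2l (ltW (q0 4)) B4)).
by apply/eqW; ring.
Qed.

Lemma incid_classes (R : realType) (I : finType) (T : eqType) (Y : {set I}) (x m y : I -> R)
    (f : I -> T) (w : R) :
  \sum_(k in Y) incid (cls Y f k) x m y w / #|cls Y f k|%:R <= incid Y x m y w.
Proof.
pose F k := \sum_(j in cls Y f k) (`|slant x m y j k| < w)%R%:R : R.
apply: (@le_trans _ _ (\sum_(k in Y) F k)).
  rewrite -(class_average Y f F); apply/eqW/eq_bigr => k _; congr (_ / _).
  apply: eq_bigr => g; rewrite mem_cls => /andP[_ /eqP gk].
  by rewrite /F (cls_eq Y gk).
apply: ler_sum => k _; rewrite /F big_mkcond /= [X in _ <= X]big_mkcond /=.
by apply: ler_sum => j _; rewrite mem_cls; case: (j \in Y) => //=; case: ifP.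
Qed.

(** Elements of [G] lying in classes where [G] has less than a quarter of the members make up at
    most a quarter of each such class, hence at most a quarter of [Y]. *)
Lemma rich_classes (R : realType) (I : finType) (T : eqType) (Y G : {set I}) (f : I -> T) :
  G \subset Y ->
  #|G|%:R <= #|[set k in G | #|cls Y f k|%:R <= 4 * #|G :&: cls Y f k|%:R :> R]|%:R
     + #|Y|%:R / 4 :> R.
Proof.
move=> /fintype.subsetP GY; set D := [set k in G | _].
pose B := [set k in Y | 4 * #|G :&: cls Y f k|%:R < #|cls Y f k|%:R :> R].
have GD : (#|G| <= #|D| + #|G :&: B|)%N.
  rewrite -(cardsID B G) addnC leq_add2r; apply/subset_leq_card/fintype.subsetP => k.
  rewrite !inE negb_and -leNgt => /andP[/orP[kY|h] kG]; last by rewrite kG.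
  by rewrite GY in kY.
apply: (@le_trans _ _ (#|D|%:R + #|G :&: B|%:R)); first by rewrite -natrD ler_nat.
rewrite lerD2l.
have -> : #|G :&: B|%:R = \sum_(g in Y) (g \in G :&: B)%:R :> R.
  rewrite -sumr_const big_mkcond /= [RHS]big_mkcond /=; apply: eq_bigr => g _.
  by case gY: (g \in Y); case gGB: (g \in _) => //; move: gGB; rewrite !inE gY ?andbF.
rewrite -(class_average Y f) [X in _ <= X]mulr_natl -sumr_const.
apply: ler_sum => k kY; rewrite ler_pdivrMr ?cls_card_gt0 // mulrC.
rewrite sum_indicator; set C := [set _ in _ | _].
have [kB|kB] := boolP (k \in B).
  have CG : (#|C| <= #|G :&: cls Y f k|)%N.
    by apply/subset_leq_card/fintype.subsetP => g; rewrite !inE => /andP[-> /andP[->]].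
  move: kB; rewrite inE kY /= => kB.
  have CG' : #|C|%:R <= #|G :&: cls Y f k|%:R :> R by rewrite ler_nat.
  by lra.
have -> : C = finset.set0.
  apply/setP => g; rewrite !inE; apply/negP => /andP[/andP[gY /eqP gk] /and3P[gG _]].
  rewrite (cls_eq Y gk) => h.
  by move: kB; rewrite inE kY h.
by rewrite cards0 divr_ge0.
Qed.

Lemma alternative (R : realType) (I : finType) (Q e M i j h H : nat) (x m y : I -> R)
    (Y : {set I}) (be : R) :
  Q = (2 ^ e)%N -> (e * M < 16 * Q)%N -> 2 * 16 ^+ M <= Q%:R :> R ->
  64 * 600 * 16 <= Q%:R :> R -> (0 < h)%N -> (h + h <= H)%N -> (i + j + H = M)%N ->
  (0 < #|Y|)%N -> uniform Q M x m y Y -> 0 < be ->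
  ncell Q x m y Y (i + h) j * ncell Q x m y Y i (j + h)
    = be * (ncell Q x m y Y i j * ncell Q x m y Y (i + h) (j + h)) ->
  #|Y|%:R ^+ 2 <= Q%:R ^+ H * be * Q%:R ^+ 5 * ncell Q x m y Y i j
      * incid Y x m y (4 / Q%:R ^+ M) \/
  exists s, [/\ (h <= s)%N, (s <= H)%N &
     ncell Q x m y Y (i + s) j * ncell Q x m y Y i (j + s)
       <= (ncell Q x m y Y i j * Q%:R ^+ s * be * Q%:R ^+ 10) ^+ 2 * Q%:R ^+ s].
Proof.
move=> Qe eM QM Q614 h0 hH ijH Y0 unif be0 beE.
have [?|far] := pselect (exists s, [/\ (h <= s)%N, (s <= H)%N &
     ncell Q x m y Y (i + s) j * ncell Q x m y Y i (j + s)
       <= (ncell Q x m y Y i j * Q%:R ^+ s * be * Q%:R ^+ 10) ^+ 2 * Q%:R ^+ s]).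
  by right.
have {}far s : (h <= s)%N -> (s <= H)%N ->
     (ncell Q x m y Y i j * Q%:R ^+ s * be * Q%:R ^+ 10) ^+ 2 * Q%:R ^+ s
     <= ncell Q x m y Y (i + s) j * ncell Q x m y Y i (j + s).
  move=> hs sH; rewrite leNgt; apply/negP => lt; apply: far; exists s; split => //.
  exact: ltW.
left.
have Q0 : (0 < Q)%N by rewrite Qe expn_gt0.
have n0 : 0 < #|Y|%:R :> R by rewrite ltr0n.
have N0 a b : 0 < ncell Q x m y Y a b by apply: lt_le_trans (ncl_ge1 _ _ Y0).
set N := ncell Q x m y Y i j.
pose f := cell Q x m y i j.
pose f1 g := (cell Q x m y (i + h) j g, f g).
pose f2 g := (cell Q x m y i (j + h) g, f g).
(* Fine cells may cross the boundary of the coarse one, so lightness is tested on their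
   intersections with it. Joint classes are at most five times as many as fine cells, whence
   [40 = 8 * 5] below. *)
pose L0 := [set g in Y | #|cls Y f g|%:R * (8 * ncl R Y f) < #|Y|%:R].
pose L1 := [set g in Y | #|cls Y f1 g|%:R * (8 * ncl R Y f1) < #|Y|%:R].
pose L2 := [set g in Y | #|cls Y f2 g|%:R * (8 * ncl R Y f2) < #|Y|%:R].
have l0 : 8 * #|L0|%:R <= #|Y|%:R :> R by apply: light_bound.
have l1 : 8 * #|L1|%:R <= #|Y|%:R :> R by apply: light_bound.
have l2 : 8 * #|L2|%:R <= #|Y|%:R :> R by apply: light_bound.
pose G := Y :\: (L0 :|: L1 :|: L2).
have GY : G \subset Y by apply: subsetDl.
have Gn : 5 / 8 * #|Y|%:R <= #|G|%:R :> R.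
  have c : (#|Y| <= #|G| + (#|L0| + #|L1| + #|L2|))%N.
    rewrite -(cardsID (L0 :|: L1 :|: L2) Y) addnC leq_add2l.
    apply: (leq_trans (subset_leq_card (subsetIr _ _))).
    by apply: (leq_trans (leq_card_setU _ _)); rewrite leq_add2r leq_card_setU.
  have c' : #|Y|%:R <= #|G|%:R + (#|L0|%:R + #|L1|%:R + #|L2|%:R) :> R.
    by rewrite -!natrD ler_nat.
  by move: l0 l1 l2 c'; clear; lra.
have far0 g : g \in G -> #|Y|%:R <= 8 * N * #|cls Y f g|%:R.
  rewrite !inE !negb_or => /andP[/andP[/andP[g0 _] _] gY].
  by move: g0; rewrite gY /= -leNgt => g0; rewrite mulrC.
have N1j : ncl R Y f1 <= 5 * ncell Q x m y Y (i + h) j.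
  by have := @ncl_joint R I Q x m y Y i j h 0 Q0; rewrite addn0.
have N2j : ncl R Y f2 <= 5 * ncell Q x m y Y i (j + h).
  by have := @ncl_joint R I Q x m y Y i j 0 h Q0; rewrite addn0.
have G1 g : g \in G -> #|Y|%:R <= 40 * ncell Q x m y Y (i + h) j * #|cls Y f1 g|%:R.
  rewrite !inE !negb_or => /andP[/andP[/andP[_ g0] _] gY].
  move: g0; rewrite gY /= -leNgt => g0; apply: (le_trans g0); rewrite mulrC ler_wpM2r //.
  by move: N1j; clear; lra.
have G2 g : g \in G -> #|Y|%:R <= 40 * ncell Q x m y Y i (j + h) * #|cls Y f2 g|%:R.
  rewrite !inE !negb_or => /andP[/andP[/andP[_ _] g0] gY].
  move: g0; rewrite gY /= -leNgt => g0; apply: (le_trans g0); rewrite mulrC ler_wpM2r //.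
  by move: N2j; clear; lra.
pose D := [set k in G | #|cls Y f k|%:R <= 4 * #|G :&: cls Y f k|%:R :> R].
have Dn : 3 / 8 * #|Y|%:R <= #|D|%:R :> R.
  by have := rich_classes R f GY; move: Gn; rewrite -/D; clear; lra.
pose W := Q%:R ^+ H * be * Q%:R ^+ 4 : R.
have q0 s : 0 < Q%:R ^+ s :> R by rewrite exprn_gt0 // ltr0n.
have W0 : 0 < W by apply: mulr_gt0; [exact: mulr_gt0|exact: q0].
pose w := 4 / Q%:R ^+ M : R.
have loc k : k \in D -> #|Y|%:R / (8 * N) / W <= incid (cls Y f k) x m y w / #|cls Y f k|%:R.
  rewrite inE => /andP[kG rk]; have kY := fintype.subsetP GY _ kG.
  have r0 := cls_card_gt0 R f kY; have Sn : (0 < #|cls Y f k|)%N by rewrite -(ltr0n R).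
  have SY : cls Y f k \subset Y by apply/fintype.subsetP => g; rewrite mem_cls => /andP[].
  have ijM : (i + j <= M)%N by rewrite -ijH leq_addr.
  have cE a b g : g \in G :&: cls Y f k ->
      cls (cls Y f k) (cell Q x m y a b) g = cls Y (fun g' => (cell Q x m y a b g', f g')) g.
    rewrite inE mem_cls => /andP[_ /andP[_ /eqP gk]]; apply/setP => u.
    by rewrite !mem_cls xpair_eqE gk -andbA; congr (_ && _); exact: andbC.
  have Sl g : g \in cls Y f k -> cell Q x m y i j g = f k by rewrite mem_cls => /andP[_ /eqP].
  have GP g : g \in G :&: cls Y f k -> #|Y|%:R <= 40 * ncell Q x m y Y (i + h) j
      * #|cls (cls Y f k) (cell Q x m y (i + h) j) g|%:R.
    by move=> gGk; rewrite cE // G1 //; move: gGk; rewrite inE => /andP[].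
  have GL g : g \in G :&: cls Y f k -> #|Y|%:R <= 40 * ncell Q x m y Y i (j + h)
      * #|cls (cls Y f k) (cell Q x m y i (j + h)) g|%:R.
    by move=> gGk; rewrite cE // G2 //; move: gGk; rewrite inE => /andP[].
  have LI := local_incidence Qe eM QM Q614 h0 hH ijH Sn SY Sl (subsetIr _ _) unif be0 beE far
    (far0 _ kG) (unif _ _ ijM _ kY) rk GP GL.
  rewrite -/w -/W in LI.
  have N80 : 0 < 8 * N by rewrite mulr_gt0 // N0.
  rewrite ler_pdivrMr //; apply: (@le_trans _ _ #|cls Y f k|%:R).
    by rewrite ler_pdivrMr // mulrC far0.
  by rewrite mulrAC ler_pdivlMr // -expr2 [_ * W]mulrC.
have tot : #|D|%:R * (#|Y|%:R / (8 * N) / W) <= incid Y x m y w.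
  apply: le_trans (incid_classes Y x m y f w).
  have DY : D \subset Y.
    by apply: fintype.subset_trans GY; apply/fintype.subsetP => k; rewrite inE => /andP[].
  rewrite mulr_natl -sumr_const big_mkcond /= [X in _ <= X]big_mkcond /=.
  apply: ler_sum => k _; case kD: (k \in D); first by rewrite (fintype.subsetP DY) // loc.
  case: ifP => // _; rewrite divr_ge0 //.
  by apply: sumr_ge0 => a _; apply: sumr_ge0.
have N00 : 0 < N by apply: N0.
have z0 : 0 <= #|Y|%:R / (8 * N) / W.
  apply: divr_ge0; last exact: ltW.
  by apply: divr_ge0; [exact: ltW|apply: mulr_ge0; [exact: ler0n|exact: ltW]].
have {}tot := le_trans (ler_wpM2r z0 Dn) tot.
have e1 : 3 / 8 * #|Y|%:R * (#|Y|%:R / (8 * N) / W) = 3 / 64 * (#|Y|%:R ^+ 2 / (N * W)).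
  by field; rewrite !gt_eqF.
have NW : 0 < N * W by rewrite mulr_gt0.
have -> : Q%:R ^+ H * be * Q%:R ^+ 5 * N * incid Y x m y (4 / Q%:R ^+ M)
   = Q%:R * incid Y x m y w * (N * W) by rewrite /W /w; ring.
rewrite -ler_pdivrMr //.
have I0 : 0 <= incid Y x m y w by apply: sumr_ge0 => a _; apply: sumr_ge0.
rewrite e1 in tot; apply: (@le_trans _ _ (64 * incid Y x m y w)).
  by move: (#|Y|%:R ^+ 2 / (N * W)) tot I0 => v; clear; lra.
rewrite ler_wpM2r //.
by move: Q614; clear; lra.
Qed.

(** Two flags in one cell of level [(i, j)] are incident at scale [Q ^ -(i + j)], and by
    Cauchy-Schwarz many pairs share a cell. *)
Lemma trivial_incidence (R : realType) (I : finType) (Q i j : nat) (x m y : I -> R)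
    (Y : {set I}) : (0 < Q)%N ->
  #|Y|%:R ^+ 2 <= ncell Q x m y Y i j * incid Y x m y (4 / Q%:R ^+ (i + j)).
Proof.
move=> Q0; apply: (le_trans (ncl_cauchy R Y (cell Q x m y i j))).
rewrite ler_wpM2l ?ncl_ge0 //; apply: ler_sum => k kY.
rewrite -sumr_const big_mkcond /= [X in _ <= X]big_mkcond /=; apply: ler_sum => g _.
rewrite mem_cls; case gY: (g \in Y) => //=; case: eqP => // gk.
have -> : (`|slant x m y g k| < 4 / Q%:R ^+ (i + j)) = true => //.
have q0 : 0 < Q%:R ^+ (i + j) :> R by rewrite exprn_gt0 // ltr0n.
rewrite ltr_pdivlMr // -[X in _ * X](gtr0_norm q0) -normrM.
rewrite -(slant_local x m y i j (cell Q x m y i j k) g k Q0) /slant.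
have [gx gm gz] := loc_range gk; have [kx km kz] := loc_range (erefl (cell Q x m y i j k)).
move: (locx Q x _ _ g) (locx Q x _ _ k) (locm Q m _ _ k) (locy Q x y _ _ _ g)
  (locy Q x y _ _ _ k) gx kx km gz kz => a b c d e0 a1 b1 c1 d1 e1; clear - a1 b1 c1 d1 e1.
have cab : `|c * (a - b)| <= 1.
  rewrite normrM mulr_ile1 //; rewrite ler_norml; apply/andP; split; move: a1 b1 c1; lra.
by move: cab; rewrite ler_norml ltr_norml => /andP[? ?]; apply/andP; split; lra.
Qed.

(** * Logarithms of cell counts and the choice of parameters *)

Definition lg (R : realType) (Q : nat) (u : R) : R := ln u / ln Q%:R.

Section Log.
Variables (R : realType) (Q : nat).
Hypothesis Q1 : (1 < Q)%N.

Lemma lnQ_gt0 : 0 < ln Q%:R :> R.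
Proof using Q1. by apply: ln_gt0; rewrite ltr1n. Qed.

Lemma lg_le (u v : R) : 0 < u -> u <= v -> lg Q u <= lg Q v.
Proof using Q1.
move=> u0 uv; rewrite /lg ler_pM2r ?invr_gt0 ?lnQ_gt0 // ler_ln //.
by rewrite posrE (lt_le_trans u0).
Qed.

Lemma lgM (u v : R) : 0 < u -> 0 < v -> lg Q (u * v) = lg Q u + lg Q v.
Proof. by move=> u0 v0; rewrite /lg lnM // mulrDl. Qed.

Lemma lgX (n : nat) : lg Q (Q%:R ^+ n) = n%:R :> R.
Proof using Q1.
rewrite /lg lnXn; last by rewrite ltr0n ltnW.
by rewrite -[ln _ *+ n]mulr_natl mulfK // gt_eqF // lnQ_gt0.
Qed.
End Log.

Lemma incid_subset (R : realType) (I : finType) (A B : {set I}) (x m y : I -> R) (w : R) :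
  B \subset A -> incid B x m y w <= incid A x m y w.
Proof.
move=> /fintype.subsetP BA; rewrite /incid big_mkcond /= [X in _ <= X]big_mkcond /=.
apply: ler_sum => k _; case kB: (k \in B); last first.
  by case: ifP => // _; apply: sumr_ge0.
rewrite (BA _ kB) big_mkcond /= [X in _ <= X]big_mkcond /=.
by apply: ler_sum => j _; case jB: (j \in B); [rewrite (BA _ jB)|case: ifP].
Qed.

Lemma uniform_exponent (R : realType) (eps : R) : 0 < eps ->
  exists2 M : nat, (0 < M)%N & forall (I : finType) (Q e : nat) (x m y : I -> R)
    (Y : {set I}) (a : R),
    Q = (2 ^ e)%N -> (e * M < 16 * Q)%N -> 2 * 16 ^+ M <= Q%:R :> R ->
    64 * 600 * 16 <= Q%:R :> R -> 0 < a -> a <= 2 * Q%:R * #|Y|%:R ->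
    (forall g, g \in Y -> 0 <= x g < 1) -> (forall g, g \in Y -> 0 <= m g < 1) ->
    (forall g, g \in Y -> 0 <= y g < 1) -> uniform Q M x m y Y ->
    a ^+ 2 <= Q%:R `^ ((3 / 2 + eps) * M%:R) * incid Y x m y (4 / Q%:R ^+ M).
Proof.
(* The additive constant 20 is the square of [Q ^ 10] in [alternative]; all other losses are
   smaller. It does not involve [Q], so [M] is fixed before [Q]. *)
move=> eps0; have [M M0 bound] := @exponent_bound R eps 20 eps0 (ler0n _ _).
exists M => // I Q e x m y Y a Qe eM QM Q614 a0 aY x01 m01 y01 unif.
have Q5 : 5 <= Q%:R :> R by move: Q614; clear; lra.
have Q1 : (1 < Q)%N by rewrite -(ltr_nat R); move: Q5; clear; lra.
have Q0 : (0 < Q)%N by apply: ltnW.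
have QR : 0 < Q%:R :> R by rewrite ltr0n.
have q0 n : 0 < Q%:R ^+ n :> R by rewrite exprn_gt0.
have Y0 : (0 < #|Y|)%N.
  rewrite lt0n; apply/eqP => Y0; move: aY; rewrite Y0 mulr0 => h.
  by have := lt_le_trans a0 h; rewrite ltxx.
have n0 : 0 < #|Y|%:R :> R by rewrite ltr0n.
set N := ncell Q x m y Y.
have N0 i j : 0 < N i j by apply: lt_le_trans (ncl_ge1 _ _ Y0).
pose w := 4 / Q%:R ^+ M : R; set Itot := incid Y x m y w.
have I0 : 0 < Itot.
  have := trivial_incidence M 0 x m y Y Q0; rewrite addn0 -/w -/Itot -/N => h.
  have := lt_le_trans (exprn_gt0 2 n0) h.
  by rewrite pmulr_rgt0.
have lgQ : lg Q Q%:R = 1 :> R by apply: (@lgX R Q Q1 1).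
pose J := lg Q (a ^+ 2 / Itot); pose g i j := lg Q (N i j).
have a2 : a ^+ 2 <= Q%:R ^+ 3 * #|Y|%:R ^+ 2.
  apply: (@le_trans _ _ ((2 * Q%:R * #|Y|%:R) ^+ 2)).
    by rewrite ler_pXn2r ?nnegrE // ltW // mulr_gt0 // mulr_gt0.
  have -> : (2 * Q%:R * #|Y|%:R) ^+ 2 = 4 * (Q%:R ^+ 2 * #|Y|%:R ^+ 2) :> R by ring.
  rewrite [Q%:R ^+ 3]exprS -mulrA ler_wpM2r //.
  by move: Q5; clear; lra.
have JT v : 0 < v -> #|Y|%:R ^+ 2 <= v * Itot -> J <= 3 + lg Q v.
  move=> v0 nv; rewrite -(@lgX R Q Q1 3) -lgM // /J; apply: lg_le => //.
    by rewrite divr_gt0 // exprn_gt0.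
  rewrite ler_pdivrMr //; apply: (le_trans a2).
  by rewrite -[X in _ <= X]mulrA; apply: ler_wpM2l nv; exact: ltW.
have step i j h1 h2 : (h1 + h2 = 1)%N -> `|g (i + h1)%N (j + h2)%N - g i j| <= 3.
  move=> h12; have up := @ncl_fine R I Q x m y Y i j h1 h2 Q0.
  have dn := @ncl_coarse R I Q x m y Y i j h1 h2 Q0.
  have e3 : (2 * Q ^ (2 * (h1 + h2)))%N%:R <= Q%:R ^+ 3 :> R.
    rewrite h12 natrM natrX [Q%:R ^+ 3]exprS ler_wpM2r ?exprn_even_ge0 //.
    by move: Q5; clear; lra.
  have e5 : 5 <= Q%:R ^+ 3 :> R.
    apply: (le_trans Q5); rewrite -[X in X <= _]expr1 ler_weXn2l // ler1n.
    exact: ltnW.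
  have u1 : g (i + h1)%N (j + h2)%N <= 3 + g i j.
    rewrite /g -(@lgX R Q Q1 3) -lgM //; apply: lg_le => //.
    by apply: (le_trans up); apply: ler_wpM2r e3; exact: ltW (N0 _ _).
  have u2 : g i j <= 3 + g (i + h1)%N (j + h2)%N.
    rewrite /g -(@lgX R Q Q1 3) -lgM //; apply: lg_le => //.
    by apply: (le_trans dn); apply: ler_wpM2r e5; exact: ltW (N0 _ _).
  by rewrite ler_norml; apply/andP; split; move: u1 u2; clear; lra.
have GJ : J <= (3 / 2 + eps) * M%:R.
  apply: (bound g J).
  - apply: (@le_trans _ _ 1%N%:R); last by rewrite ler_nat.
    rewrite /g -(@lgX R Q Q1 1); apply: lg_le => //.
    apply: (le_trans (ncl_unit 0 0 Q0 x01 m01 y01)).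
    by rewrite muln0 expn0 muln1 expr1 ler_nat.
  - by move=> i j _; have := step i j 1%N 0%N erefl; rewrite addn1 addn0.
  - by move=> i j _; have := step i j 0%N 1%N erefl; rewrite addn1 addn0.
  - move=> i j ijM; have := trivial_incidence i j x m y Y Q0; rewrite ijM => /JT.
    by move=> /(_ (N0 i j)); rewrite -/(g i j); clear; lra.
  move=> i j h h0 ijh; set H := (M - (i + j))%N.
  have ijH : (i + j + H = M)%N by rewrite subnKC // (leq_trans _ ijh) // leq_addr.
  have hH : (h + h <= H)%N by rewrite addnn -mul2n leq_subRL // (leq_trans _ ijh) // leq_addr.
  have [be beD] : {be | be = N (i + h)%N j * N i (j + h)%N / (N i j * N (i + h)%N (j + h)%N)}.
    by eexists.
  have be0 : 0 < be by rewrite beD divr_gt0 // mulr_gt0.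
  have beE : N (i + h)%N j * N i (j + h)%N = be * (N i j * N (i + h)%N (j + h)%N).
    by rewrite beD mulfVK // gt_eqF // mulr_gt0.
  have lbe : lg Q be = mixed g i j h.
    have := congr1 (lg Q) beE; rewrite !lgM ?mulr_gt0 // -!/(g _ _) /mixed.
    by clear; lra.
  have [A|[s [hs sH A]]] := alternative Qe eM QM Q614 h0 hH ijH Y0 unif be0 beE.
    left; have v0 : 0 < Q%:R ^+ H * be * Q%:R ^+ 5 * N i j by rewrite !mulr_gt0.
    have := JT _ v0 A; rewrite !lgM ?mulr_gt0 // !lgX // ?lgQ lbe -/(g i j).
    by clear; lra.
  right; exists s; split=> //; first by rewrite -ijH leq_add2l.
  have p1 : 0 < N (i + s)%N j * N i (j + s)%N by rewrite mulr_gt0.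
  have := lg_le Q1 p1 A; rewrite expr2 !lgM ?mulr_gt0 // !lgX // ?lgQ lbe -!/(g _ _).
  by clear; lra.
have L0 := @lnQ_gt0 R Q Q1.
rewrite -ler_pdivrMr // -[X in X <= _]lnK ?posrE ?divr_gt0 ?exprn_gt0 //.
rewrite /powR gt_eqF // ler_expR.
by move: GJ; rewrite /J /lg ler_pdivrMr.
Qed.

Lemma sqr_lt_expn2 l : (l * l < 16 * 2 ^ l)%N.
Proof.
elim: l => // l IH; have [l2|l2] := leqP l 2; first by case: l l2 {IH} => [|[|[|]]].
rewrite expnS; move: (2 ^ l)%N IH => p IH; nia.
Qed.

Lemma dyadic_incidence (R : realType) (eps : R) : 0 < eps ->
  exists2 M : nat, (0 < M)%N & exists l0 : nat, forall l, (l0 <= l)%N ->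
    forall (I : finType) (x m y : I -> R) (A : {set I}),
    (forall g, g \in A -> 0 <= x g < 1) -> (forall g, g \in A -> 0 <= m g < 1) ->
    (forall g, g \in A -> 0 <= y g < 1) ->
    #|A|%:R ^+ 2 <= (2 ^ l)%N%:R `^ ((3 / 2 + eps) * M%:R)
      * incid A x m y (4 / (2 ^ l)%N%:R ^+ M).
Proof.
move=> /uniform_exponent[M M0 main]; exists M => //.
(* [k] is twice the number of levels, and [a] is the exponent for which a bound [Q ^ (4 * M + 1)] at
   every level multiplies up to [Q ^ a]. Then [k ^ a <= 2 ^ (k * a) <= Q], as [uniform_subset]
   requires. *)
have [k kE] : {k | k = (2 * (M.+1 * M.+1))%N} by eexists.
have [a aE] : {a | a = ((4 * M + 1) * (M.+1 * M.+1))%N} by eexists.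
(* The summands give, in turn, [64 * 600 * 16 <= 2 ^ 20 <= Q], then [2 * 16 ^ M <= Q], then the
   bound on [k ^ a]. *)
exists (20 + (4 * M + 1) + k * a)%N => l ll I x m y A x01 m01 y01.
have [l20 lM lka] : [/\ (20 <= l)%N, (4 * M + 1 <= l)%N & (k * a <= l)%N].
  by move: ll; clear; move: (k * a)%N => ? ?; split; lia.
have [A0|A0] := posnP #|A|.
  by rewrite A0 expr0n /= mulr_ge0 ?powR_ge0 //; apply: sumr_ge0 => ? _; apply: sumr_ge0.
have [Q QE] : {Q | Q = (2 ^ l)%N} by eexists.
rewrite -QE.
have Q0 : (0 < Q)%N by rewrite QE expn_gt0.
have QR : 0 < Q%:R :> R by rewrite ltr0n.
have Q1 : 1 <= Q%:R :> R by rewrite ler1n.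
have leQ n : (n <= l)%N -> 2 ^+ n <= Q%:R :> R.
  by move=> nl; rewrite -natrX QE ler_nat leq_exp2l.
pose J := ('I_M.+1 * 'I_M.+1)%type; pose f (ij : J) := cell Q x m y ij.1 ij.2.
have cJ : #|{: J}| = (M.+1 * M.+1)%N by rewrite card_prod card_ord.
have Q2 : 2 <= Q%:R :> R by rewrite -[X in X <= _]expr1 leQ // (leq_trans _ l20).
have NB z : ncl R A (f z) <= Q%:R ^+ (4 * M + 1).
  apply: (le_trans (ncl_unit _ _ Q0 x01 m01 y01)).
  rewrite natrM natrX addn1 exprS; apply: ler_pM => //.
  rewrite ler_weXn2l //; case: z => z1 z2 /=.
  by have := ltn_ord z1; have := ltn_ord z2; clear; lia.
have a_gt0 : (0 < a)%N by rewrite aE muln_gt0 addn1.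
have BQ : (Q%:R ^+ (4 * M + 1)) ^+ #|{: J}| <= Q%:R ^+ a :> R.
  by rewrite -exprM cJ aE.
have JQ : (2 * #|{: J}|%:R) ^+ a <= Q%:R :> R.
  rewrite cJ -natrM -kE -natrX QE ler_nat; apply: (@leq_trans (2 ^ (k * a))).
    by rewrite expnM leq_exp2r // ltnW // ltn_expl.
  by rewrite leq_exp2l.
have [Y [YA AY unif]] := uniform_subset A0 a_gt0 QR NB BQ JQ.
have YB := fintype.subsetP YA.
have {}unif : uniform Q M x m y Y.
  move=> i j ijM g gY.
  have iM : (i < M.+1)%N by rewrite ltnS (leq_trans _ ijM) // leq_addr.
  have jM : (j < M.+1)%N by rewrite ltnS (leq_trans _ ijM) // leq_addl.
  exact: (unif (Ordinal iM, Ordinal jM) g gY).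
have p0 : 0 <= Q%:R `^ ((3 / 2 + eps) * M%:R) by apply: powR_ge0.
apply: le_trans (ler_wpM2l p0 (incid_subset _ _ _ _ YA)).
apply: (main I Q l) => //.
- rewrite QE; apply: leq_ltn_trans (sqr_lt_expn2 l); rewrite leq_mul2l; apply/orP; right.
  by apply: leq_trans lM; rewrite -{1}[M]mul1n (leq_trans _ (leq_addr _ _)) // leq_mul2r orbT.
- have -> : 2 * 16 ^+ M = 2 ^+ (4 * M + 1) :> R.
    by rewrite addn1 exprS exprM; congr (2 * _ ^+ _); ring.
  exact: leQ.
- apply: le_trans (leQ _ l20).
  have -> : 2 ^+ 20 = 16 * 16 * 16 * 16 * 16 :> R by ring.
  by clear; lra.
- by rewrite ltr0n.
- by move=> g /YB /x01.
- by move=> g /YB /m01.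
- by move=> g /YB /y01.
Qed.

(** * From tubes to flags *)

(** [32 = 8 * 4]: passing to flags divides slants by 8, and incidences are counted at scale
    [4 / Q ^ M]. The least admissible [l] overshoots by at most [2 ^ M], unless it is [l0]
    itself. *)
Lemma scale_choice (R : realType) (delta : R) (M l0 : nat) : (0 < M)%N ->
  0 < delta -> delta <= 1 ->
  exists l, [/\ (l0 <= l)%N, 32 <= delta * (2 ^ l)%N%:R ^+ M &
    delta * (2 ^ l)%N%:R ^+ M <= 32 * 2 ^+ M * (2 ^ l0)%N%:R ^+ M].
Proof.
move=> M0 d0 d1; pose P l := (l0 <= l)%N && (32 <= delta * (2 ^ l)%N%:R ^+ M).
have exP : exists l, P l.
  exists (l0 + Num.bound (32 / delta))%N; rewrite /P leq_addr /=.
  have := archi_boundP (ltW (divr_gt0 (ltr0n R 32) d0)).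
  set b := Num.bound _ => hb.
  rewrite -ler_pdivrMl // mulrC; apply: (le_trans (ltW hb)).
  rewrite -natrX ler_nat; apply: (@leq_trans (2 ^ (l0 + b))).
    apply: (@leq_trans (2 ^ b)); first exact/ltnW/ltn_expl.
    by rewrite leq_exp2l // leq_addl.
  by rewrite -[X in (X <= _)%N]expn1 leq_pexp2l // expn_gt0.
case: (ex_minnP exP) => l /andP[l0l h32] lmin; exists l; split=> //.
have p0 k : 0 < (2 ^ k)%N%:R ^+ M :> R by rewrite exprn_gt0 // ltr0n expn_gt0.
have [ll|ll] := eqVneq l l0.
  rewrite ll ler_wpM2r ?(ltW (p0 _)) //.
  apply: (le_trans d1); rewrite -[X in X <= _]mulr1; apply: ler_pM => //.
    by rewrite ler1n.
  by rewrite exprn_ege1 // ler1n.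
have l1 : (l0 < l)%N by rewrite ltn_neqAle eq_sym ll.
case: l l0l h32 lmin ll l1 => // l l0l h32 lmin ll l1.
have : ~~ P l by apply/negP => /lmin; rewrite ltnn.
rewrite /P -ltnS l1 /= -ltNge => h.
have -> : delta * (2 ^ l.+1)%N%:R ^+ M = (delta * (2 ^ l)%N%:R ^+ M) * 2 ^+ M :> R.
  by rewrite expnS natrM exprMn; ring.
apply: (@le_trans _ _ (32 * 2 ^+ M)).
  by rewrite ler_wpM2r ?exprn_ge0 // ltW.
by rewrite ler_peMr ?mulr_ge0 ?exprn_ge0 // exprn_ege1 // ler1n expn_gt0.
Qed.

Lemma tube_direction (R : realType) (delta : R) (T : set 'rV[R]_2) (p : 'rV[R]_2) :
  tube_through delta T p ->
  exists2 v : 'rV[R]_2, v != 0 & forall q t, Defs.edist q (p + t *: v) < delta -> q \in T.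
Proof.
move=> [L [[a [v [v0 ->]]] ->] [s _ <-]]; exists v => // q t h.
rewrite inE; exists (a + s *: v + t *: v) => //.
by exists (s + t) => //; rewrite scalerDl addrA.
Qed.

Lemma sum_ord2 (R : realType) (F : 'I_2 -> R) (c : 'I_2) :
  \sum_(i < 2) F i = F c + F (rev_ord c).
Proof.
rewrite !big_ord_recl big_ord0 addr0.
case: c => [[|[|//]] i]; [|rewrite addrC]; congr (F _ + F _); exact/val_inj.
Qed.

Lemma edist_vertical (R : realType) (c : 'I_2) (p q : 'rV[R]_2) :
  p 0 c = q 0 c -> Defs.edist p q = `|p 0 (rev_ord c) - q 0 (rev_ord c)|.
Proof.
by move=> pq; rewrite /Defs.edist (sum_ord2 _ c) pq subrr expr0n /= add0r sqrtr_sqr.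
Qed.

Lemma incidences_sum (R : realType) (n : nat) (p : 'I_n -> 'rV[R]_2)
    (T : 'I_n -> set 'rV[R]_2) :
  (incidences p T)%:R = \sum_k \sum_j (p j \in T k)%:R :> R.
Proof.
rewrite exchange_big /= pair_big /= /incidences -sum1_card natr_sum big_mkcond /=.
by apply: eq_bigr => jk _; rewrite -topredE /=; case: (_ \in _).
Qed.

Section Steep.
Variables (R : realType) (n : nat) (p v : 'I_n -> 'rV[R]_2) (c : 'I_2).
Definition flat : {set 'I_n} := [set k | `|v k 0 (rev_ord c)| <= `|v k 0 c|].
(* [slant] scales by 1/8 while all three coordinates land in [0, 1/2]. *)
Definition fx k : R := p k 0 c / 2.
Definition fm k : R := (v k 0 (rev_ord c) / v k 0 c + 1) / 4.
Definition fy k : R := (p k 0 (rev_ord c) + p k 0 c) / 8.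

Lemma slant_flag j k : slant fx fm fy j k * 8
  = p j 0 (rev_ord c) - p k 0 (rev_ord c)
    - v k 0 (rev_ord c) / v k 0 c * (p j 0 c - p k 0 c).
Proof. by rewrite /slant /fx /fm /fy; move: (_ / v k 0 c) => s; field. Qed.

Hypothesis v0 : forall k, v k != 0.
Hypothesis p01 : forall k, unit_square (p k).

Lemma flat_neq0 k : k \in flat -> v k 0 c != 0.
Proof using v0.
rewrite inE => h; apply/eqP => vc; move: h; rewrite vc normr0 normr_le0 => /eqP vr.
have /eqP[] := v0 k; apply/rowP => i; rewrite mxE.
have [->|->] : i = c \/ i = rev_ord c; last by [].
  case: (c) i => [[|[|//]] ?] [[|[|//]] ?];
    by [left; apply/val_inj|right; apply/val_inj].
by [].
Qed.

Lemma fx_range k : 0 <= fx k < 1.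
Proof using p01. by have /andP[] := p01 k c; rewrite /fx => *; apply/andP; split; lra. Qed.

Lemma fy_range k : 0 <= fy k < 1.
Proof using p01.
have /andP[] := p01 k c; have /andP[] := p01 k (rev_ord c); rewrite /fy => *.
by apply/andP; split; lra.
Qed.

Lemma fm_range k : k \in flat -> 0 <= fm k < 1.
Proof using v0.
move=> kf; have vc := flat_neq0 kf; move: kf; rewrite inE => h.
have : `|v k 0 (rev_ord c) / v k 0 c| <= 1.
  by rewrite normrM normfV ler_pdivrMr ?mul1r // normr_gt0.
rewrite ler_norml /fm => /andP[? ?]; apply/andP; split; lra.
Qed.

Lemma flat_incid (delta w : R) (T : 'I_n -> set 'rV[R]_2) : 8 * w <= delta ->
  (forall k q t, Defs.edist q (p k + t *: v k) < delta -> q \in T k) ->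
  incid flat fx fm fy w <= (incidences p T)%:R.
Proof using v0.
move=> wd HT; rewrite incidences_sum /incid big_mkcond /=; apply: ler_sum => k _.
case: ifP => kf; last by apply: sumr_ge0.
rewrite big_mkcond /=; apply: ler_sum => j _; case: ifP => jf //.
case: ltP => // h; have vc := flat_neq0 kf.
suff -> : p j \in T k by [].
(* The point of the central line with the same coordinate [c] as [p j]; the distance to it is the
   slant up to the factor 8, and it bounds the distance to the line. *)
apply: (HT k (p j) ((p j 0 c - p k 0 c) / v k 0 c)).
rewrite (@edist_vertical _ c); last by rewrite !mxE mulfVK //; ring.
apply: lt_le_trans wd; rewrite -ltr_pdivrMl // mulrC -[8^-1]gtr0_norm // -normrM.
suff -> : (p j 0 (rev_ord c) - (p k + ((p j 0 c - p k 0 c) / v k 0 c) *: v k) 0 (rev_ord c)) / 8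
  = slant fx fm fy j k by [].
by apply: (canLR (mulfK _)) => //; rewrite slant_flag !mxE; ring.
Qed.
End Steep.

Lemma flat_large (R : realType) (n : nat) (v : 'I_n -> 'rV[R]_2) :
  exists c, (n <= 2 * #|flat v c|)%N.
Proof.
have cov : (n <= #|flat v ord0| + #|flat v (rev_ord ord0)|)%N.
  rewrite -{1}[n]card_ord; apply: leq_trans (leq_card_setU _ _).
  apply/subset_leq_card/fintype.subsetP => k _; rewrite !inE rev_ordK.
  by case: leP => // /ltW.
have [h|h] := leqP n (2 * #|flat v ord0|); first by exists ord0.
by exists (rev_ord ord0); move: cov h; clear; lia.
Qed.

Local Open Scope classical_set_scope.
Local Open Scope ring_scope.

Theorem corollary1p3 (R : realType) (eps : R) (eps_gt0 : 0 < eps) :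
  exists2 c : R, 0 < c &
    forall (delta : R) (n : nat)
           (p : 'I_n -> 'rV[R]_2) (T : 'I_n -> set 'rV[R]_2),
      0 < delta -> delta <= 1 ->
      (forall j, unit_square (p j)) ->
      (forall j, tube_through delta (T j) (p j)) ->
      c * delta `^ (3 / 2 + eps) * n%:R * n%:R <= (incidences p T)%:R.
Proof.
have [M M0 [l0 main]] := dyadic_incidence eps_gt0.
have [s sE] : {s | s = 3 / 2 + eps} by eexists.
have s0 : 0 <= s by move: eps_gt0; rewrite sE; clear; lra.
rewrite -sE in main *.
have [D DE] : {D : R | D = 32 * 2 ^+ M * (2 ^ l0)%N%:R ^+ M} by eexists.
have D0 : 0 < D.
  by rewrite DE; apply: mulr_gt0; [apply: mulr_gt0|]; rewrite ?exprn_gt0 ?ltr0n ?expn_gt0.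
have Ds : 0 < D `^ s by apply: powR_gt0.
(* At least half of the directions are flat for some axis, so [n ^ 2] is at most 4 times the square
   of their number. The factor [D ^ s] comes from [delta * Q ^ M <= D]. *)
exists (4 * D `^ s)^-1; first by rewrite invr_gt0 mulr_gt0.
move=> delta n p T d0 d1 psq tube.
have dir k : exists v : 'rV[R]_2, v != 0 /\
    forall q t, Defs.edist q (p k + t *: v) < delta -> q \in T k.
  by have [v v0 h] := tube_direction (tube k); exists v.
have [v vP] := choice dir.
have [c nc] := flat_large v.
have [l [ll l32 lD]] := scale_choice l0 M0 d0 d1.
rewrite -DE in lD.
have [q qE] : {q : R | q = (2 ^ l)%N%:R ^+ M} by eexists.
have q0 : 0 < q by rewrite qE exprn_gt0 // ltr0n expn_gt0.
have v0 k : v k != 0 by have [] := vP k.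
have := main l ll 'I_n (fx p c) (fm v c) (fy p c) (flat v c)
  (fun k _ => fx_range c psq k) (fun k kf => fm_range v0 kf) (fun k _ => fy_range c psq k).
rewrite [s * _]mulrC powRrM powR_mulrn // -qE => bound.
rewrite -qE in l32 lD.
have wd : 8 * (4 / q) <= delta.
  by rewrite mulrA -natrM ler_pdivrMr.
have fI := @flat_incid R n p v c v0 delta (4 / q) T wd (fun k => (vP k).2).
have n2 : n%:R * n%:R <= 4 * #|flat v c|%:R ^+ 2 :> R.
  have nc' : n%:R <= 2 * #|flat v c|%:R :> R by rewrite -natrM ler_nat.
  have -> : 4 * #|flat v c|%:R ^+ 2 = (2 * #|flat v c|%:R) * (2 * #|flat v c|%:R) :> R by ring.
  exact: ler_pM.
have dq : delta `^ s * q `^ s <= D `^ s.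
  rewrite -powRM; [|exact: ltW|exact: ltW].
  by apply: ge0_ler_powR => //; rewrite nnegrE ltW // mulr_gt0.
rewrite -!mulrA ler_pdivrMl ?mulr_gt0 //.
have ds : 0 <= delta `^ s by apply: powR_ge0.
apply: (le_trans (ler_wpM2l ds n2)).
apply: (@le_trans _ _ (4 * (delta `^ s * q `^ s
  * incid (flat v c) (fx p c) (fm v c) (fy p c) (4 / q)))).
  rewrite mulrCA -[delta `^ s * _ * _]mulrA; apply: ler_wpM2l => //; exact: ler_wpM2l.
rewrite -[X in _ <= X]mulrA; apply: ler_wpM2l => //; apply: ler_pM => //.
  by rewrite mulr_ge0 ?powR_ge0.
by apply: sumr_ge0 => k _; apply: sumr_ge0.
Qed.
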